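(* The triangulated category $\mathrm{D}^{\mathrm b}_{\mathrm{PL}}(\mathbf{k}_{\mathbb V})$ is generated by the family $\{\mathbf k_P\}$ where $P$ ranges over the family of locally closed convex polyhedra of $\mathbb V$.
   Context: $\mathbb V$ is a real finite-dimensional vector space and $\mathbf k$ is a field. $\mathrm{D}^{\mathrm b}(\mathbf{k}_{\mathbb V})$ is the bounded derived category of sheaves of $\mathbf k$-modules on $\mathbb V$. For a locally closed subset $Z\subset\mathbb V$, $\mathbf k_Z$ is the constant sheaf with stalk $\mathbf k$ on $Z$ extended by $0$ on $\mathbb V\setminus Z$. A convex polyhedron in $\mathbb V$ is the intersection of a finite family of open or closed affine half-spaces. An object $F\in \mathrm{D}^{\mathrm b}(\mathbf{k}_{\mathbb V})$ is PL if there exists a finite family $\{P_a\}_{a\in A}$ of convex polyhedra such that $\mathbb V=\bigcup_{a\in A}P_a$ and $F|_{P_a}$ is constant of finite rank for every $a\in A$. $\mathrm{D}^{\mathrm b}_{\mathrm{PL}}(\mathbf{k}_{\mathbb V})$ is the full (triangulated) subcategory of $\mathrm{D}^{\mathrm b}(\mathbf{k}_{\mathbb V})$ of PL objects. A family $\mathscr G$ of objects of a triangulated category $\mathscr D$ generates $\mathscr D$ if for every object $F\in\mathscr D$ there exist a finite sequence $F_0,\dots,F_N$ in $\mathscr D$ with $F_0=0$, $F_N=F$ and distinguished triangles $F_k\to F_{k+1}\to G_k[m_k]\xrightarrow{+1}$ for $0\le k<N$, with $m_k\in\mathbb Z$ and $G_k\in\mathscr G$ (where $\mathscr G$ is considered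 up to isomorphism). Equivalently, $\mathscr D$ is the smallest triangulated subcategory of $\mathscr D$ containing $\mathscr G$. *)

(* Defs.v *)
From HB Require Import structures.
From mathcomp Require Import all_boot all_order all_algebra.
From mathcomp Require Import generic_quotient.
From mathcomp Require Import boolp classical_sets functions reals topology.
From mathcomp Require Import normedtype.

Set Implicit Arguments.
Unset Strict Implicit.
Unset Printing Implicit Defensive.

Import Order.TTheory GRing.Theory Num.Theory.
Import numFieldNormedType.Exports.

Local Open Scope classical_set_scope.
Local Open Scope quotient_scope.
Local Open Scope ring_scope.

Record opens (T : topologicalType) := Opens {
  oset :> set T;
  oset_open : open oset }.

Definition omem (T : topologicalType) (U : opens T) : T -> Prop := oset U.
Coercion omem : opens >-> Funclass.

Definition opensI (T : topologicalType) (U W : opens T) : opens T :=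
  @Opens T (oset U `&` oset W) (openI (oset_open U) (oset_open W)).

Definition opensT (T : topologicalType) : opens T := @Opens T setT openT.

Lemma opensIl (T : topologicalType) (U W : opens T) : opensI U W `<=` U.
Proof. exact: subIsetl. Qed.

Lemma opensIr (T : topologicalType) (U W : opens T) : opensI U W `<=` W.
Proof. exact: subIsetr. Qed.

Record sheaf (k : fieldType) (T : topologicalType) := Sheaf {
  sec :> opens T -> lmodType k;
  res : forall U W : opens T, W `<=` U -> sec U -> sec W;
  res_linear : forall (U W : opens T) (h : W `<=` U), linear (res h);
  res_id : forall (U : opens T) (h : U `<=` U) (s : sec U), res h s = s;
  res_comp : forall (U W O : opens T) (hWU : W `<=` U) (hOW : O `<=` W)
      (hOU : O `<=` U) (s : sec U), res hOW (res hWU s) = res hOU s;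
  sheaf_glue : forall (I : Type) (U : opens T) (W : I -> opens T)
      (hW : forall i, W i `<=` U),
    (forall x, U x -> exists i, W i x) ->
    forall s : forall i, sec (W i),
    (forall i j, res (@opensIl T (W i) (W j)) (s i)
               = res (@opensIr T (W i) (W j)) (s j)) ->
    exists! t : sec U, forall i, res (hW i) t = s i }.

HB.instance Definition _ k T (F : sheaf k T) (U W : opens T) (h : W `<=` U) :=
  GRing.isLinear.Build k (F U) (F W) *:%R (res h) (res_linear h).

Record hom (k : fieldType) (T : topologicalType) (F G : sheaf k T) := Hom {
  hfun :> forall U : opens T, F U -> G U;
  hom_linear : forall U, linear (@hfun U);
  hom_natural : forall (U W : opens T) (h : W `<=` U) (s : F U),
    res h (hfun s) = hfun (res h s) }.

HB.instance Definition _ k T (F G : sheaf k T) (f : hom F G) (U : opens T) :=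
  GRing.isLinear.Build k (F U) (G U) *:%R (@hfun k T F G f U)
    (@hom_linear k T F G f U).

Section HomOps.
Context (k : fieldType) (T : topologicalType).
Implicit Types F G H : sheaf k T.

Definition hid F : hom F F.
Proof. by exists (fun U s => s). Defined.

Definition hzero F G : hom F G.
Proof.
exists (fun U s => 0) => [U a u v|U W h s]; first by rewrite scaler0 addr0.
by rewrite linear0.
Defined.

Definition hcomp F G H (g : hom G H) (f : hom F G) : hom F H.
Proof.
exists (fun U s => g U (f U s)) => [U a u v|U W h s]; first by rewrite !linearP.
by rewrite !hom_natural.
Defined.

Definition hscale F G (a : k) (f : hom F G) : hom F G.
Proof.
exists (fun U s => a *: f U s) => [U b u v|U W h s].
  by rewrite linearP scalerDr !scalerA mulrC.
by rewrite linearZ /= hom_natural.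
Defined.

(* The identity of Y i if i = j, and zero otherwise: the degrees i and j of a
   complex may be equal without being convertible. *)
Definition hdelta (Y : int -> sheaf k T) (i j : int) : hom (Y i) (Y j) :=
  match i =P j with
  | ReflectT e => eq_rect i (fun l => hom (Y i) (Y l)) (hid (Y i)) j e
  | ReflectF _ => hzero (Y i) (Y j)
  end.

Lemma hdelta_id (Y : int -> sheaf k T) i U (s : Y i U) : hdelta Y i i U s = s.
Proof.
rewrite /hdelta; case: eqP => // e.
by rewrite (eq_irrelevance e (erefl i)).
Qed.

Lemma hdelta_neq (Y : int -> sheaf k T) i j U (s : Y i U) :
  i != j -> hdelta Y i j U s = 0.
Proof. by rewrite /hdelta; case: eqP. Qed.

End HomOps.
Arguments hdelta {k T} Y i j.

(* Sheaves whose sections over U are the families of elements of E x, for x in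
   U, subject to a condition that is linear and local. *)
Section LocalSections.
Context (k : fieldType) (T : topologicalType) (E : T -> lmodType k).

Definition family_restrict (U W : opens T) (h : W `<=` U)
    (s : forall x, U x -> E x) : forall x, W x -> E x :=
  fun x Wx => s x (h x Wx).

Record local_cond := LocalCond {
  lc : forall U : opens T, (forall x, U x -> E x) -> Prop;
  lc0 : forall U : opens T, @lc U (fun x _ => 0);
  lcP : forall (U : opens T) (a : k) s t, @lc U s -> @lc U t ->
    @lc U (fun x Ux => a *: s x Ux + t x Ux);
  lc_restrict : forall (U W : opens T) (h : W `<=` U) s, @lc U s ->
    @lc W (family_restrict h s);
  lc_local : forall (U : opens T) s,
    (forall x, U x -> exists (W : opens T) (h : W `<=` U),
       W x /\ @lc W (family_restrict h s)) -> @lc U s }.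

Variable P : local_cond.

Record lsec (U : opens T) := LSec {
  lfun :> forall x, U x -> E x;
  lfunP : lc P lfun }.

Section Module.
Variable U : opens T.
Implicit Types s t : lsec U.

Lemma lsec_ext s t : (forall x Ux, s x Ux = t x Ux) -> s = t.
Proof.
case: s t => [s Ps] [t Pt] /= st.
have e : s = t by apply: functional_extensionality_dep => x;
  apply: functional_extensionality_dep => Ux; exact: st.
by subst t; congr LSec; exact: Prop_irrelevance.
Qed.

Definition lsec0 : lsec U := LSec (lc0 P U).
Definition lsecP (a : k) s t : lsec U := LSec (lcP a (lfunP s) (lfunP t)).

HB.instance Definition _ := gen_eqMixin (lsec U).
HB.instance Definition _ := gen_choiceMixin (lsec U).

Fact lsec_addA : associative (lsecP 1).
Proof. by move=> s t u; apply: lsec_ext => x Ux /=; rewrite !scale1r addrA. Qed.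
Fact lsec_addC : commutative (lsecP 1).
Proof. by move=> s t; apply: lsec_ext => x Ux /=; rewrite !scale1r addrC. Qed.
Fact lsec_add0 : left_id lsec0 (lsecP 1).
Proof. by move=> s; apply: lsec_ext => x Ux /=; rewrite scale1r add0r. Qed.
Fact lsec_addN : left_inverse lsec0 (fun s => lsecP (- 1) s lsec0) (lsecP 1).
Proof.
by move=> s; apply: lsec_ext => x Ux /=; rewrite scaleN1r scale1r addr0 addNr.
Qed.

HB.instance Definition _ :=
  GRing.isZmodule.Build (lsec U) lsec_addA lsec_addC lsec_add0 lsec_addN.

Definition lsec_scale (a : k) s : lsec U := lsecP a s lsec0.

Lemma lsecDE s t x Ux : (s + t) x Ux = s x Ux + t x Ux.
Proof. by rewrite -[s x Ux]scale1r. Qed.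

Lemma lsec_scaleE a s x Ux : lsec_scale a s x Ux = a *: s x Ux.
Proof. by rewrite -[RHS]addr0. Qed.

Fact lsec_scaleA a b s : lsec_scale a (lsec_scale b s) = lsec_scale (a * b) s.
Proof. by apply: lsec_ext => x Ux; rewrite !lsec_scaleE scalerA. Qed.
Fact lsec_scale1 : left_id 1 lsec_scale.
Proof. by move=> s; apply: lsec_ext => x Ux; rewrite !lsec_scaleE scale1r. Qed.
Fact lsec_scaleDr : right_distributive lsec_scale +%R.
Proof.
move=> a s t; apply: lsec_ext => x Ux.
by rewrite !(lsec_scaleE, lsecDE) scalerDr.
Qed.
Fact lsec_scaleDl s : {morph lsec_scale^~ s : a b / a + b}.
Proof.
move=> a b; apply: lsec_ext => x Ux.
by rewrite !(lsec_scaleE, lsecDE) scalerDl.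
Qed.

HB.instance Definition _ := GRing.Zmodule_isLmodule.Build k (lsec U)
  lsec_scaleA lsec_scale1 lsec_scaleDr lsec_scaleDl.

Lemma lsecZE a s x Ux : (a *: s) x Ux = a *: s x Ux.
Proof. exact: lsec_scaleE. Qed.

Lemma lsecPE a s t x Ux : (a *: s + t) x Ux = a *: s x Ux + t x Ux.
Proof. by rewrite lsecDE lsecZE. Qed.

Lemma lsec0E x Ux : (0 : lsec U) x Ux = 0.
Proof. by []. Qed.

End Module.

Definition lsec_res (U W : opens T) (h : W `<=` U) (s : lsec U) : lsec W :=
  LSec (lc_restrict h (lfunP s)).

Fact lsec_res_linear (U W : opens T) (h : W `<=` U) : linear (lsec_res h).
Proof.
move=> a s t; apply: lsec_ext => x Wx.
rewrite lsecDE lsecZE.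
by rewrite [LHS](lsecDE (a *: s) t (h x Wx)) lsecZE.
Qed.

Fact lsec_res_id (U : opens T) (h : U `<=` U) (s : lsec U) : lsec_res h s = s.
Proof.
by apply: lsec_ext => x Ux /=; rewrite /family_restrict; congr (lfun s _);
  exact: Prop_irrelevance.
Qed.

Fact lsec_res_comp (U W O : opens T) (hWU : W `<=` U) (hOW : O `<=` W)
  (hOU : O `<=` U) (s : lsec U) : lsec_res hOW (lsec_res hWU s) = lsec_res hOU s.
Proof.
by apply: lsec_ext => x Ux /=; rewrite /family_restrict; congr (lfun s _);
  exact: Prop_irrelevance.
Qed.

Fact lsec_glue (I : Type) (U : opens T) (W : I -> opens T)
    (hW : forall i, W i `<=` U) :
  (forall x, U x -> exists i, W i x) ->
  forall s : forall i, lsec (W i),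
  (forall i j, lsec_res (@opensIl T (W i) (W j)) (s i)
             = lsec_res (@opensIr T (W i) (W j)) (s j)) ->
  exists! t : lsec U, forall i, lsec_res (hW i) t = s i.
Proof.
move=> cov s sE.
have eqs i j x (Wi : W i x) (Wj : W j x) : s i x Wi = s j x Wj.
  have Wij : opensI (W i) (W j) x by split.
  have := congr1 (fun t : lsec (opensI (W i) (W j)) => t x Wij) (sE i j).
  rewrite /= /family_restrict => e.
  rewrite (Prop_irrelevance Wi (@opensIl T (W i) (W j) x Wij)) e.
  by congr (lfun (s j) _); exact: Prop_irrelevance.
pose f x Ux := let: exist i Wix := cid (cov x Ux) in s i x Wix.
have fE i x Ux (Wix : W i x) : f x Ux = s i x Wix.
  by rewrite /f; case: cid => j Wjx; exact: eqs.
have fres i : family_restrict (hW i) f = s i.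
  apply: functional_extensionality_dep => x.
  apply: functional_extensionality_dep => Wx; exact: fE.
have Pf : lc P f.
  apply: lc_local => x Ux; have [i Wix] := cov x Ux.
  by exists (W i), (hW i); split=> //; rewrite fres; exact: lfunP.
exists (LSec Pf); split=> [i|t tE].
  by apply: lsec_ext => x Wx; exact: fE.
apply: lsec_ext => x Ux; have [i Wix] := cov x Ux.
rewrite /= (fE i x Ux Wix) -(tE i) /= /family_restrict.
by congr (lfun t _); exact: Prop_irrelevance.
Qed.

Definition lsheaf : sheaf k T :=
  Sheaf lsec_res_linear lsec_res_id lsec_res_comp lsec_glue.

End LocalSections.

Section Stalk.
Context (k : fieldType) (T : topologicalType) (F : sheaf k T) (x : T).

Record germ_rep := GermRep {
  gr_dom : opens T;
  gr_mem : gr_dom x;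
  gr_sec : F gr_dom }.

HB.instance Definition _ := gen_eqMixin germ_rep.
HB.instance Definition _ := gen_choiceMixin germ_rep.

Definition germ_eqv (a b : germ_rep) : Prop :=
  exists (W : opens T) (ha : W `<=` gr_dom a) (hb : W `<=` gr_dom b),
    W x /\ res ha (gr_sec a) = res hb (gr_sec b).

Definition germ_eqb (a b : germ_rep) : bool := `[< germ_eqv a b >].

Fact germ_eqb_refl : reflexive germ_eqb.
Proof.
move=> a; apply/asboolP; exists (gr_dom a), (@subset_refl _ _), (@subset_refl _ _).
by split=> //; exact: gr_mem.
Qed.

Fact germ_eqb_sym : symmetric germ_eqb.
Proof.
by move=> a b; apply/asboolP/asboolP => -[W [ha [hb [Wx e]]]]; exists W, hb, ha.
Qed.

Fact germ_eqb_trans : transitive germ_eqb.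
Proof.
move=> b a c /asboolP[W [ha [hb [Wx e]]]] /asboolP[O [hb' [hc [Ox e']]]].
apply/asboolP; have hW := @opensIl T W O; have hO := @opensIr T W O.
exists (opensI W O), (subset_trans hW ha), (subset_trans hO hc); split=> //.
rewrite -(res_comp ha hW) e (res_comp hb hW (subset_trans hW hb)).
rewrite (Prop_irrelevance (subset_trans hW hb) (subset_trans hO hb')).
by rewrite -(res_comp hb' hO) e' (res_comp hc hO (subset_trans hO hc)).
Qed.

Canonical germ_equiv :=
  EquivRel germ_eqb germ_eqb_refl germ_eqb_sym germ_eqb_trans.

Definition stalk := {eq_quot germ_equiv}.
HB.instance Definition _ := Choice.on stalk.

Definition germ (U : opens T) (Ux : U x) (s : F U) : stalk :=
  \pi_stalk (GermRep Ux s).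

Lemma germP (U W : opens T) (Ux : U x) (Wx : W x) (s : F U) (t : F W) :
  germ Ux s = germ Wx t <->
  exists (O : opens T) (hU : O `<=` U) (hW : O `<=` W),
    O x /\ res hU s = res hW t.
Proof.
by split=> [/eqmodP/asboolP//|H]; apply/eqmodP/asboolP.
Qed.

Lemma germ_res (U W : opens T) (Ux : U x) (Wx : W x) (h : W `<=` U) (s : F U) :
  germ Wx (res h s) = germ Ux s.
Proof.
by apply/germP; exists W, (@subset_refl _ _), h; rewrite res_id.
Qed.

Lemma germ_surj (g : stalk) : exists (U : opens T) (Ux : U x) (s : F U),
  g = germ Ux s.
Proof.
by case: (repr g) (reprK g) => U Ux s <-; exists U, Ux, s.
Qed.

Lemma germ_surj2 (g h : stalk) : exists (U : opens T) (Ux : U x) (s t : F U),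
  g = germ Ux s /\ h = germ Ux t.
Proof.
have [U [Ux [s ->]]] := germ_surj g; have [W [Wx [t ->]]] := germ_surj h.
have Ox : opensI U W x by split.
by exists (opensI U W), Ox, (res (@opensIl T U W) s), (res (@opensIr T U W) t);
  rewrite !germ_res.
Qed.

Definition stalk0 : stalk := germ (U := opensT T) I 0.

(* a *: g + h, computed on the intersection of the domains of representatives *)
Definition stalkP (a : k) (g h : stalk) : stalk :=
  let U := gr_dom (repr g) in let W := gr_dom (repr h) in
  germ (U := opensI U W) (conj (gr_mem (repr g)) (gr_mem (repr h)))
    (a *: res (@opensIl T U W) (gr_sec (repr g))
     + res (@opensIr T U W) (gr_sec (repr h))).

Lemma germ0 (U : opens T) (Ux : U x) : germ Ux 0 = stalk0.
Proof.
have h : U `<=` opensT T by [].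
by rewrite -[RHS](germ_res _ Ux h) linear0.
Qed.

Lemma stalkPE (a : k) (U : opens T) (Ux : U x) (s t : F U) :
  stalkP a (germ Ux s) (germ Ux t) = germ Ux (a *: s + t).
Proof.
rewrite /stalkP; set g := repr (germ Ux s); set h := repr (germ Ux t).
have /germP[O [hO [hU [Ox eg]]]] : germ (gr_mem g) (gr_sec g) = germ Ux s.
  by rewrite -[RHS]reprK -/g; case: (g).
have /germP[O' [hO' [hU' [Ox' eh]]]] : germ (gr_mem h) (gr_sec h) = germ Ux t.
  by rewrite -[RHS]reprK -/h; case: (h).
apply/germP; pose Q := opensI O O'.
have QO : Q `<=` O := @opensIl T O O'; have QO' : Q `<=` O' := @opensIr T O O'.
have QI : Q `<=` opensI (gr_dom g) (gr_dom h).
  by move=> y [Oy O'y]; exact: (conj (hO y Oy) (hO' y O'y)).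
exists Q, QI, (subset_trans QO hU); split; first by split.
rewrite !linearP /=; congr (_ *: _ + _).
  rewrite (res_comp _ QI (subset_trans QO hO)) -(res_comp hO QO) eg.
  by rewrite (res_comp hU QO (subset_trans QO hU)).
rewrite (res_comp _ QI (subset_trans QO' hO')) -(res_comp hO' QO') eh.
rewrite (res_comp hU' QO' (subset_trans QO' hU')).
by congr (res _ t); exact: Prop_irrelevance.
Qed.

Fact stalk_addA : associative (stalkP 1).
Proof.
move=> f g h; have [U [Ux [s [t [-> ->]]]]] := germ_surj2 f g.
have [W [Wx [u ->]]] := germ_surj h.
have Ox : opensI U W x by split.
rewrite -(germ_res Ux Ox (@opensIl T U W) s) -(germ_res Ux Ox (@opensIl T U W) t).
rewrite -(germ_res Wx Ox (@opensIr T U W) u) !stalkPE.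
by rewrite !scale1r addrA.
Qed.

Fact stalk_addC : commutative (stalkP 1).
Proof.
move=> g h; have [U [Ux [s [t [-> ->]]]]] := germ_surj2 g h.
by rewrite !stalkPE !scale1r addrC.
Qed.

Fact stalk_add0 : left_id stalk0 (stalkP 1).
Proof.
move=> g; have [U [Ux [s ->]]] := germ_surj g.
by rewrite -(germ0 Ux) stalkPE scale1r add0r.
Qed.

Fact stalk_addN : left_inverse stalk0 (fun g => stalkP (- 1) g stalk0) (stalkP 1).
Proof.
move=> g; have [U [Ux [s ->]]] := germ_surj g.
by rewrite -(germ0 Ux) !stalkPE scale1r scaleN1r addr0 addNr.
Qed.

HB.instance Definition _ :=
  GRing.isZmodule.Build stalk stalk_addA stalk_addC stalk_add0 stalk_addN.

Definition stalk_scale (a : k) (g : stalk) : stalk := stalkP a g stalk0.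

Lemma germD (U : opens T) (Ux : U x) (s t : F U) :
  germ Ux (s + t) = germ Ux s + germ Ux t.
Proof. by rewrite -[s in LHS]scale1r -stalkPE. Qed.

Lemma stalk_scaleE a (U : opens T) (Ux : U x) (s : F U) :
  stalk_scale a (germ Ux s) = germ Ux (a *: s).
Proof. by rewrite /stalk_scale -(germ0 Ux) stalkPE addr0. Qed.

Fact stalk_scaleA a b g : stalk_scale a (stalk_scale b g) = stalk_scale (a * b) g.
Proof. by have [U [Ux [s ->]]] := germ_surj g; rewrite !stalk_scaleE scalerA. Qed.
Fact stalk_scale1 : left_id 1 stalk_scale.
Proof.
by move=> g; have [U [Ux [s ->]]] := germ_surj g; rewrite stalk_scaleE scale1r.
Qed.
Fact stalk_scaleDr : right_distributive stalk_scale +%R.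
Proof.
move=> a g h; have [U [Ux [s [t [-> ->]]]]] := germ_surj2 g h.
by rewrite !(stalk_scaleE, =^~ germD) scalerDr.
Qed.
Fact stalk_scaleDl g : {morph stalk_scale^~ g : a b / a + b}.
Proof.
move=> a b; have [U [Ux [s ->]]] := germ_surj g.
by rewrite !(stalk_scaleE, =^~ germD) scalerDl.
Qed.

HB.instance Definition _ := GRing.Zmodule_isLmodule.Build k stalk
  stalk_scaleA stalk_scale1 stalk_scaleDr stalk_scaleDl.

Lemma germ_linear (U : opens T) (Ux : U x) : linear (germ Ux).
Proof.
by move=> a s t; rewrite germD -stalk_scaleE.
Qed.

HB.instance Definition _ (U : opens T) (Ux : U x) :=
  GRing.isLinear.Build k (F U) stalk *:%R (germ Ux) (germ_linear Ux).

End Stalk.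

Section StalkMap.
Context (k : fieldType) (T : topologicalType) (F G : sheaf k T) (f : hom F G).
Context (x : T).

Definition stalk_map (g : stalk F x) : stalk G x :=
  germ (gr_mem (repr g)) (f _ (gr_sec (repr g))).

Lemma stalk_mapE (U : opens T) (Ux : U x) (s : F U) :
  stalk_map (germ Ux s) = germ Ux (f U s).
Proof.
rewrite /stalk_map; set g := repr _.
have /germP[O [hO [hU [Ox e]]]] : germ (gr_mem g) (gr_sec g) = germ Ux s.
  by rewrite -[RHS]reprK -/g; case: (g).
by apply/germP; exists O, hO, hU; rewrite !hom_natural e.
Qed.

Lemma stalk_map_linear : linear stalk_map.
Proof.
move=> a g h; have [U [Ux [s [t [-> ->]]]]] := germ_surj2 g h.
by rewrite -linearP !stalk_mapE !linearP.
Qed.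

HB.instance Definition _ :=
  GRing.isLinear.Build k (stalk F x) (stalk G x) *:%R stalk_map stalk_map_linear.

End StalkMap.

(* The sheaf M_Z for Z locally closed: a section over U is a function on U that
   vanishes outside Z and is locally the restriction to Z of a constant; at a
   point outside Z that constant is 0, so supports are closed in U. *)
Section ConstantSheaf.
Context (k : fieldType) (T : topologicalType) (Z : set T) (M : lmodType k).

Definition const_lc (U : opens T) (s : forall x, U x -> M) : Prop :=
  (forall x (Ux : U x), ~ Z x -> s x Ux = 0) /\
  (forall x (Ux : U x), exists W : opens T, W x /\
     forall y (Uy : U y), W y -> Z y -> s y Uy = s x Ux).

Fact const_lc0 (U : opens T) : @const_lc U (fun x _ => 0).
Proof. by split=> // x Ux; exists U. Qed.

Fact const_lcP (U : opens T) (a : k) s t : @const_lc U s -> @const_lc U t ->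
  @const_lc U (fun x Ux => a *: s x Ux + t x Ux).
Proof.
move=> [s0 sc] [t0 tc]; split=> [x Ux nZ|x Ux].
  by rewrite s0 // t0 // scaler0 addr0.
have [W [Wx sW]] := sc x Ux; have [O [Ox tO]] := tc x Ux.
exists (opensI W O); split=> // y Uy [Wy Oy] Zy.
by rewrite (sW y Uy) // (tO y Uy).
Qed.

Fact const_lc_restrict (U W : opens T) (h : W `<=` U) s : @const_lc U s ->
  @const_lc W (family_restrict (E := fun=> M) h s).
Proof.
move=> [s0 sc]; split=> [x Wx nZ|x Wx]; first exact: s0.
have [O [Ox sO]] := sc x (h x Wx).
by exists O; split=> // y Wy; exact: sO.
Qed.

Fact const_lc_local (U : opens T) s :
  (forall x, U x -> exists (W : opens T) (h : W `<=` U),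
     W x /\ @const_lc W (family_restrict (E := fun=> M) h s)) -> @const_lc U s.
Proof.
move=> loc; split=> [x Ux nZ|x Ux]; have [W [h [Wx [s0 sc]]]] := loc x Ux.
  by rewrite -(s0 x Wx nZ); congr s; exact: Prop_irrelevance.
have [O [Ox sO]] := sc x Wx; exists (opensI W O); split=> // y Uy [Wy Oy] Zy.
rewrite (Prop_irrelevance Ux (h x Wx)) (Prop_irrelevance Uy (h y Wy)).
exact: sO.
Qed.

Definition const_cond : local_cond (fun=> M) :=
  LocalCond const_lc0 const_lcP const_lc_restrict const_lc_local.

Definition const_sheaf : sheaf k T := lsheaf const_cond.

End ConstantSheaf.

Section ConstantSheafMap.
Context (k : fieldType) (T : topologicalType) (Z : set T).
Context (M N : lmodType k) (f : {linear M -> N}).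

Fact const_hom_lc (U : opens T) (s : const_sheaf Z M U) :
  const_lc Z (fun x (Ux : U x) => f (lfun s Ux)).
Proof.
have [s0 sc] := lfunP s; split=> [x Ux nZ|x Ux]; first by rewrite s0 ?linear0.
have [W [Wx sW]] := sc x Ux; exists W; split=> // y Uy Wy Zy.
by rewrite (sW y Uy).
Qed.

Definition const_hom_fun (U : opens T) (s : const_sheaf Z M U) :
  const_sheaf Z N U := LSec (P := const_cond Z N) (const_hom_lc s).

Fact const_hom_linear (U : opens T) : linear (@const_hom_fun U).
Proof.
move=> a s t; apply: lsec_ext => x Ux; rewrite [RHS]lsecPE /= -linearP.
by congr (f _); exact: lsecPE.
Qed.

Fact const_hom_natural (U W : opens T) (h : W `<=` U) (s : const_sheaf Z M U) :
  res h (const_hom_fun s) = const_hom_fun (res h s).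
Proof. exact: lsec_ext. Qed.

Definition const_hom : hom (const_sheaf Z M) (const_sheaf Z N) :=
  Hom const_hom_linear const_hom_natural.

End ConstantSheafMap.

Definition zero_sheaf (k : fieldType) (T : topologicalType) : sheaf k T :=
  const_sheaf setT 'rV[k]_0.

Lemma zero_sheafE (k : fieldType) (T : topologicalType) (U : opens T)
  (s : zero_sheaf k T U) : s = 0.
Proof. by apply: lsec_ext => x Ux; exact: thinmx0. Qed.

Section SumSheaf.
Context (k : fieldType) (T : topologicalType) (F G : sheaf k T).

Definition sum_sheaf : sheaf k T.
Proof.
exists (fun U => (F U * G U)%type) (fun U W h s => (res h s.1, res h s.2)).
- by move=> U W h a s t /=; rewrite !linearP.
- by move=> U h [s t]; rewrite !res_id.
- by move=> U W O hWU hOW hOU s /=; rewrite !(res_comp hWU hOW hOU).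
move=> I U W hW cov s sE.
have [i j|t1 [t1E t1U]] := sheaf_glue hW cov (s := fun i => (s i).1).
  by have [] := sE i j.
have [i j|t2 [t2E t2U]] := sheaf_glue hW cov (s := fun i => (s i).2).
  by have [] := sE i j.
exists (t1, t2); split=> [i|[u1 u2] uE]; first by rewrite t1E t2E -surjective_pairing.
by rewrite (t1U u1) ?(t2U u2) // => i; rewrite -uE.
Defined.

Definition sum_inr : hom G sum_sheaf.
Proof.
exists (fun U s => (0 : F U, s)) => [U a s t|U W h s].
  suff e : (0 : F U) = a *: 0 + 0 by rewrite [in LHS]e.
  by rewrite scaler0 addr0.
by rewrite /= linear0.
Defined.

Definition sum_fst : hom sum_sheaf F.
Proof. by exists (fun U s => s.1). Defined.

End SumSheaf.

(* The inverse image of F by f: the sections over W are the families of germs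
   of F at the points f y that are locally given by sections of F. *)
Section InverseImage.
Context (k : fieldType) (S T : topologicalType) (f : S -> T).

Section Sheaf.
Variable F : sheaf k T.

Definition inv_lc (W : opens S) (s : forall y, W y -> stalk F (f y)) : Prop :=
  forall y, W y -> exists (O : opens S) (U : opens T) (t : F U),
    O y /\ U (f y) /\
    forall z (Wz : W z) (Uz : U (f z)), O z -> s z Wz = germ Uz t.

Fact inv_lc0 (W : opens S) : @inv_lc W (fun y _ => 0).
Proof.
move=> y Wy; exists W, (opensT T), 0; split=> //; split=> // z Wz Uz _.
by rewrite linear0.
Qed.

Fact inv_lcP (W : opens S) (a : k) s t : @inv_lc W s -> @inv_lc W t ->
  @inv_lc W (fun y Wy => a *: s y Wy + t y Wy).
Proof.
move=> sP tP y Wy; have [O [U [u [Oy [Uy uE]]]]] := sP y Wy.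
have [O' [U' [u' [Oy' [Uy' uE']]]]] := tP y Wy.
exists (opensI O O'), (opensI U U').
exists (a *: res (@opensIl T U U') u + res (@opensIr T U U') u').
split=> //; split=> // z Wz Uz [Oz Oz'].
have [Uz1 Uz2] := Uz.
by rewrite linearP /= (germ_res Uz1 Uz) (germ_res Uz2 Uz) -(uE z Wz) // -(uE' z Wz).
Qed.

Fact inv_lc_restrict (U W : opens S) (h : W `<=` U) s : @inv_lc U s ->
  @inv_lc W (family_restrict (E := fun y => stalk F (f y)) h s).
Proof.
move=> sP y Wy; have [O [V [t [Oy [Vy tE]]]]] := sP y (h y Wy).
by exists O, V, t; split=> //; split=> // z Wz Vz Oz; exact: tE.
Qed.

Fact inv_lc_local (U : opens S) s :
  (forall y, U y -> exists (W : opens S) (h : W `<=` U), W y /\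
     @inv_lc W (family_restrict (E := fun y => stalk F (f y)) h s)) ->
  @inv_lc U s.
Proof.
move=> loc y Uy; have [W [h [Wy sP]]] := loc y Uy.
have [O [V [t [Oy [Vy tE]]]]] := sP y Wy.
exists (opensI W O), V, t; split=> //; split=> // z Uz Vz [Wz Oz].
by rewrite (Prop_irrelevance Uz (h z Wz)); exact: tE.
Qed.

Definition inv_cond : local_cond (fun y => stalk F (f y)) :=
  LocalCond inv_lc0 inv_lcP inv_lc_restrict inv_lc_local.

Definition inv_sheaf : sheaf k S := lsheaf inv_cond.

End Sheaf.

Section Map.
Context (F G : sheaf k T) (g : hom F G).

Fact inv_hom_lc (W : opens S) (s : inv_sheaf F W) :
  @inv_lc G W (fun y Wy => stalk_map g (lfun s Wy)).
Proof.
move=> y Wy; have [O [U [t [Oy [Uy tE]]]]] := lfunP s y Wy.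
exists O, U, (g U t); split=> //; split=> // z Wz Uz Oz.
by rewrite (tE z Wz Uz Oz) stalk_mapE.
Qed.

Definition inv_hom_fun (W : opens S) (s : inv_sheaf F W) : inv_sheaf G W :=
  LSec (P := inv_cond G) (inv_hom_lc s).

Fact inv_hom_linear (W : opens S) : linear (@inv_hom_fun W).
Proof.
move=> a s t; apply: lsec_ext => y Wy; rewrite [RHS]lsecPE /=.
apply: etrans (congr1 (@stalk_map _ _ _ _ g (f y)) (lsecPE a s t Wy)) _.
exact: linearP.
Qed.

Fact inv_hom_natural (U W : opens S) (h : W `<=` U) (s : inv_sheaf F U) :
  res h (inv_hom_fun s) = inv_hom_fun (res h s).
Proof. exact: lsec_ext. Qed.

Definition inv_hom : hom (inv_sheaf F) (inv_sheaf G) :=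
  Hom inv_hom_linear inv_hom_natural.

End Map.

End InverseImage.

(* Bounded complexes of sheaves. The differential is given between all pairs of
   degrees, and vanishes unless it raises the degree by one. *)
Record complex (k : fieldType) (T : topologicalType) := Complex {
  ob :> int -> sheaf k T;
  df : forall i j, hom (ob i) (ob j);
  df_shape : forall i j U (s : ob i U), j != i + 1 -> df i j U s = 0;
  df_df : forall i j l U (s : ob i U), df j l U (df i j U s) = 0;
  complex_bounded : exists n : nat, forall i, (n < `|i|)%N ->
    forall U (s : ob i U), s = 0 }.

Record cmap (k : fieldType) (T : topologicalType) (X Y : complex k T) := CMap {
  cfun :> forall i, hom (X i) (Y i);
  cmap_df : forall i j U (s : X i U),
    df Y i j U (cfun i U s) = cfun j U (df X i j U s) }.

Section Complexes.
Context (k : fieldType) (T : topologicalType).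
Implicit Types X Y Z : complex k T.

Definition cmap_id X : cmap X X.
Proof. by exists (fun i => hid (X i)). Defined.

Definition cmap_comp X Y Z (g : cmap Y Z) (f : cmap X Y) : cmap X Z.
Proof.
exists (fun i => hcomp (g i) (f i)) => i j U s /=.
by rewrite !cmap_df.
Defined.

Definition single (F : sheaf k T) : complex k T.
Proof.
exists (fun i => if i == 0 then F else zero_sheaf k T) (fun i j => hzero _ _) => //.
by exists 0%N => -[[|i]|i] //= _ U s; exact: zero_sheafE.
Defined.

Definition zero_complex : complex k T.
Proof.
exists (fun=> zero_sheaf k T) (fun i j => hzero _ _) => //.
by exists 0%N => i _ U s; exact: zero_sheafE.
Defined.

(* X[n], with differential (-1)^n d *)
Definition cshift (n : int) X : complex k T.
Proof.
exists (fun i => X (i + n)) (fun i j => hscale ((- 1) ^ n) (df X (i + n) (j + n))).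
- move=> i j U s ij /=; rewrite df_shape ?scaler0 //.
  by apply: contra ij => /eqP e; rewrite -(inj_eq (addIr n)) e addrAC.
- by move=> i j l U s /=; rewrite linearZ /= df_df !scaler0.
have [N XN] := complex_bounded X; exists (N + `|n|)%N => i Ni U s.
apply: XN; rewrite -(ltn_add2r `|n|); apply: leq_trans Ni _.
by have := leqD_dist (i + n) 0 n; rewrite addrK subr0 sub0r abszN.
Defined.

Definition cshift_map (n : int) X Y (f : cmap X Y) : cmap (cshift n X) (cshift n Y).
Proof.
exists (fun i => f (i + n)) => i j U s /=.
by rewrite linearZ /= cmap_df.
Defined.

(* The mapping cone: in degree i it is X^(i+1) + Y^i, with differential
   (x, y) |-> (- d x, f x + d y). *)
Section Cone.
Context (X Y : complex k T) (f : cmap X Y).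

Definition cone_fun (i j : int) (U : opens T)
    (s : sum_sheaf (X (i + 1)) (Y i) U) : sum_sheaf (X (j + 1)) (Y j) U :=
  (- df X (i + 1) (j + 1) U s.1,
   hdelta Y (i + 1) j U (f (i + 1) U s.1) + df Y i j U s.2).

Definition cone_df (i j : int) :
  hom (sum_sheaf (X (i + 1)) (Y i)) (sum_sheaf (X (j + 1)) (Y j)).
Proof.
exists (@cone_fun i j) => [U a s t|U W h s].
  rewrite /cone_fun /=; congr pair; first by rewrite linearP opprD -scalerN.
  by rewrite !linearP /= scalerDr addrACA.
rewrite /cone_fun /=; congr pair; first by rewrite linearN /= hom_natural.
by rewrite linearD /= !hom_natural.
Defined.

Definition cone : complex k T.
Proof.
exists (fun i => sum_sheaf (X (i + 1)) (Y i)) cone_df.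
- move=> i j U s ij /=; rewrite /cone_fun hdelta_neq 1?eq_sym // !df_shape //.
    by rewrite oppr0 addr0.
  by apply: contra ij => /eqP/addIr ->.
- move=> i j l U [x y] /=; rewrite /cone_fun /=.
  rewrite linearN /= df_df opprK; congr pair.
  rewrite !linearN /= linearD /= df_df addr0 -cmap_df.
  have [ji|ji] := eqVneq j (i + 1).
    subst j; rewrite hdelta_id; have [->|li] := eqVneq l (i + 1 + 1).
      by rewrite hdelta_id addNr.
    by rewrite [df Y (i + 1) l _ _]df_shape // hdelta_neq 1?eq_sym // oppr0 addr0.
  rewrite [df Y (i + 1) (j + 1) _ _]df_shape; last first.
    by apply: contra ji => /eqP/addIr ->.
  by rewrite [hdelta Y (i + 1) j _ _]hdelta_neq 1?eq_sym // !linear0 addr0.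
have [m Xm] := complex_bounded (cshift 1 X); have [n Yn] := complex_bounded Y.
exists (maxn m n) => i; rewrite gtn_max => /andP[mi ni] U [x y].
by rewrite (Xm i mi U x) (Yn i ni U y).
Defined.

Definition cone_in : cmap Y cone.
Proof.
exists (fun i => sum_inr (X (i + 1)) (Y i)) => i j U s /=.
by rewrite /cone_fun /= !linear0 add0r.
Defined.

Definition cone_out : cmap cone (cshift 1 X).
Proof.
exists (fun i => sum_fst (X (i + 1)) (Y i)) => i j U s /=.
by rewrite expr1z scaleN1r.
Defined.

End Cone.

(* f induces isomorphisms on the stalks of the cohomology sheaves in all degrees:
   with i = h + 1 and j = i + 1, the stalk H^i(X)_x is the kernel of
   X^i_x -> X^j_x modulo the image of X^h_x -> X^i_x. *)
Definition quasi_iso X Y (f : cmap X Y) : Prop :=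
  forall (h i j : int) (x : T), i = h + 1 -> j = i + 1 ->
    (forall a : stalk (X i) x, stalk_map (df X i j) a = 0 ->
       (exists b : stalk (Y h) x, stalk_map (f i) a = stalk_map (df Y h i) b) ->
       exists b : stalk (X h) x, a = stalk_map (df X h i) b) /\
    (forall c : stalk (Y i) x, stalk_map (df Y i j) c = 0 ->
       exists (a : stalk (X i) x) (b : stalk (Y h) x),
         stalk_map (df X i j) a = 0 /\
         c = stalk_map (f i) a + stalk_map (df Y h i) b).

Lemma stalk_map_hscale (F G : sheaf k T) (a : k) (f : hom F G) x
  (g : stalk F x) : stalk_map (hscale a f) g = a *: stalk_map f g.
Proof.
have [U [Ux [s ->]]] := germ_surj g.
by rewrite !stalk_mapE linearZ.
Qed.

Lemma quasi_iso_shift (n : int) X Y (f : cmap X Y) :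
  quasi_iso f -> quasi_iso (cshift_map n f).
Proof.
move=> qf h i j x ih ji; set e : k := (- 1) ^ n.
have e0 : e != 0 by rewrite expfz_neq0 // oppr_eq0 oner_eq0.
have {}ih : i + n = h + n + 1 by rewrite ih addrAC.
have {}ji : j + n = i + n + 1 by rewrite ji addrAC.
have [inj sur] := qf _ _ _ x ih ji.
have scale_eq0 (F G : sheaf k T) (g : hom F G) (a : stalk F x) :
    stalk_map (hscale e g) a = 0 -> stalk_map g a = 0.
  by rewrite stalk_map_hscale => /eqP; rewrite scaler_eq0 (negPf e0) => /eqP.
have scaleK (F G : sheaf k T) (g : hom F G) (a : stalk F x) :
    stalk_map g a = stalk_map (hscale e g) (e^-1 *: a).
  by rewrite stalk_map_hscale linearZ scalerA divff // scale1r.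
split=> [a da [b ab]|c dc].
  have [|b' ->] := inj a (scale_eq0 _ _ _ _ da).
    by exists (e *: b); rewrite [LHS]ab [LHS]stalk_map_hscale linearZ.
  by exists (e^-1 *: b'); rewrite scaleK.
have [a [b [da cE]]] := sur c (scale_eq0 _ _ _ _ dc).
exists a, (e^-1 *: b); split; first by rewrite [LHS]stalk_map_hscale da scaler0.
by rewrite cE; congr (_ + _); exact: scaleK.
Qed.

(* The bounded derived category D^b(k_T), as the localization of the category of
   bounded complexes of sheaves at the quasi-isomorphisms: its morphisms are the
   formal composites of chain maps and of inverses of quasi-isomorphisms, up to
   the congruence dmor_eq. *)
Inductive dmor : complex k T -> complex k T -> Type :=
| dmap X Y : cmap X Y -> dmor X Y
| dinv X Y (f : cmap X Y) : quasi_iso f -> dmor Y X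
| dcomp X Y Z : dmor Y Z -> dmor X Y -> dmor X Z.

Definition did X : dmor X X := dmap (cmap_id X).

Inductive dmor_eq : forall X Y, dmor X Y -> dmor X Y -> Prop :=
| dmor_eq_refl X Y (u : dmor X Y) : dmor_eq u u
| dmor_eq_sym X Y (u v : dmor X Y) : dmor_eq u v -> dmor_eq v u
| dmor_eq_trans X Y (u v w : dmor X Y) :
    dmor_eq u v -> dmor_eq v w -> dmor_eq u w
| dmor_eq_comp X Y Z (v v' : dmor Y Z) (u u' : dmor X Y) :
    dmor_eq v v' -> dmor_eq u u' -> dmor_eq (dcomp v u) (dcomp v' u')
| dmor_eq_assoc X Y Z W (w : dmor Z W) (v : dmor Y Z) (u : dmor X Y) :
    dmor_eq (dcomp w (dcomp v u)) (dcomp (dcomp w v) u)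
| dmor_eq_idl X Y (u : dmor X Y) : dmor_eq (dcomp (did Y) u) u
| dmor_eq_idr X Y (u : dmor X Y) : dmor_eq (dcomp u (did X)) u
| dmor_eq_map X Y (f g : cmap X Y) :
    (forall i U (s : X i U), f i U s = g i U s) -> dmor_eq (dmap f) (dmap g)
| dmor_eq_map_comp X Y Z (g : cmap Y Z) (f : cmap X Y) :
    dmor_eq (dcomp (dmap g) (dmap f)) (dmap (cmap_comp g f))
| dmor_eq_invl X Y (f : cmap X Y) (qf : quasi_iso f) :
    dmor_eq (dcomp (dinv qf) (dmap f)) (did X)
| dmor_eq_invr X Y (f : cmap X Y) (qf : quasi_iso f) :
    dmor_eq (dcomp (dmap f) (dinv qf)) (did Y).

Definition d_is_iso X Y (u : dmor X Y) : Prop :=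
  exists v : dmor Y X,
    dmor_eq (dcomp v u) (did X) /\ dmor_eq (dcomp u v) (did Y).

Definition d_isomorphic X Y : Prop := exists u : dmor X Y, d_is_iso u.

Fixpoint dshift (n : int) X Y (u : dmor X Y) : dmor (cshift n X) (cshift n Y) :=
  match u with
  | dmap _ _ f => dmap (cshift_map n f)
  | dinv _ _ f qf => dinv (quasi_iso_shift n qf)
  | dcomp _ _ _ v u => dcomp (dshift n v) (dshift n u)
  end.

(* X -u-> Y -v-> Z -w-> X[1] is isomorphic to the triangle of a mapping cone. *)
Definition distinguished X Y Z (u : dmor X Y) (v : dmor Y Z)
    (w : dmor Z (cshift 1 X)) : Prop :=
  exists (X' Y' : complex k T) (f : cmap X' Y')
      (a : dmor X X') (b : dmor Y Y') (c : dmor Z (cone f)),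
    [/\ d_is_iso a, d_is_iso b & d_is_iso c] /\
    [/\ dmor_eq (dcomp b u) (dcomp (dmap f) a),
        dmor_eq (dcomp c v) (dcomp (dmap (cone_in f)) b) &
        dmor_eq (dcomp (dshift 1 a) w) (dcomp (dmap (cone_out f)) c)].

(* D and G are families of objects of D^b(k_T), D being the objects of a full
   triangulated subcategory. *)
Definition generates (G D : complex k T -> Prop) : Prop :=
  (forall H, G H -> D H) /\
  forall F, D F -> exists (N : nat) (Fs : nat -> complex k T),
    [/\ Fs 0%N = zero_complex, Fs N = F, (forall i, (i <= N)%N -> D (Fs i)) &
      forall i, (i < N)%N -> exists (m : int) (H H' : complex k T),
        G H /\ d_isomorphic H' H /\
        exists (u : dmor (Fs i) (Fs i.+1)) (v : dmor (Fs i.+1) (cshift m H'))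
            (w : dmor (cshift m H') (cshift 1 (Fs i))), distinguished u v w].

End Complexes.

Section StalkZero.
Context (k : fieldType) (T : topologicalType) (F G H : sheaf k T) (x : T).

Lemma stalk_eq0 : (forall (U : opens T) (s : F U), s = 0) ->
  forall a : stalk F x, a = 0.
Proof.
by move=> F0 a; have [U [Ux [s ->]]] := germ_surj a; rewrite (F0 U s) linear0.
Qed.

Lemma stalk_map_eq0 (f : hom F G) : (forall U (s : F U), f U s = 0) ->
  forall a : stalk F x, stalk_map f a = 0.
Proof.
move=> f0 a; have [U [Ux [s ->]]] := germ_surj a.
by rewrite stalk_mapE f0 linear0.
Qed.

Lemma stalk_map2_eq0 (f : hom F G) (g : hom G H) :
  (forall U (s : F U), g U (f U s) = 0) ->
  forall a : stalk F x, stalk_map g (stalk_map f a) = 0.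
Proof.
move=> gf0 a; have [U [Ux [s ->]]] := germ_surj a.
by rewrite !stalk_mapE gf0 linear0.
Qed.

End StalkZero.

(* The inverse image functor is exact, so it is applied termwise. *)
Definition inv_complex (k : fieldType) (S T : topologicalType) (f : S -> T)
  (X : complex k T) : complex k S.
Proof.
exists (fun i => inv_sheaf f (X i)) (fun i j => inv_hom f (df X i j)).
- move=> i j U s ij; apply: lsec_ext => y Uy.
  exact: (stalk_map_eq0 (fun W (t : X i W) => df_shape t ij) (lfun s Uy)).
- move=> i j l U s; apply: lsec_ext => y Uy.
  exact: (stalk_map2_eq0 (fun W (t : X i W) => df_df j l t) (lfun s Uy)).
have [n Xn] := complex_bounded X; exists n => i ni U s.
by apply: lsec_ext => y Uy; exact: (stalk_eq0 (Xn i ni) (lfun s Uy)).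
Defined.

Record vcomplex (k : fieldType) := VComplex {
  vob :> int -> vectType k;
  vdf : forall i j, {linear vob i -> vob j};
  vdf_shape : forall i j s, j != i + 1 -> vdf i j s = 0;
  vdf_vdf : forall i j l s, vdf j l (vdf i j s) = 0;
  vcomplex_bounded : exists n : nat, forall i, (n < `|i|)%N ->
    forall s : vob i, s = 0 }.

Definition const_complex (k : fieldType) (T : topologicalType)
  (M : vcomplex k) : complex k T.
Proof.
exists (fun i => const_sheaf setT (M i)) (fun i j => const_hom setT (vdf M i j)).
- by move=> i j U s ij; apply: lsec_ext => y Uy /=; exact: vdf_shape.
- by move=> i j l U s; apply: lsec_ext => y Uy /=; exact: vdf_vdf.
have [n Mn] := vcomplex_bounded M; exists n => i ni U s.
by apply: lsec_ext => y Uy; exact: Mn.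
Defined.

(* X is isomorphic in D^b(k_T) to the pull-back of an object of D^b(k) with
   finite dimensional cohomology; over a field, every such object is isomorphic
   to a bounded complex of finite dimensional vector spaces. *)
Definition constant_finite_rank (k : fieldType) (T : topologicalType)
    (X : complex k T) : Prop :=
  exists M : vcomplex k, d_isomorphic X (const_complex T M).

(* V with its canonical topology: that of R^n, in the coordinates of a basis. *)
Definition coordinates (R : realType) (V : vectType R) (v : V)
  : 'rV[R]_(\dim {:V}) := \row_i coord (vbasis {:V}) i v.
Definition vect_top (R : realType) (V : vectType R) : Type :=
  initial_topology (@coordinates R V).
HB.instance Definition _ (R : realType) (V : vectType R) :=
  Topological.copy (vect_top V) (initial_topology (@coordinates R V)).

Section PiecewiseLinear.
Context (R : realType) (V : vectType R).

Definition half_space (H : set (vect_top V)) : Prop :=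
  exists (f : {linear V -> R^o}) (c : R), (exists v, f v != 0) /\
    (H = [set v : V | f v < c] \/ H = [set v : V | f v <= c]).

Definition convex_polyhedron (P : set (vect_top V)) : Prop :=
  exists (n : nat) (H : 'I_n -> set (vect_top V)),
    (forall i, half_space (H i)) /\ P = \bigcap_i H i.

Definition locally_closed (T : topologicalType) (Z : set T) : Prop :=
  exists U C : set T, [/\ open U, closed C & Z = U `&` C].

Definition is_PL (k : fieldType) (F : complex k (vect_top V)) : Prop :=
  exists (n : nat) (P : 'I_n -> set (vect_top V)),
    [/\ forall a, convex_polyhedron (P a), \bigcup_a P a = setT &
      forall a, constant_finite_rank (inv_complex (set_val (A := P a)) F)].

Definition polyhedron_sheaf (k : fieldType) (F : complex k (vect_top V)) : Prop :=
  exists P : set (vect_top V), [/\ convex_polyhedron P, locally_closed P &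
    F = single (const_sheaf P k^o)].

End PiecewiseLinear.

(* Main.v *)
(** The family of affine forms bounding the polyhedra of a PL object X cuts the
    space into cells, each contained in one of the polyhedra. Coding sign vectors
    in base 3, with the largest digit for equality, gives an upper semicontinuous
    function rho whose fibres are the cells: the unions of the first cells are
    open, and the cells are locally closed polyhedra. Over a cell the cohomology
    sheaves of X are trivial of finite rank. Filter X by its truncations, and
    each cohomology sheaf by the subsheaves that contain everything over the
    cells before the j-th one, the span of the first m coordinate vectors over
    the j-th one, and nothing over the next ones. These are subcomplexes of X,
    described by their stalks, and consecutive ones have a quotient
    quasi-isomorphic to a shift of the constant sheaf on one cell.

    That the subcomplexes are again PL is seen by transporting truncations along
    quasi-isomorphisms. This requires an isomorphism of the derived category to
    be represented by actual quasi-isomorphisms X -> W <- Y; they are obtained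
    from homotopy pushouts, after checking that the maps induced on cohomology
    depend only on the class of a morphism. *)
From HB Require Import structures.
From Pilot Require Import Defs.
From mathcomp Require Import all_boot all_order all_algebra.
From mathcomp Require Import boolp classical_sets functions reals topology.
From mathcomp Require Import normedtype.
(* [hom] is shadowed by a definition of the vector space library. *)
Import Pilot.Defs.

Set Implicit Arguments.
Unset Strict Implicit.
Unset Printing Implicit Defensive.

Import Order.TTheory GRing.Theory Num.Theory.
Import numFieldNormedType.Exports.

Local Open Scope classical_set_scope.
Local Open Scope ring_scope.

(** * Subsheaves and subcomplexes given by their stalks *)

(** Exactness is tested on stalks, where it is linear algebra, so that no quotient sheaf and no
    cohomology sheaf is ever formed. A subsheaf of H^i is encoded by groups of germs of cocycles
    that contain the coboundaries, and a quotient S'/S by the cone of S -> S' together with a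
    function on the stalks of S' whose kernel is S. The order of the cells is forced by the
    topology: extension by zero from U gives a subsheaf when U is open. Between two degrees nothing
    is added: taking the cocycles in degree n, or everything in degree n and the coboundaries in
    degree n + 1, gives the same object. The definition of generation asks every intermediate object
    to be PL. Deducing the constancy of a truncation over a cell from that of its cohomology sheaves
    would call for the vanishing of the cohomology of cells. Instead, all trivializations over a
    cell are derived from one complex M of vector spaces and carried along quasi-isomorphisms X -> W
    <- M, so that each truncation corresponds to a subcomplex of M. *)

Section StalkFunctor.
Context (k : fieldType) (T : topologicalType).
Implicit Types F G H : sheaf k T.

Lemma germ_eq0 F x (U : opens T) (Ux : U x) (s : F U) : germ Ux s = 0 ->
  exists (O : opens T) (h : O `<=` U), O x /\ res h s = 0.
Proof.
rewrite -(linear0 (germ Ux)) => /germP[O [hU [hU' [Ox e]]]].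
by exists O, hU; rewrite e linear0.
Qed.

Lemma stalk_map_id F x (a : stalk F x) : stalk_map (hid F) a = a.
Proof. by have [U [Ux [s ->]]] := germ_surj a; rewrite stalk_mapE. Qed.

Lemma stalk_map_comp F G H (g : hom G H) (f : hom F G) x (a : stalk F x) :
  stalk_map (hcomp g f) a = stalk_map g (stalk_map f a).
Proof. by have [U [Ux [s ->]]] := germ_surj a; rewrite !stalk_mapE. Qed.

Lemma stalk_map_ext F G (f g : hom F G) x (a : stalk F x) :
  (forall U s, f U s = g U s) -> stalk_map f a = stalk_map g a.
Proof. by move=> e; have [U [Ux [s ->]]] := germ_surj a; rewrite !stalk_mapE e. Qed.

Lemma stalk_map_hzero F G x (a : stalk F x) : stalk_map (hzero F G) a = 0.
Proof. exact: stalk_map_eq0. Qed.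

End StalkFunctor.

Section Subsheaf.
Context (k : fieldType) (T : topologicalType).

Record subfam (F : sheaf k T) := SubFam {
  sfam :> forall x, stalk F x -> Prop;
  sfam0 : forall x, @sfam x 0;
  sfamP : forall x a (u v : stalk F x), sfam u -> sfam v -> sfam (a *: u + v) }.

Section Def.
Context (F : sheaf k T) (S : subfam F).

Definition ssec_pred (U : opens T) : pred (F U) :=
  fun s => `[< forall x (Ux : U x), S x (germ Ux s) >].

Fact ssec_closed (U : opens T) : submod_closed (@ssec_pred U).
Proof.
split; first by apply/asboolP => x Ux; rewrite linear0; exact: sfam0.
move=> a s t /asboolP sS /asboolP tS; apply/asboolP => x Ux.
by rewrite linearP; apply: sfamP; [exact: sS|exact: tS].
Qed.

Record ssec (U : opens T) := SSec { ssval :> F U; ssvalP : @ssec_pred U ssval }.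
HB.instance Definition _ U := [isSub for @ssval U].
HB.instance Definition _ U := [Choice of ssec U by <:].
HB.instance Definition _ U := GRing.isSubmodClosed.Build k (F U) (@ssec_pred U)
  (@ssec_closed U).
HB.instance Definition _ U := [SubChoice_isSubLmodule of ssec U by <:].

Lemma ssecP (U : opens T) (s : ssec U) x (Ux : U x) : S x (germ Ux (ssval s)).
Proof. by have /asboolP := ssvalP s; exact. Qed.

Lemma ssec_inj (U : opens T) : injective (@ssval U).
Proof. exact: val_inj. Qed.

Definition mk_ssec (U : opens T) (s : F U)
  (Ss : forall x (Ux : U x), S x (germ Ux s)) : ssec U := SSec (asboolT Ss).

Fact ssec_res_subproof (U W : opens T) (h : W `<=` U) (s : ssec U) x
  (Wx : W x) : S x (germ Wx (res h (ssval s))).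
Proof. by rewrite (germ_res (h x Wx)); exact: ssecP. Qed.

Definition ssec_res (U W : opens T) (h : W `<=` U) (s : ssec U) : ssec W :=
  mk_ssec (ssec_res_subproof h s).

Lemma ssval_linear (U : opens T) : linear (@ssval U).
Proof. exact: (linearP (\val : ssec U -> F U)). Qed.

Fact ssec_res_linear (U W : opens T) (h : W `<=` U) : linear (ssec_res h).
Proof.
by move=> a s t; apply: ssec_inj; rewrite [RHS]ssval_linear /= [X in res _ X]ssval_linear linearP.
Qed.

Fact ssec_glue (I : Type) (U : opens T) (W : I -> opens T)
    (hW : forall i, W i `<=` U) :
  (forall x, U x -> exists i, W i x) ->
  forall s : forall i, ssec (W i),
  (forall i j, ssec_res (@opensIl T (W i) (W j)) (s i)
             = ssec_res (@opensIr T (W i) (W j)) (s j)) ->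
  exists! t : ssec U, forall i, ssec_res (hW i) t = s i.
Proof.
move=> cov s sE.
have [i j|t [tE tU]] := sheaf_glue hW cov (s := fun i => ssval (s i)).
  exact: (congr1 (@ssval _) (sE i j)).
have St x (Ux : U x) : S x (germ Ux t).
  have [i Wx] := cov x Ux.
  by rewrite -(germ_res Ux Wx (hW i)) tE; exact: ssecP.
exists (mk_ssec St); split=> [i|u uE]; apply: ssec_inj; first exact: tE.
by apply: tU => i; rewrite -uE.
Qed.

Definition sub_sheaf : sheaf k T.
Proof.
exists ssec ssec_res.
- exact: ssec_res_linear.
- by move=> U h s; apply: ssec_inj; exact: res_id.
- by move=> U W O hWU hOW hOU s; apply: ssec_inj; exact: res_comp.
- exact: ssec_glue.
Defined.

Definition sub_incl : hom sub_sheaf F.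
Proof. by exists (fun U s => ssval s) => [U|//]; exact: ssval_linear. Defined.

Lemma sub_incl_inj x (a : stalk sub_sheaf x) : stalk_map sub_incl a = 0 -> a = 0.
Proof.
have [U [Ux [s ->]]] := germ_surj a; rewrite stalk_mapE /=.
move=> /germ_eq0[O [h [Ox e]]].
rewrite -(germ_res Ux Ox h) (_ : res h s = 0) ?linear0 //.
by apply: ssec_inj; rewrite /= e; exact/esym/(linear0 (\val : ssec O -> F O)).
Qed.

Lemma sub_inclP x (a : stalk sub_sheaf x) : S x (stalk_map sub_incl a).
Proof.
have [U [Ux [s ->]]] := germ_surj a; rewrite stalk_mapE /=; exact: ssecP.
Qed.

(** Openness in the etale space of F. For an arbitrary family S the stalks of [sub_sheaf] may be
    smaller than S; under this condition they are S itself. *)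
Definition open_fam := forall x (a : stalk F x), S x a ->
  exists (U : opens T) (Ux : U x) (s : F U), a = germ Ux s /\
    forall y (Uy : U y), S y (germ Uy s).

Lemma sub_incl_surj : open_fam -> forall x (a : stalk F x), S x a ->
  exists b : stalk sub_sheaf x, a = stalk_map sub_incl b.
Proof.
move=> oS x a /oS[U [Ux [s [-> Ss]]]].
by exists (@germ _ _ sub_sheaf x U Ux (mk_ssec Ss)); rewrite stalk_mapE.
Qed.

Fact sub_factor_subproof (G : sheaf k T) (g : hom G F)
  (gS : forall x a, S x (stalk_map g (a : stalk G x))) (U : opens T) (s : G U) x
  (Ux : U x) : S x (germ Ux (g U s)).
Proof. by rewrite -stalk_mapE. Qed.

Definition sub_factor (G : sheaf k T) (g : hom G F)
  (gS : forall x a, S x (stalk_map g (a : stalk G x))) : hom G sub_sheaf.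
Proof.
exists (fun U s => mk_ssec (sub_factor_subproof gS s)) => [U a s t|U W h s].
  by apply: ssec_inj; rewrite [RHS]ssval_linear /= linearP.
by apply: ssec_inj; rewrite /= hom_natural.
Defined.

Lemma sub_factorK (G : sheaf k T) (g : hom G F)
    (gS : forall x a, S x (stalk_map g (a : stalk G x))) x (a : stalk G x) :
  stalk_map sub_incl (stalk_map (sub_factor gS) a) = stalk_map g a.
Proof. by have [U [Ux [s ->]]] := germ_surj a; rewrite !stalk_mapE. Qed.

End Def.
End Subsheaf.

Section Subcomplex.
Context (k : fieldType) (T : topologicalType).
Implicit Types X Y Z : complex k T.

Lemma stalk_df_df X i j l x (a : stalk (X i) x) :
  stalk_map (df X j l) (stalk_map (df X i j) a) = 0.
Proof. by apply: stalk_map2_eq0 => U s; exact: df_df. Qed.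

Lemma stalk_df_shape X i j x (a : stalk (X i) x) : j != i + 1 ->
  stalk_map (df X i j) a = 0.
Proof. by move=> ij; apply: stalk_map_eq0 => U s; exact: df_shape. Qed.

Lemma stalk_cmap_df X Y (f : cmap X Y) i j x (a : stalk (X i) x) :
  stalk_map (df Y i j) (stalk_map (f i) a)
  = stalk_map (f j) (stalk_map (df X i j) a).
Proof.
by have [U [Ux [s ->]]] := germ_surj a; rewrite !stalk_mapE cmap_df.
Qed.

Record subcx X := SubCx {
  scx :> forall i, subfam (X i);
  scx_df : forall i j x a, scx i x a -> scx j x (stalk_map (df X i j) a) }.

Definition open_scx X (S : subcx X) := forall i, open_fam (S i).

Section Def.
Context (X : complex k T) (S : subcx X).

Fact sub_df_subproof i j x (a : stalk (sub_sheaf (S i)) x) :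
  S j x (stalk_map (hcomp (df X i j) (sub_incl (S i))) a).
Proof. by rewrite stalk_map_comp; apply: scx_df; exact: sub_inclP. Qed.

Definition sub_complex : complex k T.
Proof.
exists (fun i => sub_sheaf (S i)) (fun i j => sub_factor (@sub_df_subproof i j)).
- by move=> i j U s ij; apply: ssec_inj; rewrite /= df_shape.
- by move=> i j l U s; apply: ssec_inj; rewrite /= df_df.
have [n Xn] := complex_bounded X; exists n => i ni U s.
by apply: ssec_inj; rewrite [LHS](Xn i ni) [RHS](Xn i ni).
Defined.

Definition sub_cincl : cmap sub_complex X.
Proof. by exists (fun i => sub_incl (S i)). Defined.

Definition sub_cfactor Y (g : cmap Y X)
  (gS : forall i x a, S i x (stalk_map (g i) (a : stalk (Y i) x))) :
  cmap Y sub_complex.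
Proof.
exists (fun i => sub_factor (gS i)) => i j U s.
by apply: ssec_inj; rewrite /= cmap_df.
Defined.

End Def.
End Subcomplex.

(** * Stalkwise cocycles and coboundaries, truncations *)

Section SubfamTheory.
Context (k : fieldType) (T : topologicalType) (F : sheaf k T) (S : subfam F).
Context (x : T).
Implicit Types u v : stalk F x.

Lemma sfamZ a u : S x u -> S x (a *: u).
Proof. by move=> Su; rewrite -[_ *: _]addr0; apply: sfamP => //; exact: sfam0. Qed.
Lemma sfamD u v : S x u -> S x v -> S x (u + v).
Proof. by move=> Su Sv; rewrite -[u]scale1r; exact: sfamP. Qed.
Lemma sfamN u : S x u -> S x (- u).
Proof. by rewrite -scaleN1r; exact: sfamZ. Qed.
Lemma sfamB u v : S x u -> S x v -> S x (u - v).
Proof. by move=> Su /sfamN; exact: sfamD. Qed.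
Lemma sfamBr u v : S x (u - v) -> S x v -> S x u.
Proof. by move=> uv Sv; rewrite -(subrK v u); exact: sfamD. Qed.
Lemma sfam_sym u v : S x (u - v) -> S x (v - u).
Proof. by move/sfamN; rewrite opprB. Qed.
Lemma sfam_trans u v w : S x (u - v) -> S x (v - w) -> S x (u - w).
Proof. by move=> uv vw; rewrite -(subrKA v); exact: sfamD. Qed.

End SubfamTheory.

Section Cohomology.
Context (k : fieldType) (T : topologicalType).
Implicit Types X Y Z : complex k T.

Definition cyc X i : subfam (X i).
Proof.
exists (fun x a => stalk_map (df X i (i + 1)) a = 0) => [x|x a u v]; first exact: linear0.
by rewrite linearP /= => -> ->; rewrite scaler0 addr0.
Defined.

Definition bd X i : subfam (X i).
Proof.
exists (fun x a => exists b, a = stalk_map (df X (i - 1) i) b) => [x|x a u v].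
  by exists 0; rewrite linear0.
by move=> [b ->] [c ->]; exists (a *: b + c); rewrite linearP.
Defined.

(** Relations between degrees are passed as hypotheses, here and below, because [i - 1 + 1] and [i]
    are equal without being convertible. *)
Lemma cycE X i j x (a : stalk (X i) x) : j = i + 1 ->
  cyc X i x a <-> stalk_map (df X i j) a = 0.
Proof. by move=> ->. Qed.

Lemma bdE X h i x (a : stalk (X i) x) : i = h + 1 ->
  bd X i x a <-> exists b : stalk (X h) x, a = stalk_map (df X h i) b.
Proof.
move=> e; have {e} eh : h = i - 1 by rewrite e addrK.
by subst h.
Qed.

Lemma bd_cyc X i x (a : stalk (X i) x) : bd X i x a -> cyc X i x a.
Proof. by move=> [b ->]; exact: stalk_df_df. Qed.

Lemma bd_df X i j x (a : stalk (X i) x) : j = i + 1 ->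
  bd X j x (stalk_map (df X i j) a).
Proof. by move=> ji; apply/(bdE _ ji); exists a. Qed.

Lemma cmap_cyc X Y (f : cmap X Y) i x (a : stalk (X i) x) :
  cyc X i x a -> cyc Y i x (stalk_map (f i) a).
Proof. by rewrite /= stalk_cmap_df => ->; rewrite linear0. Qed.

Lemma cmap_bd X Y (f : cmap X Y) i x (a : stalk (X i) x) :
  bd X i x a -> bd Y i x (stalk_map (f i) a).
Proof. by move=> [b ->]; exists (stalk_map (f (i - 1)) b); rewrite stalk_cmap_df. Qed.

Lemma open_cyc X i : open_fam (cyc X i).
Proof.
move=> x a; have [U [Ux [s ->]]] := germ_surj a; rewrite /= stalk_mapE.
move=> /germ_eq0[O [h [Ox e]]]; exists O, Ox, (res h s).
split=> [|y Oy]; first by rewrite (germ_res Ux).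
by rewrite stalk_mapE -hom_natural e linear0.
Qed.

Lemma open_bd X i : open_fam (bd X i).
Proof.
move=> x a [b ->]; have [U [Ux [s ->]]] := germ_surj b.
exists U, Ux, (df X (i - 1) i U s); rewrite stalk_mapE; split=> // y Uy.
by exists (germ Uy s); rewrite stalk_mapE.
Qed.

Lemma quasi_isoP X Y (f : cmap X Y) : quasi_iso f <->
  forall i x,
    (forall a, cyc X i x a -> bd Y i x (stalk_map (f i) a) -> bd X i x a) /\
    (forall c, cyc Y i x c -> exists a, cyc X i x a /\
       bd Y i x (c - stalk_map (f i) a)).
Proof.
split=> [qf i x|qf h i j x ih ->].
  have ih : i = i - 1 + 1 by rewrite subrK.
  have [inj sur] := qf _ _ _ x ih erefl; split=> // c /sur[a [b [a0 ->]]].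
  by exists a; split=> //; exists b; rewrite [X in X - _]addrC addrK.
have [inj sur] := qf i x; split=> [a ca ba|c cc].
  by apply/(bdE _ ih)/inj => //; apply/(bdE _ ih).
have [a [ca /(bdE _ ih)[b e]]] := sur c cc; exists a, b; split=> //.
by rewrite -e addrC subrK.
Qed.

Lemma quasi_iso_bij X Y (f : cmap X Y) :
  (forall i x (a : stalk (X i) x), stalk_map (f i) a = 0 -> a = 0) ->
  (forall i x c, exists a : stalk (X i) x, c = stalk_map (f i) a) ->
  quasi_iso f.
Proof.
move=> inj sur; have inj' i x (a b : stalk (X i) x) :
    stalk_map (f i) a = stalk_map (f i) b -> a = b.
  by move=> e; apply/subr0_eq/inj; rewrite linearB /= e subrr.
apply/quasi_isoP => i x; split=> [a _ [b]|c cc].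
  have [b' ->] := sur (i - 1) x b; rewrite stalk_cmap_df => /inj' ->.
  by exists b'.
have [a cE] := sur i x c; exists a; split; last by rewrite -cE subrr; exact: sfam0.
by apply: inj; rewrite -stalk_cmap_df -cE.
Qed.

Lemma quasi_iso_comp X Y Z (g : cmap Y Z) (f : cmap X Y) :
  quasi_iso g -> quasi_iso f -> quasi_iso (cmap_comp g f).
Proof.
move=> /quasi_isoP qg /quasi_isoP qf; apply/quasi_isoP => i x.
have [gi gs] := qg i x; have [fi fs] := qf i x; split=> [a ca|c cc].
  by rewrite stalk_map_comp => bgf; apply/fi/gi => //; exact: cmap_cyc.
have [b [cb bb]] := gs c cc; have [a [ca ba]] := fs b cb.
exists a; split=> //; rewrite stalk_map_comp; apply: sfam_trans bb _.
by rewrite -linearB; exact: cmap_bd.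
Qed.

Section Factor.
Context (X Y : complex k T) (S : subcx X) (oS : open_scx S) (g : cmap Y X).
Hypothesis gS : forall i x a, S i x (stalk_map (g i) (a : stalk (Y i) x)).

(** Being a coboundary depends on the subcomplex, since the primitive has to lie in S; being a
    cocycle does not, the inclusion being injective on stalks. *)
Lemma sub_bdP i x (a : stalk (sub_complex S i) x) :
  bd (sub_complex S) i x a <-> exists b, S (i - 1) x b /\
    stalk_map (sub_incl (S i)) a = stalk_map (df X (i - 1) i) b.
Proof.
split=> [[b ->]|[b [/(sub_incl_surj (oS (i := i - 1)))[b' ->] e]]].
  exists (stalk_map (sub_incl (S (i - 1))) b); split; first exact: sub_inclP.
  exact/esym/(stalk_cmap_df (sub_cincl S)).
exists b'; apply/subr0_eq/sub_incl_inj; rewrite linearB /= e.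
by rewrite (stalk_cmap_df (sub_cincl S)) subrr.
Qed.

Lemma sub_cycP i x (a : stalk (sub_complex S i) x) :
  cyc (sub_complex S) i x a <-> cyc X i x (stalk_map (sub_incl (S i)) a).
Proof.
split=> [ca|]; first exact: (cmap_cyc (sub_cincl S)).
by rewrite /= (stalk_cmap_df (sub_cincl S)) => /sub_incl_inj.
Qed.

Lemma quasi_iso_factor :
  (forall i x a b, cyc Y i x a -> S (i - 1) x b ->
     stalk_map (g i) a = stalk_map (df X (i - 1) i) b -> bd Y i x a) ->
  (forall i x c, S i x c -> cyc X i x c -> exists a b, [/\ cyc Y i x a,
     S (i - 1) x b & c = stalk_map (g i) a + stalk_map (df X (i - 1) i) b]) ->
  quasi_iso (sub_cfactor gS).
Proof.
move=> inj sur; apply/quasi_isoP => i x; split=> [a ca|c].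
  by move=> /sub_bdP[b [Sb]]; rewrite sub_factorK; exact: inj.
move=> /sub_cycP /(sur _ _ _ (sub_inclP c))[a [b [ca Sb cE]]].
exists a; split=> //; apply/sub_bdP; exists b; split=> //.
by rewrite linearB /= sub_factorK cE addrAC subrr add0r.
Qed.

Lemma quasi_iso_factor_bij :
  (forall i x (a : stalk (Y i) x), stalk_map (g i) a = 0 -> a = 0) ->
  (forall i x c, S i x c -> exists a : stalk (Y i) x, c = stalk_map (g i) a) ->
  quasi_iso (sub_cfactor gS).
Proof.
move=> inj sur; apply: quasi_iso_bij => i x a.
  by move=> a0; apply: inj; rewrite -(sub_factorK (@gS i)) [stalk_map (sub_factor _) _]a0 linear0.
have [b e] := sur _ _ _ (sub_inclP a); exists b.
by apply/subr0_eq/sub_incl_inj; rewrite linearB /= sub_factorK e subrr.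
Qed.

End Factor.

(* Subsheaves of the cohomology sheaves, as families of groups of cocycles
   that contain the coboundaries. *)
Record cohfam X := CohFam {
  cohf :> forall i, subfam (X i);
  cohf_bd : forall i x a, bd X i x a -> cohf i x a;
  cohf_cyc : forall i x a, cohf i x a -> cyc X i x a;
  cohf_open : forall i, open_fam (cohf i) }.

Section Truncation.
Context (X : complex k T) (n : int) (S : cohfam X).

(** An interpolation between two truncations: the cohomology stops in degree n - 1 if S consists of
    the coboundaries, and in degree n if it consists of the cocycles. That S lies between the two
    makes this a subcomplex. *)
Definition tau_fam i : subfam (X i).
Proof.
exists (fun x a => if i < n then True else if i == n then S i x a else a = 0).
  by move=> x; case: ifP => // _; case: ifP => // _; exact: sfam0.
move=> x a u v; case: ifP => // _; case: ifP => // _; first exact: sfamP.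
by move=> -> ->; rewrite scaler0 addr0.
Defined.

Fact tau_df i j x (a : stalk (X i) x) :
  tau_fam i x a -> tau_fam j x (stalk_map (df X i j) a).
Proof.
have [ji|ji _] := eqVneq j (i + 1); last by rewrite stalk_df_shape //; exact: sfam0.
rewrite /=; case: ltgtP => [lin _|lni ->|ein /cohf_cyc /(cycE _ ji) ->].
- case: ltgtP => // [nj|jn]; last exact/cohf_bd/bd_df.
  by have := lt_le_trans nj (_ : j <= n); rewrite ltxx ji lezD1 => /(_ lin).
- rewrite linear0; case: ifP => // _; case: ifP => // _; exact: sfam0.
- case: ifP => // _; case: ifP => // _; exact: sfam0.
Qed.

Definition tau : subcx X := SubCx tau_df.

Lemma open_tau : open_scx tau.
Proof.
move=> i x a /=; have [U [Ux [s ->]]] := germ_surj a.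
case: ltgtP => _; first by exists U, Ux, s.
  move=> /germ_eq0[O [h [Ox e]]]; exists O, Ox, (res h s).
  by split=> [|y Oy]; rewrite ?(germ_res Ux) // e linear0.
move=> /(cohf_open (i:=i)); exact.
Qed.

End Truncation.

(** The cohomology of the truncation is that of X below n, S modulo coboundaries in degree n, and 0
    above; hence S and S' have to correspond in degree n only. *)
Lemma tau_qis X Y (f : cmap X Y) n (S : cohfam X) (S' : cohfam Y) :
  quasi_iso f ->
  (forall x a, cyc X n x a -> S n x a <-> S' n x (stalk_map (f n) a)) ->
  exists g : cmap (sub_complex (tau n S)) (sub_complex (tau n S')), quasi_iso g.
Proof.
move=> /quasi_isoP qf SS'.
have gS i x (a : stalk (sub_complex (tau n S) i) x) :
    tau n S' i x (stalk_map (cmap_comp f (sub_cincl (tau n S)) i) a).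
  rewrite stalk_map_comp; have /= := sub_inclP a; case: ltgtP => // [_ ->|e Sa].
    by rewrite linear0.
  by subst i; apply/SS' => //; exact: cohf_cyc Sa.
exists (sub_cfactor gS); apply: quasi_iso_factor; first exact: open_tau.
  move=> i x a b /(sub_cycP) ca tb; rewrite stalk_map_comp => e.
  apply/(sub_bdP (@open_tau _ n S)).
  have [in1|in1] := ltP n i.
    exists 0; split; first exact: sfam0.
    by have /= := sub_inclP a; rewrite ltNge (ltW in1) /= gt_eqF // => ->; rewrite linear0.
  have [inj _] := qf i x; have [|b' ->] := inj _ ca; first by exists b.
  by exists b'; split=> //=; rewrite ltrBlDr ltzD1 in1.
move=> i x c tc cc.
have [in1|in1] := ltP n i.
  exists 0, 0; split; [exact: sfam0|exact: sfam0|].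
  by rewrite !linear0 addr0; move: tc => /=; rewrite ltNge (ltW in1) /= gt_eqF.
have [_ sur] := qf i x; have [a [ca [b e]]] := sur c cc.
(* In degree n, f a = c - (c - f a) is in S', because c - f a is a coboundary; so a is in S. *)
have ta : tau n S i x a.
  move: tc in1 => /=; case: ltgtP => // ein Sc _; subst i.
  apply/SS' => //; rewrite -[stalk_map _ a](subKr c) e.
  by apply: sfamB => //; apply: cohf_bd; exists b.
have [a' aE] := sub_incl_surj (@open_tau _ n S i) ta.
exists a', b; split.
- by apply/sub_cycP; rewrite -aE.
- by rewrite /= ltrBlDr ltzD1 in1.
- by rewrite stalk_map_comp -aE -e addrC subrK.
Qed.

Lemma d_isomorphic_refl X : d_isomorphic X X.
Proof.
by exists (did X), (did X); split; exact: dmor_eq_idl.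
Qed.

Lemma d_isomorphic_sym X Y : d_isomorphic X Y -> d_isomorphic Y X.
Proof. by move=> [u [v [vu uv]]]; exists v, u. Qed.

Lemma dcompK X Y Z (u : dmor X Y) (u' : dmor Y X) (v : dmor Y Z) (v' : dmor Z Y) :
  dmor_eq (dcomp u' u) (did X) -> dmor_eq (dcomp v' v) (did Y) ->
  dmor_eq (dcomp (dcomp u' v') (dcomp v u)) (did X).
Proof.
move=> u'u v'v; apply: dmor_eq_trans (dmor_eq_assoc _ _ _) _.
apply: dmor_eq_trans u'u; apply: dmor_eq_comp (dmor_eq_refl _).
apply: dmor_eq_trans (dmor_eq_sym (dmor_eq_assoc _ _ _)) _.
by apply: dmor_eq_trans (dmor_eq_idr _); apply: dmor_eq_comp (dmor_eq_refl _) _.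
Qed.

Lemma d_isomorphic_trans Y X Z :
  d_isomorphic X Y -> d_isomorphic Y Z -> d_isomorphic X Z.
Proof.
move=> [u [u' [u'u uu']]] [v [v' [v'v vv']]].
by exists (dcomp v u), (dcomp u' v'); split; exact: dcompK.
Qed.

Lemma quasi_iso_isomorphic X Y (f : cmap X Y) : quasi_iso f -> d_isomorphic X Y.
Proof.
move=> qf; exists (dmap f), (dinv qf); split; first exact: dmor_eq_invl.
exact: dmor_eq_invr.
Qed.

End Cohomology.

(** * Isomorphisms as pairs of quasi-isomorphisms *)

Section SumStalk.
Context (k : fieldType) (T : topologicalType) (F G : sheaf k T).

Definition sum_snd : hom (sum_sheaf F G) G.
Proof. by exists (fun U s => s.2). Defined.

Definition sum_inl : hom F (sum_sheaf F G).
Proof.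
exists (fun U s => (s, 0 : G U)) => [U a s t|U W h s].
  suff e : (0 : G U) = a *: 0 + 0 by rewrite [in LHS]e.
  by rewrite scaler0 addr0.
by rewrite /= linear0.
Defined.

Context (x : T).

Definition sum_pair (a : stalk F x) (b : stalk G x) : stalk (sum_sheaf F G) x :=
  stalk_map sum_inl a + stalk_map (sum_inr F G) b.

Lemma sum_pair1 a b : stalk_map (sum_fst F G) (sum_pair a b) = a.
Proof.
rewrite linearD /= -!stalk_map_comp.
have -> : stalk_map (hcomp (sum_fst F G) sum_inl) a = a.
  by rewrite -[RHS]stalk_map_id; exact: stalk_map_ext.
by rewrite stalk_map_eq0 ?addr0.
Qed.

Lemma sum_pair2 a b : stalk_map sum_snd (sum_pair a b) = b.
Proof.
rewrite linearD /= -!stalk_map_comp.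
have -> : stalk_map (hcomp sum_snd (sum_inr F G)) b = b.
  by rewrite -[RHS]stalk_map_id; exact: stalk_map_ext.
by rewrite stalk_map_eq0 ?add0r.
Qed.

Lemma sum_stalk_ext (c d : stalk (sum_sheaf F G) x) :
  stalk_map (sum_fst F G) c = stalk_map (sum_fst F G) d ->
  stalk_map sum_snd c = stalk_map sum_snd d -> c = d.
Proof.
have [U [Ux [s [t [-> ->]]]]] := germ_surj2 c d; rewrite !stalk_mapE /=.
move=> e1 e2; apply/subr0_eq; rewrite -linearB /=.
have /germ_eq0[O [h [Ox r1]]] : germ Ux (s.1 - t.1) = 0.
  by rewrite linearB /= e1 subrr.
have /germ_eq0[O' [h' [Ox' r2]]] : germ Ux (s.2 - t.2) = 0.
  by rewrite linearB /= e2 subrr.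
have Qx : opensI O O' x by [].
have hQ := subset_trans (@opensIl _ O O') h.
rewrite -(germ_res Ux Qx hQ) (_ : res hQ _ = 0) ?linear0 //=.
congr pair; rewrite /=.
  by rewrite -(res_comp h (@opensIl _ O O')) r1 linear0.
rewrite (Prop_irrelevance hQ (subset_trans (@opensIr _ O O') h')).
by rewrite -(res_comp h' (@opensIr _ O O')) r2 linear0.
Qed.

End SumStalk.

Section SumComplex.
Context (k : fieldType) (T : topologicalType).

Definition sum_complex (X Y : complex k T) : complex k T.
Proof.
unshelve eexists (fun i => sum_sheaf (X i) (Y i)) (fun i j => _).
- exists (fun U s => (df X i j U s.1, df Y i j U s.2)) => [U a s t|U W h s].
    by rewrite /= !linearP.
  by rewrite /= !hom_natural.
- by move=> i j U s ij /=; rewrite !df_shape.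
- by move=> i j l U s /=; rewrite !df_df.
have [m Xm] := complex_bounded X; have [n Yn] := complex_bounded Y.
exists (maxn m n) => i; rewrite gtn_max => /andP[mi ni] U [x y].
by rewrite (Xm i mi U x) (Yn i ni U y).
Defined.

Context (Y W W' : complex k T) (f : cmap Y W) (g : cmap Y W').

(** With this sign the cone of Y -> W + W' is the homotopy pushout of f and g: the two composites
    from Y to the cone are homotopic. *)
Definition csum_map : cmap Y (sum_complex W W').
Proof.
unshelve eexists (fun i => _).
  exists (fun U s => (f i U s, - g i U s)) => [U a s t|U O h s].
    by congr pair; rewrite linearP //= opprD scalerN.
  by congr pair; rewrite /= ?linearN /= hom_natural.
by move=> i j U s; congr pair; rewrite /= ?linearN /= cmap_df.
Defined.

Definition push := cone csum_map.

Definition pushl : cmap W push.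
Proof.
unshelve eexists (fun i => hcomp (sum_inr _ _) (sum_inl (W i) (W' i))).
by move=> i j U s; rewrite /= /cone_fun /= !linear0 add0r.
Defined.

Definition pushr : cmap W' push.
Proof.
unshelve eexists (fun i => hcomp (sum_inr _ _) (sum_inr (W i) (W' i))).
by move=> i j U s; rewrite /= /cone_fun /= !linear0 add0r.
Defined.

End SumComplex.

Section StalkIdentities.
Context (k : fieldType) (T : topologicalType) (F G : sheaf k T) (x : T).

Lemma stalk_map_oppE (f g : hom F G) (a : stalk F x) :
  (forall U s, f U s = - g U s) -> stalk_map f a = - stalk_map g a.
Proof.
have [U [Ux [s ->]]] := germ_surj a => e.
by rewrite stalk_mapE e linearN stalk_mapE.
Qed.

Lemma stalk_map_addE (f g h : hom F G) (a : stalk F x) :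
  (forall U s, f U s = g U s + h U s) ->
  stalk_map f a = stalk_map g a + stalk_map h a.
Proof.
have [U [Ux [s ->]]] := germ_surj a => e.
rewrite stalk_mapE e linearD.
by congr (_ + _); rewrite stalk_mapE.
Qed.

End StalkIdentities.

Section ConeStalk.
Context (k : fieldType) (T : topologicalType) (X Y : complex k T) (f : cmap X Y).

Definition cone_fst i : hom (cone f i) (X (i + 1)) := sum_fst _ _.
Definition cone_snd i : hom (cone f i) (Y i) := sum_snd _ _.

Context (x : T).

Lemma cone_ext i (c d : stalk (cone f i) x) :
  stalk_map (cone_fst i) c = stalk_map (cone_fst i) d ->
  stalk_map (cone_snd i) c = stalk_map (cone_snd i) d -> c = d.
Proof. exact: sum_stalk_ext. Qed.

Lemma cone_pair i (a : stalk (X (i + 1)) x) (b : stalk (Y i) x) :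
  exists c : stalk (cone f i) x,
    stalk_map (cone_fst i) c = a /\ stalk_map (cone_snd i) c = b.
Proof.
by exists (sum_pair a b); split; [exact: sum_pair1|exact: sum_pair2].
Qed.

Lemma cone_df1 i j (c : stalk (cone f i) x) :
  stalk_map (cone_fst j) (stalk_map (df (cone f) i j) c)
  = - stalk_map (df X (i + 1) (j + 1)) (stalk_map (cone_fst i) c).
Proof.
rewrite -stalk_map_comp -[in RHS]stalk_map_comp; exact: stalk_map_oppE.
Qed.

Lemma cone_df2 i (c : stalk (cone f i) x) :
  stalk_map (cone_snd (i + 1)) (stalk_map (df (cone f) i (i + 1)) c)
  = stalk_map (f (i + 1)) (stalk_map (cone_fst i) c)
    + stalk_map (df Y i (i + 1)) (stalk_map (cone_snd i) c).
Proof.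
rewrite -stalk_map_comp -[X in _ = X + _]stalk_map_comp.
rewrite -[X in _ = _ + X]stalk_map_comp.
by apply: stalk_map_addE => U s /=; rewrite hdelta_id.
Qed.

Lemma cone_in_fst i (b : stalk (Y i) x) :
  stalk_map (cone_fst i) (stalk_map (cone_in f i) b) = 0.
Proof. by rewrite -stalk_map_comp; exact: stalk_map_eq0. Qed.

Lemma cone_in_snd i (b : stalk (Y i) x) :
  stalk_map (cone_snd i) (stalk_map (cone_in f i) b) = b.
Proof.
rewrite -stalk_map_comp -[RHS]stalk_map_id; exact: stalk_map_ext.
Qed.

End ConeStalk.

Section SumComplexStalk.
Context (k : fieldType) (T : topologicalType) (X Y : complex k T).

Definition csum_fst i : hom (sum_complex X Y i) (X i) := sum_fst _ _.
Definition csum_snd i : hom (sum_complex X Y i) (Y i) := sum_snd _ _.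

Context (x : T).

Lemma csum_ext i (c d : stalk (sum_complex X Y i) x) :
  stalk_map (csum_fst i) c = stalk_map (csum_fst i) d ->
  stalk_map (csum_snd i) c = stalk_map (csum_snd i) d -> c = d.
Proof. exact: sum_stalk_ext. Qed.

Lemma csum_pair i (a : stalk (X i) x) (b : stalk (Y i) x) :
  exists c : stalk (sum_complex X Y i) x,
    stalk_map (csum_fst i) c = a /\ stalk_map (csum_snd i) c = b.
Proof.
by exists (sum_pair a b); split; [exact: sum_pair1|exact: sum_pair2].
Qed.

Lemma csum_df1 i j (c : stalk (sum_complex X Y i) x) :
  stalk_map (csum_fst j) (stalk_map (df (sum_complex X Y) i j) c)
  = stalk_map (df X i j) (stalk_map (csum_fst i) c).
Proof.
rewrite -stalk_map_comp -[in RHS]stalk_map_comp; exact: stalk_map_ext.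
Qed.

Lemma csum_df2 i j (c : stalk (sum_complex X Y i) x) :
  stalk_map (csum_snd j) (stalk_map (df (sum_complex X Y) i j) c)
  = stalk_map (df Y i j) (stalk_map (csum_snd i) c).
Proof.
rewrite -stalk_map_comp -[in RHS]stalk_map_comp; exact: stalk_map_ext.
Qed.

End SumComplexStalk.

Section Pushout.
Context (k : fieldType) (T : topologicalType).
Context (Y W W' : complex k T) (f : cmap Y W) (g : cmap Y W') (x : T).

Let p1 i : stalk (push f g i) x -> stalk (W i) x :=
  fun c => stalk_map (csum_fst W W' i) (stalk_map (cone_snd (csum_map f g) i) c).
Let p2 i : stalk (push f g i) x -> stalk (W' i) x :=
  fun c => stalk_map (csum_snd W W' i) (stalk_map (cone_snd (csum_map f g) i) c).
Let p0 i : stalk (push f g i) x -> stalk (Y (i + 1)) x :=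
  fun c => stalk_map (cone_fst (csum_map f g) i) c.

Lemma push_ext i (c d : stalk (push f g i) x) :
  p0 c = p0 d -> p1 c = p1 d -> p2 c = p2 d -> c = d.
Proof. by move=> e0 e1 e2; apply: cone_ext => //; exact: csum_ext. Qed.

Lemma push_elt i (y : stalk (Y (i + 1)) x) (w : stalk (W i) x)
    (w' : stalk (W' i) x) : exists c : stalk (push f g i) x,
  [/\ p0 c = y, p1 c = w & p2 c = w'].
Proof.
have [v [v1 v2]] := csum_pair w w'.
have [c [c1 c2]] := cone_pair (csum_map f g) y v.
by exists c; rewrite /p1 /p2 c2.
Qed.

Lemma push_df0 i c : p0 (stalk_map (df (push f g) i (i + 1)) c)
  = - stalk_map (df Y (i + 1) (i + 1 + 1)) (p0 c).
Proof. exact: cone_df1. Qed.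

Lemma push_df1 i c : p1 (stalk_map (df (push f g) i (i + 1)) c)
  = stalk_map (f (i + 1)) (p0 c) + stalk_map (df W i (i + 1)) (p1 c).
Proof.
rewrite /p1 [stalk_map (cone_snd _ _) _]cone_df2 linearD.
congr (_ + _); last exact: csum_df1.
rewrite -[LHS]stalk_map_comp; exact: stalk_map_ext.
Qed.

Lemma push_df2 i c : p2 (stalk_map (df (push f g) i (i + 1)) c)
  = - stalk_map (g (i + 1)) (p0 c) + stalk_map (df W' i (i + 1)) (p2 c).
Proof.
rewrite /p2 [stalk_map (cone_snd _ _) _]cone_df2 linearD.
congr (_ + _); last exact: csum_df2.
rewrite -[LHS]stalk_map_comp; exact: stalk_map_oppE.
Qed.

Lemma pushlE i (w : stalk (W i) x) (c := stalk_map (pushl f g i) w) :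
  [/\ p0 c = 0, p1 c = w & p2 c = 0].
Proof.
rewrite /p0 /p1 /p2 /c; split; rewrite -!stalk_map_comp.
- exact: stalk_map_eq0.
- by rewrite -[RHS]stalk_map_id; exact: stalk_map_ext.
- exact: stalk_map_eq0.
Qed.

Lemma pushrE i (w : stalk (W' i) x) (c := stalk_map (pushr f g i) w) :
  [/\ p0 c = 0, p1 c = 0 & p2 c = w].
Proof.
rewrite /p0 /p1 /p2 /c; split; rewrite -!stalk_map_comp.
- exact: stalk_map_eq0.
- exact: stalk_map_eq0.
- by rewrite -[RHS]stalk_map_id; exact: stalk_map_ext.
Qed.

Lemma push0D i (c d : stalk (push f g i) x) : p0 (c + d) = p0 c + p0 d.
Proof. exact: linearD. Qed.
Lemma push1D i (c d : stalk (push f g i) x) : p1 (c + d) = p1 c + p1 d.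
Proof. by rewrite /p1 !linearD. Qed.
Lemma push2D i (c d : stalk (push f g i) x) : p2 (c + d) = p2 c + p2 d.
Proof. by rewrite /p2 !linearD. Qed.
Lemma push0N i (c : stalk (push f g i) x) : p0 (- c) = - p0 c.
Proof. exact: linearN. Qed.
Lemma push1N i (c : stalk (push f g i) x) : p1 (- c) = - p1 c.
Proof. by rewrite /p1 !linearN. Qed.
Lemma push2N i (c : stalk (push f g i) x) : p2 (- c) = - p2 c.
Proof. by rewrite /p2 !linearN. Qed.

(** The homotopy sends y to (y, 0, 0), whose differential (- d y, f y, - g y) has first coordinate 0
    when y is a cocycle. *)
Lemma push_bd i (y : stalk (Y i) x) : cyc Y i x y ->
  bd (push f g) i x (stalk_map (pushl f g i) (stalk_map (f i) y)
                     - stalk_map (pushr f g i) (stalk_map (g i) y)).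
Proof.
have e : i = i - 1 + 1 by rewrite subrK.
move: (i - 1) e => h e; subst i => cy; apply/(bdE _ erefl).
have [c [c0 c1 c2]] := push_elt y (0 : stalk (W h) x) (0 : stalk (W' h) x).
exists c.
have [l0 l1 l2] := pushlE (stalk_map (f (h + 1)) y).
have [r0 r1 r2] := pushrE (stalk_map (g (h + 1)) y).
apply: push_ext.
- by rewrite push0D push0N l0 r0 push_df0 c0 [stalk_map _ y]cy; rewrite oppr0 addr0.
- by rewrite push1D push1N l1 r1 push_df1 c0 c1 !linear0 !addr0.
- by rewrite push2D push2N l2 r2 push_df2 c0 c2 !linear0 add0r addr0.
Qed.

(** The quotient of the pushout by W' is the cone of f, which is acyclic. The chase is done in
    coordinates (y, v, v'), with differential (- d y, f y + d v, - g y + d v'); it uses the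
    injectivity of f on cohomology in degrees i and i + 1 and its surjectivity in degree i. *)
Lemma quasi_iso_pushr_at : quasi_iso f -> forall h i j : int,
  i = h + 1 -> j = i + 1 ->
    (forall a : stalk (W' i) x, cyc W' i x a ->
       (exists b : stalk (push f g h) x,
          stalk_map (pushr f g i) a = stalk_map (df (push f g) h i) b) ->
       exists b : stalk (W' h) x, a = stalk_map (df W' h i) b) /\
    (forall c : stalk (push f g i) x, stalk_map (df (push f g) i j) c = 0 ->
       exists (a : stalk (W' i) x) (b : stalk (push f g h) x),
         stalk_map (df W' i j) a = 0 /\
         c = stalk_map (pushr f g i) a + stalk_map (df (push f g) h i) b).
Proof.
move=> qf h _ _ -> ->; split=> [w cw [c e]|c cc].
  have [r0 r1 r2] := pushrE w; rewrite e in r0 r1 r2.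
  move: r0 r1 r2; rewrite push_df0 push_df1 push_df2.
  set y := p0 c; set v := p1 c; set v' := p2 c => /eqP; rewrite oppr_eq0 => /eqP dy.
  move=> /eqP; rewrite addr_eq0 => /eqP fy <-.
  have [inj _] := qf _ _ _ x (erefl (h + 1)) erefl.
  have [|y0 ->] := inj y dy; first by exists (- v); rewrite fy linearN.
  exists (v' - stalk_map (g h) y0).
  rewrite [RHS]linearB /= stalk_cmap_df. exact: addrC.
have := congr1 (@p2 _) cc; have := congr1 (@p1 _) cc; have := congr1 (@p0 _) cc.
rewrite push_df0 push_df1 push_df2 /p0 /p1 /p2 !linear0 -/(p0 c) -/(p1 c) -/(p2 c).
set y := p0 c; set v := p1 c; set v' := p2 c.
move=> /eqP; rewrite oppr_eq0 => /eqP dy /eqP; rewrite addr_eq0 => /eqP fy.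
move=> /eqP; rewrite addr_eq0 eqr_opp => /eqP dv'.
have [inj _] := qf _ _ _ x (erefl (h + 1 + 1)) erefl.
have [|y0 yE] := inj y dy; first by exists (- v); rewrite fy linearN.
have [_ sur] := qf _ _ _ x (erefl (h + 1)) erefl.
(* This is a cocycle, since d (f y0) = f y = - d v. *)
have [|y1 [w0 [cy1 vE]]] := sur (stalk_map (f (h + 1)) y0 + v).
  by rewrite linearD /= stalk_cmap_df -yE fy addNr.
(* The boundary of (y1 - y0, w0, 0) is (y, v, - g (y1 - y0)). Subtracting it from c kills the first
   two coordinates and leaves an element of W'. *)
have [b [b0 b1 b2]] := push_elt (y1 - y0) w0 (0 : stalk (W' h) x).
exists (v' + stalk_map (g (h + 1)) (y1 - y0)), b; split.
  rewrite linearD /= -dv' stalk_cmap_df linearB /= cy1 -yE sub0r linearN /=.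
  exact: subrr.
have [r0 r1 r2] := pushrE (v' + stalk_map (g (h + 1)) (y1 - y0)).
apply: push_ext; rewrite ?push0D ?push1D ?push2D ?r0 ?r1 ?r2 ?push_df0 ?push_df1 ?push_df2.
- by rewrite b0 linearB /= cy1 -yE !sub0r opprK.
- by rewrite b0 b1 add0r linearB /= addrAC -vE addrAC subrr add0r.
- by rewrite b0 b2 linear0 addr0 addrK.
Qed.

End Pushout.

Section Coroof.
Context (k : fieldType) (T : topologicalType).
Implicit Types X Y Z : complex k T.

Lemma quasi_iso_pushr Y W W' (f : cmap Y W) (g : cmap Y W') :
  quasi_iso f -> quasi_iso (pushr f g).
Proof. by move=> qf h i j x ih ->; exact: quasi_iso_pushr_at. Qed.

Lemma stalk_cmap_id X i x (a : stalk (X i) x) : stalk_map (cmap_id X i) a = a.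
Proof. exact: stalk_map_id. Qed.

Lemma stalk_cmap_comp X Y Z (g : cmap Y Z) (f : cmap X Y) i x (a : stalk (X i) x) :
  stalk_map (cmap_comp g f i) a = stalk_map (g i) (stalk_map (f i) a).
Proof. exact: stalk_map_comp. Qed.

Lemma quasi_iso_id X : quasi_iso (cmap_id X).
Proof.
apply: quasi_iso_bij => i x a; first by rewrite stalk_cmap_id.
by exists a; rewrite stalk_cmap_id.
Qed.

(* The relation induced by u between the stalks of H^i(X) and of H^i(Y). *)
Fixpoint crel X Y (u : dmor X Y) i x :
    stalk (X i) x -> stalk (Y i) x -> Prop :=
  match u with
  | dmap X Y f => fun a b => bd Y i x (b - stalk_map (f i) a)
  | dinv X Y f _ => fun a b => bd Y i x (a - stalk_map (f i) b)
  | dcomp X Y Z v u => fun a c =>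
      exists b, [/\ cyc Y i x b, crel u a b & crel v b c]
  end.

Lemma crel_bdr X Y (u : dmor X Y) i x a b b' :
  @crel X Y u i x a b -> bd Y i x (b' - b) -> crel u a b'.
Proof.
elim: u a b b' => {X Y} [X Y f|X Y f qf|X Y Z v IHv u IHu] a b b'; cbn [crel].
- by move=> ab b'b; exact: sfam_trans b'b ab.
- move=> ab b'b; apply: sfam_trans ab _; rewrite -linearB /=.
  exact/cmap_bd/sfam_sym.
- by move=> [c [cc ac cb]] b'b; exists c; split=> //; exact: IHv cb b'b.
Qed.

Lemma crel_bdl X Y (u : dmor X Y) i x a a' b :
  @crel X Y u i x a b -> bd X i x (a' - a) -> crel u a' b.
Proof.
elim: u a a' b => {X Y} [X Y f|X Y f qf|X Y Z v IHv u IHu] a a' b; cbn [crel].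
- move=> ab a'a; apply: sfam_trans ab _; rewrite -linearB /=.
  exact/cmap_bd/sfam_sym.
- by move=> ab a'a; exact: sfam_trans a'a ab.
- by move=> [c [cc ac cb]] a'a; exists c; split=> //; exact: IHu ac a'a.
Qed.

Lemma crel0 X Y (u : dmor X Y) i x : @crel X Y u i x 0 0.
Proof.
elim: u => {X Y} [X Y f|X Y f qf|X Y Z v IHv u IHu]; cbn [crel].
- by rewrite linear0 subrr; exact: sfam0.
- by rewrite linear0 subrr; exact: sfam0.
- by exists 0; split=> //; exact: sfam0.
Qed.

(** This is the statement that H^i is defined on the localization, checked on each rule of the
    congruence. Both elements are cocycles because the middle term of a composite has to be one, and
    because quasi-isomorphisms control cocycles only. *)
Lemma crel_eq X Y (u v : dmor X Y) : dmor_eq u v ->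
  forall i x a b, cyc X i x a -> cyc Y i x b -> crel u a b <-> crel v a b.
Proof.
elim=> {X Y u v} //; cbn [crel did cmap_id cmap_comp cfun].
- by move=> X Y u v _ IH i x a b ca cb; split=> /IH; exact.
- move=> X Y u v w _ IH1 _ IH2 i x a b ca cb.
  by split=> [/IH1 h|/IH2 h]; [apply/IH2 => //; exact: h|apply/IH1 => //; exact: h].
- move=> X Y Z v v' u u' _ IHv _ IHu i x a b ca cb.
  by split=> -[c [cc ac cb']]; exists c; (split=> //; [exact/IHu|exact/IHv]).
- move=> X Y Z W w v u i x a b ca cb; split.
    by move=> [c [cc [d [cd ad dc]] cb']]; exists d; split=> //; exists c.
  by move=> [d [cd ad [c [cc dc cb']]]]; exists c; split=> //; exists d.
- move=> X Y u i x a b ca cb; split=> [[c [cc ac]]|ab].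
    by rewrite stalk_map_id; exact: crel_bdr ac.
  by exists b; split=> //; rewrite stalk_map_id subrr; exact: sfam0.
- move=> X Y u i x a b ca cb; split=> [[c [cc]]|ab].
    by rewrite stalk_map_id => ca' cb'; apply: crel_bdl cb' _; exact: sfam_sym.
  by exists a; split=> //; rewrite stalk_map_id subrr; exact: sfam0.
- by move=> X Y f g fg i x a b ca cb; rewrite (stalk_map_ext a (fg i)).
- move=> X Y Z g f i x a b ca cb; rewrite stalk_map_comp.
  split=> [[c [cc ac cb']]|ab].
    by apply: sfam_trans cb' _; rewrite -linearB; exact: cmap_bd.
  exists (stalk_map (f i) a); split=> //; first exact: cmap_cyc.
  by rewrite subrr; exact: sfam0.
- move=> X Y f /quasi_isoP qf i x a b ca cb; rewrite stalk_map_id.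
  have [inj _] := qf i x; split=> [[c [cc ca' cb']]|ba].
    apply: inj; first exact: sfamB.
    rewrite linearB /=; apply: sfam_trans ca'; exact: sfam_sym.
  exists (stalk_map (f i) a); split; first exact: cmap_cyc.
    by rewrite subrr; exact: sfam0.
  by rewrite -linearB; apply/cmap_bd/sfam_sym.
- move=> X Y f /quasi_isoP qf i x a b ca cb; rewrite stalk_map_id.
  have [_ sur] := qf i x; split=> [[c [cc ca' cb']]|ba].
    apply: sfam_trans cb' _; exact: sfam_sym.
  have [c [cc bc]] := sur a ca; exists c; split=> //.
  exact: sfam_trans ba bc.
Qed.

(** For a composite, the zigzag X -> W <- Y -> W' <- Z is shortened by the homotopy pushout of W <-
    Y -> W', into which W' maps by a quasi-isomorphism. The comparison is made on cohomology, where
    the pushout square commutes by [push_bd]. *)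
Lemma coroof X Y (u : dmor X Y) : exists W (f : cmap X W) (s : cmap Y W),
  quasi_iso s /\ forall i x a b, cyc X i x a -> cyc Y i x b ->
    crel u a b <-> bd W i x (stalk_map (f i) a - stalk_map (s i) b).
Proof.
elim: u => {X Y} [X Y f|X Y f qf|X Y Z v [W' [b [t [qt tE]]]] u [W [a [s [qs sE]]]]].
- exists Y, f, (cmap_id Y); split=> [|i x a b _ _]; cbn [crel cmap_id cfun].
    exact: quasi_iso_id.
  by rewrite stalk_map_id; split; exact: sfam_sym.
- exists Y, (cmap_id Y), f; split=> // i x a b _ _; cbn [crel cmap_id cfun].
  by rewrite stalk_map_id.
exists (push s b), (cmap_comp (pushl s b) a), (cmap_comp (pushr s b) t).
have qr := quasi_iso_pushr b qs; split; first exact: quasi_iso_comp.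
move=> i x p q cp cq; rewrite (stalk_cmap_comp (pushl s b)).
rewrite (stalk_cmap_comp (pushr s b)).
have [_ sur] := (quasi_isoP s).1 qs i x; have [inj _] := (quasi_isoP _).1 qr i x.
have key y : cyc Y i x y -> bd W i x (stalk_map (a i) p - stalk_map (s i) y) ->
    bd (push s b) i x (stalk_map (pushl s b i) (stalk_map (a i) p)
                       - stalk_map (pushr s b i) (stalk_map (b i) y)).
  move=> cy py; apply: sfam_trans _ (push_bd s b cy).
  by rewrite -linearB; exact: cmap_bd.
split=> [[y [cy /(sE _ _ _ _ cp cy) py /(tE _ _ _ _ cy cq) yq]]|pq].
  by apply: sfam_trans (key y cy py) _; rewrite -linearB; exact: cmap_bd.
have [y [cy py]] := sur _ (cmap_cyc a cp); exists y; split=> //; first exact/sE.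
apply/tE => //; apply: inj.
  by apply: sfamB; exact: cmap_cyc.
by rewrite linearB; exact: sfam_trans (sfam_sym (key _ cy py)) pq.
Qed.

Lemma isomorphic_coroof X Y : d_isomorphic X Y ->
  exists W (f : cmap X W) (s : cmap Y W), quasi_iso f /\ quasi_iso s.
Proof.
move=> [u [v [vu uv]]]; have [W [f [s [qs fs]]]] := coroof u.
exists W, f, s; split=> //; apply/quasi_isoP => i x; split=> [a ca ba|c cc].
  (* As f a is a coboundary, u relates a to 0. Composing with v, the identity relates a to 0 as
     well, which means that a is a coboundary. *)
  have a0 : crel u a 0.
    by apply/fs; [|exact: sfam0|rewrite linear0 subr0].
  have /(crel_eq vu ca (sfam0 _ _)) : crel (dcomp v u) a 0.
    by exists 0; split=> //; [exact: sfam0|exact: crel0].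
  cbn [crel did cmap_id cfun]; rewrite stalk_map_id sub0r => /sfamN.
  by rewrite opprK.
have [_ sur] := (quasi_isoP s).1 qs i x; have [b [cb cbd]] := sur c cc.
(* The identity relates b to itself, hence so does [dcomp u v], and the middle term is the required
   preimage. *)
have /(crel_eq uv cb cb)[a [ca _ ab]] : crel (did Y) b b.
  by cbn [crel did cmap_id cfun]; rewrite stalk_map_id subrr; exact: sfam0.
exists a; split=> //; move/(fs _ _ _ _ ca cb): ab => /sfam_sym; exact: sfam_trans.
Qed.

End Coroof.

(** * Subcomplexes whose quotient is a constant sheaf on a locally closed set *)

Section LocalSectionStalk.
Context (k : fieldType) (T : topologicalType) (E : T -> lmodType k).
Context (P : local_cond E) (x : T).

Definition lev (a : stalk (lsheaf P) x) : E x :=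
  lfun (gr_sec (repr a)) (gr_mem (repr a)).

Lemma levE (U : opens T) (Ux : U x) (s : lsheaf P U) : lev (germ Ux s) = lfun s Ux.
Proof.
rewrite /lev; set g := repr _.
have /germP[O [hO [hU [Ox e]]]] : germ (gr_mem g) (gr_sec g) = germ Ux s.
  by rewrite -[RHS]reprK -/g; case: (g).
have := congr1 (fun t : lsheaf P O => lfun t Ox) e.
rewrite /= /family_restrict (Prop_irrelevance (hO x Ox) (gr_mem g)) => ->.
by rewrite (Prop_irrelevance (hU x Ox) Ux).
Qed.

Lemma lev_linear : linear lev.
Proof.
move=> a u v; have [U [Ux [s [t [-> ->]]]]] := germ_surj2 u v.
by rewrite -linearP !levE -lsecPE.
Qed.
HB.instance Definition _ := GRing.isLinear.Build k _ _ _ lev lev_linear.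

Lemma lev_inj :
  (forall (U : opens T) (s : lsheaf P U) (Ux : U x), lfun s Ux = 0 ->
     exists O : opens T, O x /\ forall y (Uy : U y), O y -> lfun s Uy = 0) ->
  injective lev.
Proof.
move=> det; suff ker a : lev a = 0 -> a = 0.
  by move=> a b ab; apply/subr0_eq/ker; rewrite linearB /= ab subrr.
have [U [Ux [s ->]]] := germ_surj a; rewrite levE => /det[O [Ox sO]].
have Qx : opensI U O x by [].
rewrite -(germ_res Ux Qx (@opensIl _ U O)) (_ : res _ s = 0) ?linear0 //.
by apply: lsec_ext => y [Uy Oy]; exact: sO.
Qed.

Section Hom.
Context (G : sheaf k T) (e : forall y, {linear stalk G y -> E y}).
Hypothesis eP : forall (U : opens T) (s : G U), lc P (fun y (Uy : U y) => e y (germ Uy s)).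

Definition lhom : hom G (lsheaf P).
Proof.
exists (fun U s => LSec (eP s)) => [U a s t|U W h s]; apply: lsec_ext => y Uy.
  by rewrite [RHS]lsecPE /= !linearP.
by rewrite /= /family_restrict (germ_res (h y Uy)).
Defined.

Lemma lev_lhom (a : stalk G x) : lev (stalk_map lhom a) = e x a.
Proof. by have [U [Ux [s ->]]] := germ_surj a; rewrite stalk_mapE levE. Qed.

End Hom.

End LocalSectionStalk.

Section ConstantStalk.
Context (k : fieldType) (T : topologicalType) (Z : set T) (M : lmodType k).
Context (x : T).

Definition const_ev : stalk (const_sheaf Z M) x -> M := @lev _ _ _ _ x.
HB.instance Definition _ := GRing.Linear.on const_ev.

Lemma const_evE (U : opens T) (Ux : U x) (s : const_sheaf Z M U) :
  const_ev (germ Ux s) = lfun s Ux.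
Proof. exact: levE. Qed.

Lemma const_ev_inj : injective const_ev.
Proof.
apply: lev_inj => U s Ux s0; have [sZ /(_ x Ux)[W [Wx sW]]] := lfunP s.
exists W; split=> // y Uy Wy.
by have [Zy|nZy] := pselect (Z y); [rewrite sW|rewrite sZ].
Qed.

Lemma const_ev_out a : ~ Z x -> const_ev a = 0.
Proof.
have [U [Ux [s ->]]] := germ_surj a; rewrite const_evE => nZ.
by have [sZ _] := lfunP s; exact: sZ.
Qed.

Lemma const_ev_map (N : lmodType k) (f : {linear M -> N})
    (a : stalk (const_sheaf Z M) x) :
  lev (stalk_map (const_hom Z f) a) = f (const_ev a).
Proof.
by have [U [Ux [s ->]]] := germ_surj a; rewrite stalk_mapE levE const_evE.
Qed.

End ConstantStalk.

Lemma const_ev_locally_closed (k : fieldType) (T : topologicalType) (Z : set T)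
    (M : lmodType k) (x : T) (v : M) : locally_closed Z -> Z x ->
  exists a : stalk (const_sheaf Z M) x, const_ev a = v.
Proof.
move=> [U [C [oU cC ZE]]] Zx.
(* The constant v on Z extended by 0 over U. It is a section because a point of U outside Z has a
   neighbourhood, the complement of C, that misses Z. *)
pose s y (_ : Opens oU y) : M := if pselect (Z y) then v else 0.
have vP : const_lc Z s.
  split=> [y Uy nZ|y Uy]; rewrite /s; first by case: pselect.
  case: pselect => [Zy|nZ].
    by exists (opensT T); split=> // z Uz _ Zz; case: pselect.
  have nC : (~` C) y by move=> Cy; apply: nZ; rewrite ZE.
  exists (Opens (closed_openC cC)); split=> // z Uz nCz Zz.
  by case: nCz; move: Zz; rewrite ZE => -[].
have Ux : Opens oU x by move: Zx; rewrite ZE => -[].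
exists (@germ _ _ (const_sheaf Z M) x _ Ux (LSec (P := const_cond Z M) vP)).
by rewrite const_evE /= /s; case: pselect.
Qed.

Lemma locally_closedT (T : topologicalType) : locally_closed (setT : set T).
Proof. by exists setT, setT; split; [exact: openT|exact: closedT|rewrite setIT]. Qed.

Lemma const_ev_surj (k : fieldType) (T : topologicalType) (M : lmodType k) (x : T)
  (v : M) : exists a : stalk (const_sheaf setT M) x, const_ev a = v.
Proof. by apply: const_ev_locally_closed => //; exact: locally_closedT. Qed.

Section HomIf.
Context (k : fieldType) (T : topologicalType) (G F Z : sheaf k T).

(** The terms of [single] are given by a test on the degree. Repeating the test, with the boolean as
    a variable, lets properties be proved by cases without any transport between types. *)
Definition hom_if (b : bool) (h : hom G F) : hom G (if b then F else Z) :=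
  if b as b' return hom G (if b' then F else Z) then h else hzero G Z.

Lemma hom_if_eq0 b h x (a : stalk G x) :
  stalk_map (hom_if b h) a = 0 -> b -> stalk_map h a = 0.
Proof. by case: b. Qed.

Lemma hom_if_ker b (h : hom G F) (U : opens T) (s : G U) : h U s = 0 -> hom_if b h U s = 0.
Proof. by case: b. Qed.

Lemma hom_if_surj b h x (P : stalk G x -> Prop) (c : stalk (if b then F else Z) x) :
  (forall (U : opens T) (s : Z U), s = 0) -> P 0 ->
  (b -> forall c : stalk F x, exists a, P a /\ c = stalk_map h a) ->
  exists a, P a /\ c = stalk_map (hom_if b h) a.
Proof.
move=> Z0 P0; case: b c => [|] c sur; first exact: sur.
by exists 0; split=> //; rewrite linear0; exact: stalk_eq0.
Qed.

End HomIf.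

Lemma sub_incl_df (k : fieldType) (T : topologicalType) (X : complex k T)
    (S : subcx X) i j x (a : stalk (sub_complex S i) x) :
  stalk_map (sub_incl (S j)) (stalk_map (df (sub_complex S) i j) a)
  = stalk_map (df X i j) (stalk_map (sub_incl (S i)) a).
Proof. exact/esym/(stalk_cmap_df (sub_cincl S)). Qed.

Section SubInclusion.
Context (k : fieldType) (T : topologicalType) (X : complex k T) (S S' : subcx X).
Hypothesis SS' : forall i x a, S i x a -> S' i x a.

Fact sub_sub_subproof i x (a : stalk (sub_complex S i) x) :
  S' i x (stalk_map (sub_cincl S i) a).
Proof. by apply: SS'; exact: sub_inclP. Qed.

Definition sub_sub : cmap (sub_complex S) (sub_complex S') :=
  sub_cfactor sub_sub_subproof.

Lemma sub_subK i x (a : stalk (sub_complex S i) x) :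
  stalk_map (sub_incl (S' i)) (stalk_map (sub_sub i) a)
  = stalk_map (sub_incl (S i)) a.
Proof. exact: sub_factorK. Qed.

End SubInclusion.

(* psi is the quotient map S' -> S'/S, which is concentrated in degree n and
   identifies S'/S with the constant sheaf k on C. *)
Section Step.
Context (k : fieldType) (T : topologicalType) (X : complex k T) (S S' : subcx X).
Context (C : set T) (n : int) (psi : forall i x, stalk (X i) x -> k).
Hypothesis oS : open_scx S.
Hypothesis oS' : open_scx S'.
Hypothesis SS' : forall i x a, S i x a -> S' i x a.
Hypothesis dS : forall i j x a, S' i x a -> S j x (stalk_map (df X i j) a).
Hypothesis psiP : forall i x a u v, S' i x u -> S' i x v ->
  psi (a *: u + v) = a * psi u + psi v.
Hypothesis psi_ker : forall i x a, S' i x a -> psi a = 0 <-> S i x a.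
Hypothesis psi_deg : forall i x a, i != n -> @psi i x a = 0.
Hypothesis psi_out : forall i x a, ~ C x -> S' i x a -> psi a = 0.
Hypothesis psi_one : forall x, C x -> exists a, S' n x a /\ psi a = 1.
Hypothesis psi_loc : forall i (U : opens T) (s : X i U),
  (forall y (Uy : U y), S' i y (germ Uy s)) -> forall x (Ux : U x),
  exists W : opens T, W x /\
    forall y (Uy : U y), W y -> C y -> psi (germ Uy s) = psi (germ Ux s).

Let sincl := sub_sub SS'.

Fact psi_lc i (U : opens T) (s : cone sincl i U) :
  const_lc (M := k^o) C (fun x (Ux : U x) => psi (germ Ux (ssval s.2))).
Proof.
split=> [x Ux nC|x Ux]; first by apply: psi_out => //; exact: ssecP.
by apply: psi_loc => y Uy; exact: ssecP.
Qed.

Definition psi_fun i (U : opens T) (s : cone sincl i U) : const_sheaf C k^o U :=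
  LSec (P := const_cond C k^o) (psi_lc s).

Definition psi_hom i : hom (cone sincl i) (const_sheaf C k^o).
Proof.
exists (@psi_fun i) => [U a s t|U W h s]; apply: lsec_ext => x Ux.
  rewrite [RHS]lsecPE -[RHS]psiP; [|exact: ssecP|exact: ssecP].
  rewrite -linearP; congr (psi (germ Ux _)); exact: (ssval_linear a s.2 t.2).
by rewrite /= /family_restrict (germ_res (h x Ux)).
Defined.

Lemma psi_homE i x (c : stalk (cone sincl i) x) :
  const_ev (stalk_map (psi_hom i) c)
  = psi (stalk_map (sub_incl (S' i)) (stalk_map (cone_snd sincl i) c)).
Proof.
have [U [Ux [s ->]]] := germ_surj c.
by rewrite stalk_mapE const_evE [stalk_map (cone_snd _ _) _]stalk_mapE stalk_mapE.
Qed.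

Fact psi_cmap_df i j (U : opens T) (s : cone sincl i U) :
  df (cshift (- n) (single (const_sheaf C k^o))) i j U
    (hom_if (zero_sheaf k T) (i + - n == 0) (psi_hom i) U s)
  = hom_if (zero_sheaf k T) (j + - n == 0) (psi_hom j) U
      (df (cone sincl) i j U s).
Proof.
(* The target has zero differential, so that psi has to vanish on boundaries. The second coordinate
   of the boundary of (s1, s2) is s1 + d s2 when j = i + 1, and both terms lie in S. *)
rewrite [LHS]scaler0; apply/esym/hom_if_ker.
apply: lsec_ext => x Ux.
have S'x := ssecP (df (cone sincl) i j U s).2 Ux; apply/(psi_ker S'x) => {S'x} /=.
have [ji|ji] := eqVneq j (i + 1); last first.
  rewrite hdelta_neq 1?eq_sym // add0r -stalk_mapE.
  by apply: dS; exact: ssecP.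
subst j; rewrite hdelta_id.
rewrite [X in S _ _ X](_ : _ = germ Ux (ssval s.1)
    + stalk_map (df X i (i + 1)) (germ Ux (ssval s.2))); last first.
  by rewrite stalk_mapE -linearD.
by apply: sfamD; [exact: ssecP|apply: dS; exact: ssecP].
Qed.

Definition psi_cmap :
    cmap (cone sincl) (cshift (- n) (single (const_sheaf C k^o))) :=
  @CMap _ _ (cone sincl) (cshift (- n) (single (const_sheaf C k^o)))
    (fun i => hom_if (zero_sheaf k T) (i + - n == 0) (psi_hom i)) psi_cmap_df.

Lemma psi_cmap_inj i x (c : stalk (cone sincl i) x) :
  stalk_map (psi_cmap i) c = 0 ->
  S i x (stalk_map (sub_incl (S' i)) (stalk_map (cone_snd sincl i) c)).
Proof.
move=> /hom_if_eq0 c0; apply/psi_ker; first exact: sub_inclP.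
have [ein|/psi_deg //] := eqVneq i n.
by rewrite -psi_homE c0 ?linear0 // ein subrr.
Qed.

Lemma psi_hom_surj x (c : stalk (const_sheaf C k^o) x) :
  exists a : stalk (X n) x, S' n x a /\ const_ev c = psi a.
Proof.
have [Cx|nCx] := pselect (C x); last first.
  exists 0; split; first exact: sfam0.
  by rewrite const_ev_out // psi_out //; exact: sfam0.
have [a [Sa a1]] := psi_one Cx; exists ((const_ev c : k) *: a); split; first exact: sfamZ.
rewrite -[(const_ev c : k) *: a]addr0 psiP ?a1 ?mulr1 //; last exact: sfam0.
by rewrite (psi_ker (sfam0 _ _)).2 ?addr0 //; exact: sfam0.
Qed.

Lemma quasi_iso_psi : quasi_iso psi_cmap.
Proof.
move=> h i j x -> -> {i j}; split=> [c cc [b cE]|c _].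
  have {b}cE : stalk_map (psi_cmap (h + 1)) c = 0.
    rewrite cE; apply: stalk_map_eq0 => U s; exact: scaler0.
  have [a' aE] := sub_incl_surj (@oS _) (psi_cmap_inj cE).
  (* The second coordinate a' of c is in S, and the cocycle condition makes the first one equal to -
     d a'; so c is the boundary of (a', 0). *)
  have [b [b1 b2]] := cone_pair sincl a' 0.
  exists b; apply: cone_ext; last first.
    rewrite cone_df2 b1 b2 linear0 addr0.
    by apply/subr0_eq/sub_incl_inj; rewrite linearB /= sub_subK -aE subrr.
  rewrite cone_df1 b1.
  have := congr1 (fun u => stalk_map (cone_snd sincl (h + 1 + 1)) u) cc; rewrite cone_df2 linear0.
  move=> /(congr1 (fun u => stalk_map (sub_incl (S' (h + 1 + 1))) u)).
  rewrite linearD linear0 /= sub_subK sub_incl_df aE.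
  rewrite -sub_incl_df => /eqP; rewrite addr_eq0 => /eqP e.
  apply/subr0_eq/sub_incl_inj; rewrite opprK linearD /= e.
  by rewrite addNr.
have [] := @hom_if_surj _ _ _ _ _ (h + 1 + - n == 0) (psi_hom (h + 1)) x
    (fun a => stalk_map (df (cone sincl) (h + 1) (h + 1 + 1)) a = 0) c.
- by move=> U s; exact: zero_sheafE.
- exact: linear0.
- move=> /eqP/subr0_eq hn c'; have [u [Su uE]] := psi_hom_surj c'; subst n.
  have [b bE] := sub_incl_surj (@oS' _) Su.
  have [e eE] := sub_incl_surj (@oS (h + 1 + 1)) (dS (h + 1 + 1) Su).
  (* With u in S' of the prescribed value under psi, d u lies in S and (- d u, u) is a cocycle of
     the cone. *)
  have [a [a1 a2]] := cone_pair sincl (- e) b.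
  exists a; split; last first.
    by apply: const_ev_inj; rewrite psi_homE a2 -bE.
  apply: cone_ext; rewrite linear0.
    rewrite cone_df1 a1 linearN opprK; apply: sub_incl_inj.
    by rewrite sub_incl_df -eE stalk_df_df.
  rewrite cone_df2 a1 a2 linearN /=; apply: sub_incl_inj.
  rewrite linearD linearN /= sub_subK -eE sub_incl_df -bE.
  by rewrite addNr.
move=> a [da cE]; exists a, 0; split=> //.
by rewrite linear0 addr0.
Qed.

Lemma step_isomorphic : d_isomorphic (cone sincl)
  (cshift (- n) (single (const_sheaf C k^o))).
Proof. exact: quasi_iso_isomorphic quasi_iso_psi. Qed.

End Step.

(** * Inverse images *)

Section InverseStalk.
Context (k : fieldType) (S T : topologicalType) (f : S -> T).
Hypothesis cf : continuous f.

Lemma open_preimage (U : opens T) : open (f @^-1` oset U).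
Proof. by move/continuousP: cf; apply; exact: oset_open. Qed.

Definition opens_preimage (U : opens T) : opens S := Opens (open_preimage U).

Section Sheaf.
Variable F : sheaf k T.

(** For continuous f this is the isomorphism between the stalk of the inverse image at y and the
    stalk of F at f y; all statements on inverse images are reduced to F through it. *)
Definition iev y : stalk (inv_sheaf f F) y -> stalk F (f y) := @lev _ _ _ _ y.
HB.instance Definition _ y := GRing.Linear.on (@iev y).

Lemma iev_inj y : injective (@iev y).
Proof.
apply: lev_inj => W s Wy s0; have [O [U [t [Oy [Uy tE]]]]] := lfunP s y Wy.
have : germ Uy t = 0 by rewrite -(tE y Wy Uy Oy).
move=> /germ_eq0[U' [h [U'y e]]].
exists (opensI O (opens_preimage U')); split=> // z Wz [Oz U'z].
by rewrite (tE z Wz (h _ U'z) Oz) -(germ_res (h _ U'z) U'z h) e linear0.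
Qed.

Fact inv_section_lc (U : opens T) (s : F U) :
  @inv_lc _ _ _ f F (opens_preimage U) (fun y Uy => @germ _ _ F (f y) U Uy s).
Proof.
move=> y Uy; exists (opens_preimage U), U, s; split=> //; split=> // z Wz Uz _.
by rewrite (Prop_irrelevance Wz Uz).
Qed.

Definition inv_section (U : opens T) (s : F U) : inv_sheaf f F (opens_preimage U) :=
  LSec (P := inv_cond f F) (inv_section_lc s).

Lemma iev_section (U : opens T) (s : F U) y (Uy : U (f y)) :
  iev (@germ _ _ _ y (opens_preimage U) Uy (inv_section s)) = germ Uy s.
Proof. by rewrite /iev levE. Qed.

Lemma iev_surj y (a : stalk F (f y)) : exists b, iev b = a.
Proof.
have [U [Uy [s ->]]] := germ_surj a.
exists (@germ _ _ (inv_sheaf f F) y (opens_preimage U) Uy (inv_section s)).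
exact: iev_section.
Qed.

End Sheaf.

Lemma iev_map (F G : sheaf k T) (g : hom F G) y (a : stalk (inv_sheaf f F) y) :
  iev (stalk_map (inv_hom f g) a) = stalk_map g (iev a).
Proof.
have [U [Uy [s ->]]] := germ_surj a; rewrite stalk_mapE.
by rewrite [LHS]levE [in RHS]/iev levE.
Qed.

Definition inv_cmap (X Y : complex k T) (g : cmap X Y) :
  cmap (inv_complex f X) (inv_complex f Y).
Proof.
exists (fun i => inv_hom f (g i)) => i j U s.
by apply: lsec_ext => y Uy /=; rewrite stalk_cmap_df.
Defined.

Lemma iev_df (X : complex k T) i j y (a : stalk (inv_complex f X i) y) :
  iev (stalk_map (df (inv_complex f X) i j) a) = stalk_map (df X i j) (iev a).
Proof. exact: iev_map. Qed.

Lemma inv_cycP (X : complex k T) i y (a : stalk (inv_complex f X i) y) :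
  cyc (inv_complex f X) i y a <-> cyc X i (f y) (iev a).
Proof.
rewrite /cyc /= -iev_df; split=> [->|e]; first exact: linear0.
by apply: iev_inj; rewrite e linear0.
Qed.

Lemma inv_bdP (X : complex k T) i y (a : stalk (inv_complex f X i) y) :
  bd (inv_complex f X) i y a <-> bd X i (f y) (iev a).
Proof.
split=> [[b ->]|[b]]; first by exists (iev b); rewrite iev_df.
have [b' <-] := iev_surj b; rewrite -iev_df => /iev_inj ->.
by exists b'.
Qed.

Lemma quasi_iso_inv (X Y : complex k T) (g : cmap X Y) :
  quasi_iso g -> quasi_iso (inv_cmap g).
Proof.
move=> /quasi_isoP qg; apply/quasi_isoP => i y; have [inj sur] := qg i (f y).
split=> [a /inv_cycP ca /inv_bdP|c /inv_cycP/sur[a [ca ba]]].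
  by rewrite iev_map => /(inj _ ca)/inv_bdP.
have [a' a'E] := iev_surj (F := X i) a; subst a; exists a'.
split; first exact/inv_cycP.
by apply/inv_bdP; rewrite linearB /= iev_map.
Qed.

End InverseStalk.

Section InverseComposition.
Context (k : fieldType) (A B T : topologicalType) (u : A -> B) (g : B -> T).
Hypothesis cu : continuous u.
Hypothesis cg : continuous g.

Section Sheaf.
Variable F : sheaf k T.

Definition iev2 y : stalk (inv_sheaf u (inv_sheaf g F)) y -> stalk F (g (u y)) :=
  fun a => iev (iev a).

Fact iev2_linear y : linear (@iev2 y).
Proof. by move=> a s t; rewrite /iev2 !linearP. Qed.
HB.instance Definition _ y := GRing.isLinear.Build k _ _ _ (@iev2 y) (@iev2_linear y).

Fact iev2_lc (U : opens A) (s : inv_sheaf u (inv_sheaf g F) U) :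
  lc (inv_cond (g \o u) F) (fun y (Uy : U y) => iev2 (germ Uy s)).
Proof.
move=> y Uy; have [O [V [t [Oy [Vy tE]]]]] := lfunP s y Uy.
have [O' [V' [t' [O'y [V'y tE']]]]] := lfunP t (u y) Vy.
exists (opensI O (opensI (opens_preimage cu V) (opens_preimage cu O'))), V', t'.
split=> //; split=> // z Uz V'z [Oz [Vz O'z]].
by rewrite /iev2 {2}/iev levE (tE z Uz Vz Oz) [LHS]levE; exact: tE'.
Qed.

Definition inv_comp_hom : hom (inv_sheaf u (inv_sheaf g F)) (inv_sheaf (g \o u) F) :=
  lhom iev2_lc.

Lemma iev_comp y (a : stalk (inv_sheaf u (inv_sheaf g F)) y) :
  iev (stalk_map inv_comp_hom a) = iev (iev a).
Proof. exact: (lev_lhom iev2_lc). Qed.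

End Sheaf.

Variable X : complex k T.

Definition inv_comp :
  cmap (inv_complex u (inv_complex g X)) (inv_complex (g \o u) X).
Proof.
exists (fun i => inv_comp_hom (X i)) => i j U s.
apply: lsec_ext => y Uy; rewrite /= -iev_df -iev_df.
by rewrite /iev2 stalk_mapE.
Defined.

Lemma quasi_iso_inv_comp : quasi_iso inv_comp.
Proof.
have cgu : continuous (g \o u) by move=> y; apply: continuous_comp; [exact: cu|exact: cg].
apply: quasi_iso_bij => i y a.
  move=> /(congr1 (fun b => iev b)); rewrite iev_comp linear0 => a0.
  by apply/(iev_inj cu)/(iev_inj cg); rewrite !linear0.
have [b bE] := iev_surj cg (iev a); have [c cE] := iev_surj cu b.
by exists c; apply: (iev_inj cgu); rewrite iev_comp cE bE.
Qed.

Section Constant.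
Variables (Z : set B) (M : lmodType k).
Hypothesis uZ : forall y, Z (u y).

Definition const_iev y : stalk (inv_sheaf u (const_sheaf Z M)) y -> M :=
  fun a => const_ev (iev a).

Fact const_iev_linear y : linear (@const_iev y).
Proof. by move=> a s t; rewrite /const_iev !linearP. Qed.
HB.instance Definition _ y :=
  GRing.isLinear.Build k _ _ _ (@const_iev y) (@const_iev_linear y).

Fact const_iev_lc (U : opens A) (s : inv_sheaf u (const_sheaf Z M) U) :
  lc (const_cond setT M) (fun y (Uy : U y) => const_iev (germ Uy s)).
Proof.
split=> [y _ []//|y Uy].
have [O [V [t [Oy [Vy tE]]]]] := lfunP s y Uy.
have [_ /(_ (u y) Vy)[W [Wy tW]]] := lfunP t.
exists (opensI O (opens_preimage cu (opensI V W))); split=> // z Uz [Oz [Vz Wz]] _.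
rewrite /const_iev /iev !levE (tE z Uz Vz Oz) (tE y Uy Vy Oy) !const_evE.
exact: tW.
Qed.

(** The set Z is arbitrary in order to serve twice: for constant complexes, and for the sheaf of a
    polyhedron restricted to a cell that it contains. *)
Definition inv_const_hom :
    hom (inv_sheaf u (const_sheaf Z M)) (const_sheaf setT M) :=
  lhom const_iev_lc.

Lemma const_ev_inv y (a : stalk (inv_sheaf u (const_sheaf Z M)) y) :
  const_ev (stalk_map inv_const_hom a) = const_ev (iev a).
Proof. exact: (lev_lhom const_iev_lc). Qed.

End Constant.

Variable M : vcomplex k.

Definition inv_const : cmap (inv_complex u (const_complex B M)) (const_complex A M).
Proof.
exists (fun i => inv_const_hom (Z := setT) (M i) (fun=> I)) => i j U s.
apply: lsec_ext => y Uy; rewrite [RHS](_ : _ = const_ev (iev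
    (stalk_map (df (inv_complex u (const_complex B M)) i j) (germ Uy s)))).
  by rewrite iev_df [RHS]const_ev_map.
by rewrite stalk_mapE.
Defined.

Lemma quasi_iso_inv_const : quasi_iso inv_const.
Proof.
apply: quasi_iso_bij => i y a.
  move=> /(congr1 (fun b => const_ev b)); rewrite const_ev_inv linear0 => a0.
  by apply/(iev_inj cu)/const_ev_inj; rewrite !linear0.
have [b bE] := const_ev_surj (u y) (const_ev a); have [c cE] := iev_surj cu b.
by exists c; apply: const_ev_inj; rewrite const_ev_inv cE.
Qed.

End InverseComposition.

Lemma isomorphic_inv (k : fieldType) (B T : topologicalType) (g : B -> T)
    (X Y : complex k T) : continuous g ->
  d_isomorphic X Y -> d_isomorphic (inv_complex g X) (inv_complex g Y).
Proof.
move=> cg /isomorphic_coroof[W [f [s [qf qs]]]].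
apply: (@d_isomorphic_trans _ _ (inv_complex g W)).
  exact: quasi_iso_isomorphic (quasi_iso_inv cg qf).
exact/d_isomorphic_sym/(quasi_iso_isomorphic (quasi_iso_inv cg qs)).
Qed.

Lemma constant_finite_rank_iso (k : fieldType) (T : topologicalType)
    (X Y : complex k T) :
  d_isomorphic X Y -> constant_finite_rank Y -> constant_finite_rank X.
Proof. by move=> XY [M YM]; exists M; exact: d_isomorphic_trans YM. Qed.

Lemma constant_finite_rank_inv (k : fieldType) (A B T : topologicalType)
    (u : A -> B) (g : B -> T) (X : complex k T) :
  continuous u -> continuous g -> constant_finite_rank (inv_complex g X) ->
  constant_finite_rank (inv_complex (g \o u) X).
Proof.
move=> cu cg [M XM]; exists M.
apply: (@d_isomorphic_trans _ _ (inv_complex u (inv_complex g X))).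
  apply: d_isomorphic_sym.
  exact: quasi_iso_isomorphic (quasi_iso_inv_comp cu cg X).
apply: d_isomorphic_trans (isomorphic_inv cu XM) _.
exact: quasi_iso_isomorphic (quasi_iso_inv_const cu M).
Qed.

Lemma constant_finite_rank_subset (k : fieldType) (T : topologicalType)
    (P C : set T) (X : complex k T) : C `<=` P ->
  constant_finite_rank (inv_complex (set_val (A := P)) X) ->
  constant_finite_rank (inv_complex (set_val (A := C)) X).
Proof.
move=> CP.
pose u (y : C) : P := exist _ (set_val y) (mem_set (CP _ (set_valP y))).
have cv (D : set T) : continuous (set_val (A := D)) by exact: initial_continuous.
have cu : continuous u.
  by apply: continuous_comp_initial; exact: cv.
exact: (constant_finite_rank_inv cu (cv P)).
Qed.

(** * Trivializations of cohomology sheaves *)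

(** These are coordinates on K / I, read on a complement D of I in K; K and I will be the kernel and
    the image of differentials. Indexing them by [nat], with value 0 from r on, avoids index types
    that depend on the degree and on the cell. *)
Lemma quotient_coordinates (k : fieldType) (E : vectType k) (K I : {vspace E}) :
  (I <= K)%VS -> exists (r : nat) (phi : nat -> 'Hom(E, k^o)),
    [/\ forall a, a \in K -> (forall m, phi m a = 0) <-> a \in I,
        forall m a, (r <= m)%N -> phi m a = 0 &
        forall m, (m < r)%N -> exists a, [/\ a \in K, phi m a = 1 &
          forall l, l != m -> phi l a = 0]].
Proof.
move=> IK; pose D := (K :\: I)%VS; pose r := \dim D.
have DI : (D :&: I = 0)%VS := capv_diff K I.
have DK : (D + I = K)%VS by rewrite addv_diff; apply/addv_idPl.
pose phi m : 'Hom(E, k^o) := if insub m is Some i then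
  (linfun (coord (vbasis D) i : E -> k^o) \o daddv_pi D I)%VF else 0.
have phiE (i : 'I_r) a : phi i a = coord (vbasis D) i (daddv_pi D I a).
  by rewrite /phi valK comp_lfunE lfunE.
have phi_out m a : (r <= m)%N -> phi m a = 0.
  by move=> rm; rewrite /phi insubF ?lfunE // ltnNge rm.
exists r, phi; split=> // [a aK|m mr]; first split=> [a0|aI m].
- rewrite -(daddv_pi_add DI (w := a)) ?DK // (coord_vbasis (memv_pi D I a)).
  rewrite big1 ?add0r ?memv_pi // => i _.
  by rewrite -phiE a0 scale0r.
- have [mr|/phi_out//] := ltnP m r.
  rewrite -[m]/(val (Ordinal mr)) phiE.
  (* For a in I the component along I is a itself, so the component along D is 0. *)
  have := daddv_pi_add DI (w := a); rewrite DK => /(_ aK).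
  rewrite (daddv_pi_id (_ : (I :&: D)%VS = 0%VS)) //; last by rewrite capvC.
  by move/eqP; rewrite -subr_eq0 addrK => /eqP ->; rewrite linear0.
pose i := Ordinal mr; have iD : (vbasis D)`_i \in D.
  by apply: vbasis_mem; rewrite mem_nth // size_tuple.
have fD := basis_free (vbasisP D).
exists (vbasis D)`_i; split.
- by rewrite -DK memvE (subv_trans _ (addvSl _ _)) // -memvE.
- by rewrite -[m]/(val i) phiE daddv_pi_id // coord_free // eqxx.
move=> l lm; have [lr|/phi_out//] := ltnP l r.
rewrite -[l]/(val (Ordinal lr)) phiE daddv_pi_id // coord_free //.
by rewrite -val_eqE /= eq_sym (negPf lm).
Qed.

Section Trivialization.
Context (k : fieldType) (T : topologicalType).
Implicit Types X Y : complex k T.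

(* A trivialization with fibre k^r, over a subset A, of the cohomology sheaf
   H^i(X): a linear map from cocycles to sequences of coordinates. *)
Record trivial_on X i (A : set T) (r : nat)
    (phi : forall x, stalk (X i) x -> nat -> k) : Prop := TrivialOn {
  tr_lin : forall x a u v m, A x -> cyc X i x u -> cyc X i x v ->
    phi x (a *: u + v) m = a * phi x u m + phi x v m;
  tr_ker : forall x a, A x -> cyc X i x a ->
    (forall m, phi x a m = 0) <-> bd X i x a;
  tr_out : forall x a m, A x -> cyc X i x a -> (r <= m)%N -> phi x a m = 0;
  tr_sur : forall x m, A x -> (m < r)%N -> exists a, [/\ cyc X i x a,
    phi x a m = 1 & forall l, l != m -> phi x a l = 0];
  tr_loc : forall (U : opens T) (s : X i U),
    (forall y (Uy : U y), cyc X i y (germ Uy s)) ->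
    forall x (Ux : U x), A x -> exists W : opens T, W x /\
      forall y (Uy : U y), W y -> A y -> forall m,
      phi y (germ Uy s) m = phi x (germ Ux s) m }.

Lemma tr_bdB X i A r phi (p : @trivial_on X i A r phi) x u v m : A x ->
  cyc X i x u -> cyc X i x v -> bd X i x (u - v) -> phi x u m = phi x v m.
Proof.
move=> Ax cu cv uv; rewrite -(subrK v u) -[u - v]scale1r.
rewrite (tr_lin p); [|exact: Ax|exact: sfamB|exact: cv].
by rewrite mul1r ((tr_ker p Ax (bd_cyc uv)).2 uv m) add0r.
Qed.

Lemma trivial_pull X Y (f : cmap X Y) i A r phi : quasi_iso f ->
  @trivial_on Y i A r phi ->
  @trivial_on X i A r (fun x a => phi x (stalk_map (f i) a)).
Proof.
move=> /quasi_isoP qf p; split.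
- by move=> x a u v m Ax cu cv; rewrite linearP (tr_lin p) //; exact: cmap_cyc.
- move=> x a Ax ca; rewrite (tr_ker p Ax (cmap_cyc f ca)).
  by have [inj _] := qf i x; split; [exact: inj|exact: cmap_bd].
- by move=> x a m Ax ca; apply: (tr_out p) => //; exact: cmap_cyc.
- move=> x m Ax mr; have [c [cc c1 c0]] := tr_sur p Ax mr.
  have [_ sur] := qf i x; have [a [ca ba]] := sur c cc.
  have e l : phi x (stalk_map (f i) a) l = phi x c l.
    apply: (tr_bdB p) => //; [exact: cmap_cyc|exact: sfam_sym].
  by exists a; split=> [//||l lm]; rewrite e // c0.
- move=> U s cs x Ux Ax.
  have [|W [Wx WE]] := tr_loc p (s := f i U s) _ Ux Ax.
    by move=> y Uy; rewrite -stalk_mapE; exact: cmap_cyc.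
  by exists W; split=> // y Uy Wy Ay m; rewrite !stalk_mapE WE.
Qed.

Lemma trivial_push X Y (f : cmap X Y) i A r phi : quasi_iso f ->
  @trivial_on X i A r phi -> exists psi, @trivial_on Y i A r psi /\
    forall x a, A x -> cyc X i x a -> psi x (stalk_map (f i) a) = phi x a.
Proof.
move=> /quasi_isoP qf p.
(* The value at c is that of phi at any cocycle a with f a cohomologous to c. It does not depend on
   a: two choices differ by a coboundary, f being injective on cohomology. If there is no such a, 0
   is a default value. *)
have ex x (c : stalk (Y i) x) : exists v : nat -> k, A x -> forall a,
    cyc X i x a -> bd Y i x (c - stalk_map (f i) a) -> phi x a = v.
  have [[a [ca ba]]|no] := pselect (exists a, cyc X i x a /\
      bd Y i x (c - stalk_map (f i) a)); last first.
    by exists (fun=> 0) => _ a ca ba; case: no; exists a.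
  exists (phi x a) => Ax a' ca' ba'; apply/funext => m; apply: (tr_bdB p) => //.
  have [inj _] := qf i x; apply: inj; first exact: sfamB.
  by rewrite linearB; exact: sfam_trans (sfam_sym ba') ba.
pose psi x := projT1 (choice (ex x)); have psiE' x := projT2 (choice (ex x)).
have psiE x c a : A x -> cyc X i x a -> bd Y i x (c - stalk_map (f i) a) ->
  psi x c = phi x a by move=> Ax ca ba; rewrite (psiE' x c Ax a).
clearbody psi.
have psif x a : A x -> cyc X i x a -> psi x (stalk_map (f i) a) = phi x a.
  by move=> Ax ca; apply: psiE => //; rewrite subrr; exact: sfam0.
exists psi; split=> //; split.
- move=> x a u v m Ax cu cv; have [_ sur] := qf i x.
  have [u' [cu' bu]] := sur u cu; have [v' [cv' bv]] := sur v cv.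
  rewrite (psiE _ _ _ _ _ bu) // (psiE _ _ _ _ _ bv) // -(tr_lin p) //.
  congr (_ m); apply: psiE => //; first exact: sfamP.
  by rewrite linearP opprD addrACA -scalerBr; exact: sfamP.
- move=> x c Ax cc; have [_ sur] := qf i x; have [a [ca ba]] := sur c cc.
  rewrite (psiE _ _ _ _ _ ba) // (tr_ker p Ax ca); have [inj _] := qf i x.
  split=> [b|bc]; first by apply: sfamBr ba _; exact: cmap_bd.
  by apply: inj => //; apply: sfamBr (sfam_sym ba) _.
- move=> x c m Ax cc rm; have [_ sur] := qf i x; have [a [ca ba]] := sur c cc.
  by rewrite (psiE _ _ _ _ _ ba) // (tr_out p).
- move=> x m Ax mr; have [a [ca a1 a0]] := tr_sur p Ax mr.
  exists (stalk_map (f i) a); rewrite psif //; split=> //; exact: cmap_cyc.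
- move=> U s cs x Ux Ax; have [_ sur] := qf i x.
  (* At x, the germ of s is the image of a cocycle plus a coboundary. Spreading this out, s = f t +
     d e near x, with t a section of cocycles; there psi of s is phi of t, which is locally constant
     along A. *)
  have [a [ca [b bE]]] := sur _ (cs x Ux).
  have [U1 [U1x [t [tE ct]]]] := open_cyc ca.
  have [U2 [U2x [e eE]]] := germ_surj b.
  have [W [Wx WE]] := tr_loc p ct U1x Ax.
  have : germ Ux s = germ U1x (f i U1 t) + germ U2x (df Y (i - 1) i U2 e).
    by rewrite -stalk_mapE -[germ U2x _]stalk_mapE -tE -eE -bE addrC subrK.
  pose V := opensI U1 U2; have Vx : V x by split.
  rewrite -(germ_res U1x Vx (@opensIl _ _ _)) -(germ_res U2x Vx (@opensIr _ _ _)).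
  rewrite -linearD => /germP[O [hU [hV [Ox e']]]].
  have psi_s y (Uy : U y) (U1y : U1 y) : O y -> A y ->
      psi y (germ Uy s) = phi y (germ U1y t).
    move=> Oy Ay; apply: psiE => //.
    rewrite -(germ_res Uy Oy hU) e' (germ_res (hV y Oy)) [X in X - _]linearD /=.
    rewrite (germ_res U1y) -stalk_mapE addrAC subrr add0r.
    have [_ U2y] := hV y Oy.
    rewrite (germ_res U2y); exists (germ U2y e); by rewrite stalk_mapE.
  exists (opensI O W); split=> // y Uy [Oy Wy] Ay m.
  have [U1y _] := hV y Oy.
  by rewrite (psi_s y Uy U1y) // (psi_s x Ux U1x) // WE.
Qed.

End Trivialization.

Section TrivialFamily.
Context (k : fieldType) (T : topologicalType) (X : complex k T) (r : int -> nat).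
Context (phi : forall i x, stalk (X i) x -> nat -> k).
Hypothesis p : forall i, @trivial_on k T X i setT (r i) (@phi i).
Variable m : nat.

Definition triv_fam i : subfam (X i).
Proof.
exists (fun x a => cyc X i x a /\ forall l, (m <= l)%N -> phi a l = 0).
  move=> x; split=> [|l ml]; first exact: sfam0.
  by apply: (tr_ker (p i) _ _).2 => //; exact: sfam0.
move=> x a u v [cu u0] [cv v0]; split=> [|l ml]; first exact: sfamP.
by rewrite (tr_lin (p i)) // u0 // v0 // mulr0 addr0.
Defined.

Definition triv_cohfam : cohfam X.
Proof.
exists triv_fam.
- move=> i x a ba; have ca := bd_cyc ba; split=> // l _.
  exact: ((tr_ker (p i) _ ca).2 ba l).
- by move=> i x a [].
move=> i x a [ca a0]; have [U [Ux [s [aE cs]]]] := open_cyc ca; subst a.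
have [//|W [Wx WE]] := tr_loc (p i) cs Ux.
have Ox : opensI U W x by [].
exists (opensI U W), Ox, (res (@opensIl _ U W) s); rewrite (germ_res Ux).
split=> // y Oy; have [Uy Wy] := Oy; rewrite (germ_res Uy); split=> // l ml.
by rewrite WE ?a0.
Defined.

End TrivialFamily.

Section ConstantComplex.
Context (k : fieldType) (T : topologicalType) (M : vcomplex k).

Lemma const_df i j x (a : stalk (const_complex T M i) x) :
  const_ev (stalk_map (df (const_complex T M) i j) a) = vdf M i j (const_ev a).
Proof. exact: const_ev_map. Qed.

Lemma const_cycP i x (a : stalk (const_complex T M i) x) :
  cyc (const_complex T M) i x a <-> vdf M i (i + 1) (const_ev a) = 0.
Proof.
rewrite -const_df /cyc /=; split=> [->|a0]; first exact: linear0.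
by apply: const_ev_inj; rewrite a0 linear0.
Qed.

Lemma const_bdP i x (a : stalk (const_complex T M i) x) :
  bd (const_complex T M) i x a <-> exists b, const_ev a = vdf M (i - 1) i b.
Proof.
split=> [[b ->]|[b bE]]; first by exists (const_ev b); rewrite const_df.
have [c cE] := const_ev_surj x b; exists c.
by apply: const_ev_inj; rewrite const_df cE.
Qed.

(** The coordinates are linear forms on the whole of M i, not merely functions on cocycles. Their
    vanishing thus defines subspaces, out of which [cell_data] builds a subcomplex of M. *)
Lemma const_trivial i : exists (r : nat) (phi : nat -> 'Hom(M i, k^o)),
  [/\ forall m a, (r <= m)%N -> phi m a = 0,
      forall m a, phi m (vdf M (i - 1) i a) = 0 &
  trivial_on (X := const_complex T M) (i := i) setT r
    (fun x a m => phi m (const_ev a))].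
Proof.
have [|r [phi [ker out sur]]] := @quotient_coordinates k (M i)
    (lker (linfun (vdf M i (i + 1)))) (limg (linfun (vdf M (i - 1) i))).
  apply/subvP => a /memv_imgP[b _ ->].
  by rewrite memv_ker !lfunE /= vdf_vdf.
exists r, phi; split=> //; last split.
- move=> m a; apply: (ker _ _).2; first by rewrite memv_ker lfunE /= vdf_vdf.
  by rewrite -lfunE memv_img // memvf.
- by move=> x a u v m _ _ _; rewrite !linearP.
- move=> x a _ /const_cycP ca; have aK : const_ev a \in lker (linfun (vdf M i (i + 1))).
    by rewrite memv_ker lfunE /= ca.
  rewrite (ker _ aK) const_bdP.
  split=> [/memv_imgP[b _]|[b ->]]; first by rewrite lfunE; exists b.
  by rewrite -lfunE memv_img // memvf.
- by move=> x a m _ _; exact: out.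
- move=> x m _ /sur[a [aK a1 a0]]; have [b bE] := const_ev_surj x a.
  exists b; rewrite bE; split=> //.
  by apply/const_cycP; rewrite bE; move: aK; rewrite memv_ker lfunE => /eqP.
- move=> U s _ x Ux _; have [_ /(_ x Ux)[W [Wx sW]]] := lfunP s.
  exists W; split=> // y Uy Wy _ m; rewrite !const_evE; congr (phi m _).
  exact: sW.
Qed.

End ConstantComplex.

Section VSubcomplex.
Context (k : fieldType) (M : vcomplex k) (U : forall i, {vspace M i}).
Hypothesis dU : forall i j a, a \in U i -> vdf M i j a \in U j.

Definition vsub_df i j (a : subvs_of (U i)) : subvs_of (U j) :=
  vsproj (U j) (vdf M i j (vsval a)).

Lemma vsub_dfE i j a : vsval (@vsub_df i j a) = vdf M i j (vsval a).
Proof. by rewrite /vsub_df vsprojK // dU // subvsP. Qed.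

Fact vsub_df_linear i j : linear (@vsub_df i j).
Proof. by move=> a u v; rewrite /vsub_df !linearP. Qed.
HB.instance Definition _ i j :=
  GRing.isLinear.Build k _ _ _ (@vsub_df i j) (@vsub_df_linear i j).

Definition vsub : vcomplex k.
Proof.
exists (fun i => subvs_of (U i) : vectType k) (fun i j => @vsub_df i j : {linear _ -> _}).
- by move=> i j s ij; apply: subvs_inj; rewrite vsub_dfE vdf_shape ?linear0.
- by move=> i j l s; apply: subvs_inj; rewrite !vsub_dfE vdf_vdf linear0.
have [n Mn] := vcomplex_bounded M; exists n => i ni s.
by apply: subvs_inj; rewrite (Mn i ni (vsval s)) linear0.
Defined.

Definition vsub_cmap (T : topologicalType) :
  cmap (const_complex T vsub) (const_complex T M).
Proof.
exists (fun i => const_hom setT (vsval : subvs_of (U i) -> M i)) => i j O s.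
by apply: lsec_ext => x Ox /=; rewrite vsub_dfE.
Defined.

Lemma const_ev_vsub (T : topologicalType) i x (a : stalk (const_complex T vsub i) x) :
  const_ev (stalk_map (vsub_cmap T i) a) = vsval (const_ev a).
Proof. exact: const_ev_map. Qed.

End VSubcomplex.

Section Cell.
Context (k : fieldType) (T : topologicalType) (C : set T) (X : complex k T).

Let v := set_val (A := C).
Let cv : continuous v. Proof. exact: initial_continuous. Qed.

Lemma trivial_extend i r phi' :
  @trivial_on _ _ (inv_complex v X) i setT r phi' ->
  exists phi, @trivial_on _ _ X i C r phi /\
    forall y (a : stalk (inv_complex v X i) y), phi (v y) (iev a) = phi' y a.
Proof.
move=> p.
(* Over C the germ a is pulled back through the bijection [iev]; outside C the value 0 is a default
   that [trivial_on] never reads. *)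
pose phi x (a : stalk (X i) x) : nat -> k := if pselect (C x) is left Cx then
  let y : C := exist _ x (mem_set Cx) in
  phi' y (xget 0 [set b : stalk (inv_complex v X i) y | iev b = a]) else fun=> 0.
have phiE y (a : stalk (inv_complex v X i) y) : phi (v y) (iev a) = phi' y a.
  rewrite /phi; case: pselect => [Cy|nC]; last by case: nC; exact: set_valP.
  have ye : exist _ (v y) (mem_set Cy) = y :> C by apply: val_inj.
  case: y a Cy ye => x q a Cx ye /=.
  have eq : mem_set Cx = q by exact: Prop_irrelevance.
  move: a; rewrite -{}eq => a; congr phi'.
  case: xgetP => [b _ /(iev_inj cv) -> //|/(_ a)]; by case.
have onC x : C x -> exists y : C, v y = x.
  by move=> Cx; exists (exist _ x (mem_set Cx)).
have sur y a : exists b : stalk (inv_complex v X i) y, iev b = a := iev_surj cv a.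
have cP y (a : stalk (inv_complex v X i) y) := inv_cycP cv a.
exists phi; split=> //; split.
- move=> x a u w m /onC[y yx]; subst x; have [u' <-] := sur y u; have [w' <-] := sur y w.
  by move=> /cP cu /cP cw; rewrite -linearP !phiE (tr_lin p).
- move=> x a /onC[y yx]; subst x; have [b <-] := sur y a => /cP cb.
  by rewrite phiE (tr_ker p) // (inv_bdP cv).
- move=> x a m /onC[y yx]; subst x; have [b <-] := sur y a => /cP cb rm.
  by rewrite phiE (tr_out p).
- move=> x m /onC[y yx] mr; subst x; have [a [ca a1 a0]] := tr_sur p (x := y) I mr.
  by exists (iev a); split=> [||l lm]; [exact/(cP y a)|rewrite phiE|rewrite phiE a0].
move=> U s cs x Ux Cx; have [y yx] := onC x Cx; subst x.
have [|W' [W'y WE]] := tr_loc p (s := inv_section cv s) _ (Ux : opens_preimage cv U y) I.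
  by move=> z Uz; apply/cP; rewrite iev_section.
(* An open subset of the subspace C is the trace of an open subset of T. *)
have [W0 oW0 eW] := oset_open W'.
exists (Opens oW0); split; first by rewrite /omem /= -[W0 _]/((v @^-1` W0) y) eW.
move=> x' Ux' Wx' Cx' m; have [z zx] := onC x' Cx'; subst x'.
have := WE z Ux' _ I m; rewrite -!phiE !iev_section; apply.
by rewrite /omem -eW.
Qed.

(** Over C there are quasi-isomorphisms X -> W <- M; coordinates on the cohomology of M are pushed
    to W and pulled back to X. A truncation cut out over C by the vanishing of coordinates is
    transported to M in the same way, where it is the constant complex of a subcomplex. The two
    claims go together because the second one needs this origin of phi. *)
Lemma cell_data : constant_finite_rank (inv_complex v X) ->
  exists (r : int -> nat) (phi : forall i x, stalk (X i) x -> nat -> k),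
    (forall i, @trivial_on _ _ X i C (r i) (phi i)) /\
    forall n m (S : cohfam X),
      (forall x a, C x -> cyc X n x a ->
         S n x a <-> forall l, (m <= l)%N -> phi n x a l = 0) ->
      constant_finite_rank (inv_complex v (sub_complex (tau n S))).
Proof.
move=> [M /isomorphic_coroof[W [f [s [qf qs]]]]].
have exM i := cid (const_trivial (set_type C) M i).
pose r i := projT1 (exM i).
have exM' i := cid (projT2 (exM i)); pose phiM i := projT1 (exM' i).
have phiM_out i m a : (r i <= m)%N -> phiM i m a = 0.
  by have [+ _ _] := projT2 (exM' i); exact.
have phiM_df i m a : phiM i m (vdf M (i - 1) i a) = 0.
  by have [_ + _] := projT2 (exM' i); exact.
have trM i : trivial_on (X := const_complex (set_type C) M) (i := i) setT (r i)
    (fun x a m => phiM i m (const_ev a)).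
  by have [] := projT2 (exM' i).
have exW i := cid (trivial_push qs (trM i)).
pose phiW i := projT1 (exW i).
have trW i : trivial_on setT (r i) (phiW i) by have [] := projT2 (exW i).
have phiWE i x a : cyc (const_complex (set_type C) M) i x a ->
    phiW i x (stalk_map (s i) a) = (phiM i)^~ (const_ev a).
  by have [_] := projT2 (exW i); exact.
have trX i := trivial_pull qf (trW i).
have exX i := cid (trivial_extend (trX i)).
pose phi i := projT1 (exX i).
have tr i : trivial_on C (r i) (phi i) by have [] := projT2 (exX i).
have phiE i y a : phi i (v y) (iev a) = phiW i y (stalk_map (f i) a).
  by have [_] := projT2 (exX i); exact.
clearbody phiM phiW phi r => {exM exM' exW exX}.
exists r, phi; split=> // n m S SE.
pose SX := triv_cohfam trX m; pose SW := triv_cohfam trW m.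
pose SM := triv_cohfam trM m.
(* Restricting the truncation to C and truncating the restriction give subcomplexes with the same
   stalks. *)
apply: (@constant_finite_rank_iso _ _ _ (sub_complex (tau n SX))).
  have SXE y (a : stalk (inv_complex v X n) y) : SX n y a <-> S n (v y) (iev a).
    have Cy : C (v y) by exact: set_valP.
    split=> [[/(inv_cycP cv) ca a0]|Sa].
      by apply/SE => // l ml; rewrite phiE a0.
    have ca := cohf_cyc Sa; split; first exact/(inv_cycP cv).
    by move/(SE _ _ Cy ca): Sa; rewrite phiE.
  have tauE i y (a : stalk (inv_complex v X i) y) :
      tau n SX i y a <-> tau n S i (v y) (iev a).
    rewrite [tau n SX i y a]/= [tau n S i _ _]/=; case: ltgtP => // [_|ein]; last first.
      by subst i; exact: SXE.
    by split=> [->|a0]; [exact: linear0|apply: (iev_inj cv); rewrite a0 linear0].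
  have gE i y (a : stalk (inv_complex v (sub_complex (tau n S)) i) y) :
      iev (stalk_map (inv_cmap v (sub_cincl (tau n S)) i) a)
      = stalk_map (sub_incl (tau n S i)) (iev a) by exact: iev_map.
  have gS i y a : tau n SX i y
      (stalk_map (inv_cmap v (sub_cincl (tau n S)) i) a).
    by apply/tauE; rewrite gE; exact: sub_inclP.
  apply: (quasi_iso_isomorphic (f := sub_cfactor gS)).
  apply: quasi_iso_factor_bij => [i y a|i y c].
  - move=> /(congr1 (fun b => iev b)); rewrite gE linear0 => /sub_incl_inj a0.
    by apply: (iev_inj cv); rewrite a0 linear0.
  - move=> /tauE /(sub_incl_surj (@open_tau _ _ _ n S i))[b bE].
    have [a aE] := iev_surj cv b; exists a.
    by apply: (iev_inj cv); rewrite gE aE.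
have [gX qX] : exists g : cmap (sub_complex (tau n SX)) (sub_complex (tau n SW)),
    quasi_iso g.
  apply: tau_qis qf _ => y a ca; split=> -[_ a0]; split=> //.
  exact: cmap_cyc.
have [gM qM] : exists g : cmap (sub_complex (tau n SM)) (sub_complex (tau n SW)),
    quasi_iso g.
  apply: tau_qis qs _ => y a ca; split=> -[_ a0]; split=> //.
  - exact: cmap_cyc.
  - by move=> l ml; rewrite phiWE // a0.
  - by move=> l ml; rewrite -(a0 l ml) phiWE.
apply: (constant_finite_rank_iso (quasi_iso_isomorphic qX)).
apply: (constant_finite_rank_iso (d_isomorphic_sym (quasi_iso_isomorphic qM))).
(* This is the degree n part of the subcomplex of M. A finite intersection suffices, since the
   coordinates of index at least r i are zero. *)
pose U1 i : {vspace M i} := (lker (linfun (vdf M i (i + 1))) :&: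
  \bigcap_(l < r i | (m <= l)%N) lker (phiM i l))%VS.
have U1P i a : a \in U1 i <->
    vdf M i (i + 1) a = 0 /\ forall l, (m <= l)%N -> phiM i l a = 0.
  rewrite memv_cap memv_ker lfunE /=; split=> [/andP[/eqP da]|[-> a0]].
    rewrite memvE => /subv_bigcapP aU; split=> // l ml.
    have [lr|/phiM_out//] := ltnP l (r i).
    by have := aU (Ordinal lr) ml; rewrite -memvE memv_ker => /eqP.
  rewrite eqxx memvE; apply/subv_bigcapP => l ml.
  by rewrite -memvE memv_ker a0.
pose U i : {vspace M i} := if i < n then fullv else if i == n then U1 i else 0%VS.
have dU i j a : a \in U i -> vdf M i j a \in U j.
  have [ji|ji _] := eqVneq j (i + 1); last by rewrite vdf_shape ?mem0v.
  rewrite /U; case: (ltgtP i n) => [lin _|lni|ein /U1P[]].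
  - case: ltgtP => [_|nj|jn]; first exact: memvf.
      by have := lt_le_trans nj (_ : j <= n); rewrite ltxx ji lezD1 => /(_ lin).
    (* The image of the differential lies in [U1 j] because the forms phi vanish on it. *)
    apply/U1P; rewrite vdf_vdf; split=> // l ml.
    have e : i = j - 1 by rewrite ji addrK.
    by subst i.
  - by rewrite memv0 => /eqP ->; rewrite linear0 mem0v.
  - by rewrite -ji => -> _; rewrite mem0v.
have tauE i x (b : stalk (const_complex (set_type C) M i) x) :
    tau n SM i x b <-> const_ev b \in U i.
  rewrite [tau n SM i x b]/= /U; case: ltgtP => [_|_|ein].
  - by rewrite memvf.
  - rewrite memv0; split=> [->|/eqP b0]; first by rewrite linear0.
    by apply: const_ev_inj; rewrite b0 linear0.
  - split=> [[/const_cycP cb b0]|/U1P[cb b0]]; first exact/U1P.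
    by split=> //; apply/const_cycP.
have gS i x a : tau n SM i x (stalk_map (vsub_cmap dU (set_type C) i) a).
  by apply/tauE; rewrite const_ev_vsub; exact: subvsP.
exists (vsub dU); apply: d_isomorphic_sym.
apply: (quasi_iso_isomorphic (f := sub_cfactor gS)).
apply: quasi_iso_factor_bij => [i x a|i x c].
- move=> /(congr1 (fun b => const_ev b)); rewrite const_ev_vsub linear0 => a0.
  by apply/const_ev_inj/subvs_inj; rewrite a0 !linear0.
move=> /tauE cU; have [a aE] := const_ev_surj x (Subvs cU : subvs_of (U i)).
by exists a; apply: const_ev_inj; rewrite const_ev_vsub aE.
Qed.

End Cell.

(** * The filtration of a complex by cells and degrees *)

Section Chain.
Context (k : fieldType) (T : topologicalType) (X : complex k T).
Context (rho : T -> nat) (N : nat).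
Hypothesis rho_lt : forall x, (rho x < N)%N.
Hypothesis rho_usc : forall x, exists W : opens T, W x /\
  forall y, W y -> (rho y <= rho x)%N.

Let cell j : set T := [set x | rho x = j].

Context (r : nat -> int -> nat)
  (phi : nat -> forall i x, stalk (X i) x -> nat -> k).
Hypothesis tr : forall j i, (j < N)%N ->
  @trivial_on _ _ X i (cell j) (r j i) (@phi j i).

Let Phi i x (a : stalk (X i) x) l := phi (rho x) a l.

Let trP x i := tr i (rho_lt x).

Lemma Phi_bd i x (a : stalk (X i) x) : cyc X i x a ->
  (forall l, Phi a l = 0) <-> bd X i x a.
Proof. by move=> ca; apply: (tr_ker (trP x i)). Qed.

(* All cohomology over the cells < j, none over the cells > j, and over the
   cell j the span of the first m coordinate vectors. *)
Definition chain_fam (j m : nat) i : subfam (X i).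
Proof.
exists (fun x a => cyc X i x a /\
    forall l, (j < rho x)%N || (rho x == j) && (m <= l)%N -> Phi a l = 0).
  move=> x; split=> [|l _]; first exact: sfam0.
  by apply: (Phi_bd _).2; exact: sfam0.
move=> x a u v [cu u0] [cv v0]; split=> [|l h]; first exact: sfamP.
rewrite /Phi (tr_lin (trP x i)) // [phi _ u l]u0 // [phi _ v l]v0 //.
by rewrite mulr0 addr0.
Defined.

Definition chain (j m : nat) : cohfam X.
Proof.
exists (chain_fam j m).
- move=> i x a ba; have ca := bd_cyc ba; split=> // l _.
  exact: (Phi_bd ca).2.
- by move=> i x a [].
move=> i x a [ca a0].
(* Beyond the cell j the germ is a coboundary. It remains one on a neighbourhood, and coboundaries
   satisfy the condition over every cell. *)
have [jx|xj] := ltnP j (rho x).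
  have /open_bd[U [Ux [s [-> bs]]]] : bd X i x a.
    by apply/(Phi_bd ca) => l; rewrite a0 // jx.
  exists U, Ux, s; split=> // y Uy; have cs := bd_cyc (bs y Uy); split=> // l _.
  exact: (Phi_bd cs).2.
(* Near x, rho is at most rho x, hence at most j. A nearby point where there is a condition lies in
   the cell j, and then x does too, so that local constancy of the coordinates along this cell
   applies. *)
have [U [Ux [s [aE cs]]]] := open_cyc ca; subst a.
have [//|W [Wx WE]] := tr_loc (trP x i) cs Ux; have [W' [W'x rW']] := rho_usc x.
have Ox : opensI U (opensI W W') x by [].
exists _, Ox, (res (@opensIl _ U _) s); rewrite (germ_res Ux).
split=> // y Oy; have [Uy [Wy W'y]] := Oy; rewrite (germ_res Uy); split=> // l.
have yx := rW' y W'y; rewrite ltnNge (leq_trans yx xj) /= => /andP[/eqP yj ml].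
have xy : rho x = rho y by apply/eqP; rewrite eqn_leq yx yj xj.
by rewrite /Phi -xy WE // -[LHS]/(Phi _ _) a0 // xy yj eqxx ml orbT.
Defined.

Definition chainc n (j m : nat) := sub_complex (tau n (chain j m)).

Lemma chain_all j i x a : (N <= j)%N -> chain j 0 i x a <-> cyc X i x a.
Proof.
move=> Nj; split=> [[]//|ca]; split=> // l.
have xj := leq_trans (rho_lt x) Nj.
by rewrite ltnNge (ltnW xj) (ltn_eqF xj).
Qed.

Lemma chain0 i x a : chain 0 0 i x a <-> bd X i x a.
Proof.
split=> [[ca a0]|ba].
  by apply/(Phi_bd ca) => l; apply: a0; rewrite leq0n andbT orbC eq_sym -leq_eqVlt.
split=> [|l _]; first exact: bd_cyc.
by apply: (Phi_bd _).2 => //; exact: bd_cyc.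
Qed.

Lemma chain_next j i x a : (j < N)%N -> chain j (r j i) i x a <-> chain j.+1 0 i x a.
Proof.
move=> jN; split=> -[ca a0]; split=> // l h.
  move: h; rewrite leq0n andbT orbC eq_sym -leq_eqVlt => h; apply: a0.
  by rewrite h.
have [jx|xj] := ltnP j (rho x).
  by apply: a0; rewrite leq0n andbT orbC eq_sym -leq_eqVlt.
move: h; rewrite ltnNge xj /= => /andP[/eqP xjE rl].
by apply: (tr_out (trP x i)) => //; rewrite xjE.
Qed.

(** The two families have the same members without being the same term, so the identity of X induces
    the quasi-isomorphism. *)
Lemma chain_next_iso n j : (j < N)%N ->
  d_isomorphic (chainc n j (r j n)) (chainc n j.+1 0).
Proof.
move=> jN; have [g qg] : exists g : cmap (chainc n j (r j n)) (chainc n j.+1 0), quasi_iso g.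
  apply: tau_qis (quasi_iso_id X) _ => x a _.
  by rewrite stalk_cmap_id; exact: chain_next.
exact: quasi_iso_isomorphic qg.
Qed.

(** The quotient is X^n modulo cocycles in degree n and the coboundaries in degree n + 1; the
    differential is an isomorphism between them, and the quotient is acyclic. *)
Lemma chain_degree_iso n : d_isomorphic (chainc n N 0) (chainc (n + 1) 0 0).
Proof.
have SS' i x a : tau n (chain N 0) i x a -> tau (n + 1) (chain 0 0) i x a.
  have [lin _|ni] := leP i n; first by rewrite /= ltzD1 lin.
  by rewrite [X in X -> _]/= ltNge (ltW ni) gt_eqF // => ->; exact: sfam0.
apply: (quasi_iso_isomorphic (f := sub_sub SS')).
apply: quasi_iso_factor => [|i x a b|i x c]; first exact: open_tau.
  move=> /sub_cycP ca _ e; apply/(sub_bdP (@open_tau _ _ _ n _)).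
  have [ni|lni] := ltP n i.
    exists 0; split; first exact: sfam0.
    have := sub_inclP a; rewrite /= ltNge (ltW ni) /= gt_eqF // => ->.
    by rewrite linear0.
  by exists b; split=> //=; rewrite ltrBlDr ltzD1 lni.
have [ein|in1] := eqVneq i (n + 1); first subst i.
  rewrite [X in X -> _]/= ltxx eqxx => /chain0[b ->] _; exists 0, b; split.
  - exact: sfam0.
  - by rewrite /= ltrBlDr ltzD1 lexx.
  - by rewrite linear0 add0r.
move=> tc cc.
have tc' : tau n (chain N 0) i x c.
  move: tc; rewrite [X in X -> _]/= [X in _ -> X]/= (negPf in1) ltzD1; case: (ltgtP i n) => // _ _.
  exact/chain_all.
have [a aE] := sub_incl_surj (@open_tau _ _ _ n (chain N 0) i) tc'.
exists a, 0; split.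
- by apply/sub_cycP; rewrite -aE.
- exact: sfam0.
- by rewrite linear0 addr0.
Qed.

Lemma chain_step n j m : (j < N)%N -> (m < r j n)%N ->
  exists f : cmap (chainc n j m) (chainc n j m.+1),
    d_isomorphic (cone f) (cshift (- n) (single (const_sheaf (cell j) k^o))).
Proof.
move=> jN mr.
have SS' i x a : tau n (chain j m) i x a -> tau n (chain j m.+1) i x a.
  rewrite /=; case: ltgtP => // _ [ca a0]; split=> // l h; apply: a0.
  by case/orP: h => [->//|/andP[-> /ltnW ->]]; rewrite orbT.
(* Passing from m to m + 1 frees the coordinate of index m over the cell j in degree n; this
   coordinate identifies the quotient with the constant sheaf on the cell. *)
pose psi i x (a : stalk (X i) x) : k :=
  if (i == n) && (rho x == j) then Phi a m else 0.
have psi0 i x (a : stalk (X i) x) : bd X i x a -> psi i x a = 0.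
  move=> ba; rewrite /psi; case: ifP => // _.
  by apply: (Phi_bd _).2 => //; exact: bd_cyc.
exists (sub_sub SS'); apply: (step_isomorphic (psi := psi)).
- exact: open_tau.
- exact: open_tau.
(* In degree n the larger family consists of cocycles, whose differential is 0; in the other degrees
   the two families coincide. *)
- move=> i j' x a S'a; have [j'i|j'i] := eqVneq j' (i + 1); last first.
    by rewrite stalk_df_shape //; exact: sfam0.
  have [ein|nin] := eqVneq i n; last first.
    by apply: tau_df; move: S'a; rewrite [X in X -> _]/= [X in _ -> X]/= (negPf nin).
  subst i; move: S'a; rewrite [X in X -> _]/= ltxx eqxx => -[ca _].
  by rewrite ((cycE a j'i).1 ca); exact: sfam0.
- move=> i x a u v; rewrite /psi; case: ifP => [/andP[/eqP ein _]|_ _ _]; last first.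
    by rewrite mulr0 addr0.
  subst i; rewrite [X in X -> _]/= [X in _ -> X -> _]/= ltxx eqxx.
  by move=> -[cu _] [cv _]; exact: (tr_lin (trP x n)).
- move=> i x a; have [ein|nin] := eqVneq i n; last by rewrite /psi /= (negPf nin).
  subst i; rewrite /= /psi ltxx eqxx /= => -[ca a0]; split=> [am|[_ am]].
    split=> // l h; have [lm|lm] := eqVneq l m; last first.
      apply: a0; case/orP: h => [->//|/andP[-> ml]].
      by rewrite [(m < l)%N]ltn_neqAle eq_sym lm ml orbT.
    subst l; move: am; case: eqP => [//|/eqP xj _]; apply: a0.
    by case/orP: h => [->//|]; rewrite (negPf xj).
  by case: eqP => // xj; apply: am; rewrite xj eqxx leqnn orbT.
- by move=> i x a nin; rewrite /psi (negPf nin).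
- by move=> i x a nC _; rewrite /psi; case: (rho x =P j) => // _; rewrite andbF.
- move=> x xj; have := mr; rewrite -[j]xj => mrx.
  have [a [ca a1 a0]] := tr_sur (trP x n) (erefl (rho x)) mrx.
  exists a; rewrite /= /psi ltxx !eqxx /= xj eqxx; split=> //; split=> // l.
  rewrite ?ltnn ?eqxx /= => ml.
  by apply: a0; rewrite gtn_eqF.
- move=> i U s Ss x Ux; have [ein|nin] := eqVneq i n; last first.
    by exists U; split=> // y Uy _ _; rewrite /psi (negPf nin).
  subst i; have {Ss}Ss y (Uy : U y) : chain j m.+1 n y (germ Uy s).
    by have := Ss y Uy; rewrite /= ltxx eqxx.
  have cs y (Uy : U y) := cohf_cyc (Ss y Uy).
  (* Before the cell j, a neighbourhood of x misses this cell by semicontinuity. After it, the germ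
     is a coboundary at x, hence nearby, and psi is 0. On it, the trivialization is locally
     constant. *)
  have [xj|jx|xj] := ltngtP (rho x) j.
  + have [W [Wx rW]] := rho_usc x; exists W; split=> // y Uy Wy yj.
    by have := leq_ltn_trans (rW y Wy) xj; rewrite -[j]yj ltnn.
  + have bx : bd X n x (germ Ux s).
      by apply/(Phi_bd (cs x Ux)) => l; have [_] := Ss x Ux; apply; rewrite jx.
    have [U' [U'x [s' [/germP[O [h [h' [Ox e]]]] bs']]]] := open_bd bx.
    exists O; split=> // y Uy Oy _; rewrite !psi0 //.
    by rewrite -(germ_res Uy Oy h) e (germ_res (h' y Oy)).
  + have [//|W [Wx WE]] := tr_loc (trP x n) cs Ux.
    exists W; split=> // y Uy Wy yj; rewrite /psi /Phi yj xj !eqxx /=.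
    by have := WE y Uy Wy _ m; rewrite /cell /= xj; apply.
Qed.

Lemma chain_start : exists n0 : int, forall n : int, n <= n0 ->
  d_isomorphic (zero_complex k T) (chainc n 0 0).
Proof.
(* The bound b concerns the degrees with |i| > b strictly, so the truncation is 0 once n < - b. *)
have [b Xb] := complex_bounded X; exists (- b%:Z - 1) => n nb.
have X0 i x (a : stalk (X i) x) : i <= n -> a = 0.
  move=> ilen; apply: stalk_eq0; apply: Xb.
  have : i < - b%:Z by apply: le_lt_trans ilen (le_lt_trans nb _); rewrite ltrBlDr ltrDl.
  rewrite -ltz_nat abszE -normrN ltrNr => /lt_le_trans; apply; exact: ler_norm.
have gdf i j (U : opens T) (s : zero_complex k T i U) :
    df X i j U (hzero _ (X i) U s) = hzero _ (X j) U (df (zero_complex k T) i j U s).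
  exact: linear0.
pose g : cmap (zero_complex k T) X := CMap gdf.
have gS i x a : tau n (chain 0 0) i x (stalk_map (g i) a).
  by rewrite [stalk_map _ a]stalk_map_hzero; exact: sfam0.
apply: (quasi_iso_isomorphic (f := sub_cfactor gS)).
apply: quasi_iso_factor_bij => [i x a _|i x c tc].
  by apply: stalk_eq0 => U s; exact: zero_sheafE.
exists 0; rewrite linear0; have [lin|ni] := leP i n; first exact: X0.
by move: tc; rewrite /= ltNge (ltW ni) /= gt_eqF.
Qed.

Lemma chain_end : exists n1 : int, forall n : int, n1 <= n ->
  d_isomorphic X (chainc n 0 0).
Proof.
have [b Xb] := complex_bounded X; exists (b%:Z + 1) => n nb.
have X0 i x (a : stalk (X i) x) : n <= i -> a = 0.
  move=> nlei; apply: stalk_eq0; apply: Xb.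
  have : b%:Z < i by apply: lt_le_trans (le_trans nb nlei); rewrite ltrDl.
  rewrite -ltz_nat abszE => /lt_le_trans; apply; exact: ler_norm.
have gS i x (a : stalk (X i) x) : tau n (chain 0 0) i x (stalk_map (cmap_id X i) a).
  rewrite stalk_cmap_id; have [lin|ni] := ltP i n; first by rewrite /= lin.
  by rewrite (X0 i x a ni); exact: sfam0.
apply: (quasi_iso_isomorphic (f := sub_cfactor gS)).
apply: quasi_iso_factor_bij => [i x a|i x c _]; first by rewrite stalk_cmap_id.
by exists c; rewrite stalk_cmap_id.
Qed.

End Chain.

(** * Distinguished triangles and generation *)

Section Triangles.
Context (k : fieldType) (T : topologicalType).
Implicit Types X Y Z : complex k T.

Lemma dshift_eq n X Y (u v : dmor X Y) :
  dmor_eq u v -> dmor_eq (dshift n u) (dshift n v).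
Proof.
elim=> {X Y u v} /=.
- by move=> X Y u; exact: dmor_eq_refl.
- by move=> X Y u v _; exact: dmor_eq_sym.
- by move=> X Y u v w _ uv _; exact: dmor_eq_trans uv.
- by move=> X Y Z v v' u u' _ vv' _ uu'; exact: dmor_eq_comp.
- by move=> X Y Z W w v u; exact: dmor_eq_assoc.
- move=> X Y u; apply: dmor_eq_trans (dmor_eq_idl _).
  by apply: dmor_eq_comp (dmor_eq_refl _); exact: dmor_eq_map.
- move=> X Y u; apply: dmor_eq_trans (dmor_eq_idr _).
  by apply: dmor_eq_comp (dmor_eq_refl _) _; exact: dmor_eq_map.
- by move=> X Y f g fg; apply: dmor_eq_map => i U s; exact: fg.
- move=> X Y Z g f; apply: dmor_eq_trans (dmor_eq_map_comp _ _) _.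
  exact: dmor_eq_map.
- move=> X Y f qf; apply: dmor_eq_trans (dmor_eq_invl _) _; exact: dmor_eq_map.
- move=> X Y f qf; apply: dmor_eq_trans (dmor_eq_invr _) _; exact: dmor_eq_map.
Qed.

Lemma dcompKl X Y Z (u : dmor Y Z) (u' : dmor Z Y) (w : dmor X Z) :
  dmor_eq (dcomp u u') (did Z) -> dmor_eq (dcomp u (dcomp u' w)) w.
Proof.
move=> uu'; apply: dmor_eq_trans (dmor_eq_assoc _ _ _) _.
by apply: dmor_eq_trans (dmor_eq_idl _); exact: dmor_eq_comp (dmor_eq_refl _).
Qed.

Lemma cone_triangle A B Z X Y (f : cmap X Y) :
  d_isomorphic A X -> d_isomorphic B Y -> d_isomorphic Z (cone f) ->
  exists (u : dmor A B) (v : dmor B Z) (w : dmor Z (cshift 1 A)), distinguished u v w.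
Proof.
move=> [a [a' [a'a aa']]] [b [b' [b'b bb']]] [c [c' [c'c cc']]].
exists (dcomp b' (dcomp (dmap f) a)), (dcomp c' (dcomp (dmap (cone_in f)) b)).
exists (dcomp (dshift 1 a') (dcomp (dmap (cone_out f)) c)), X, Y, f, a, b, c.
split; first by split; [exists a'|exists b'|exists c'].
split; [exact: dcompKl|exact: dcompKl|apply: dcompKl].
apply: dmor_eq_trans (dshift_eq 1 aa') _; exact: dmor_eq_map.
Qed.

Lemma df_hdelta Y i i' j j' (U : opens T) (s : Y i' U) : i' = i -> j' = j ->
  df Y i j U (hdelta Y i' i U s) = hdelta Y j' j U (df Y i' j' U s).
Proof. by move=> ei ej; subst i j; rewrite !hdelta_id. Qed.

(** The degrees i + 0 and i are not convertible, and [hdelta] provides the identification of the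
    terms. *)
Lemma cshift0_isomorphic Y : d_isomorphic (cshift 0 Y) Y.
Proof.
have gdf i j (U : opens T) (s : cshift 0 Y i U) :
    df Y i j U (hdelta Y (i + 0) i U s)
    = hdelta Y (j + 0) j U (df (cshift 0 Y) i j U s).
  rewrite (@df_hdelta Y i (i + 0) j (j + 0)) ?addr0 //.
  by congr (hdelta Y (j + 0) j U _); rewrite /= expr0z scale1r.
have gbij i i' x : i' = i -> bijective (fun a : stalk (Y i') x => stalk_map (hdelta Y i' i) a).
  move=> e; subst i; exists id => a; rewrite -[RHS]stalk_map_id;
    by apply: stalk_map_ext => U s; rewrite hdelta_id.
have gb i x := gbij i (i + 0) x (addr0 i).
apply: (quasi_iso_isomorphic (f := CMap gdf)); apply: quasi_iso_bij => i x a.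
  move=> /= a0; apply: (bij_inj (gb i x)); rewrite a0.
  exact/esym/(linear0 (stalk_map (hdelta Y (i + 0) i) (x := x))).
by have [h _ hK] := gb i x; exists (h a); rewrite hK.
Qed.

Section Zero.
Variable Y : complex k T.

Lemma zero_stalk i x (a : stalk (zero_complex k T i) x) : a = 0.
Proof. by apply: stalk_eq0 => U s; exact: zero_sheafE. Qed.

Definition from_zero : cmap (zero_complex k T) Y.
Proof. by exists (fun i => hzero _ _) => i j U s /=; exact: linear0. Defined.

Definition to_zero : cmap Y (zero_complex k T).
Proof. by exists (fun i => hzero _ _). Defined.

Lemma cone_from_zero : d_isomorphic Y (cone from_zero).
Proof.
apply: (quasi_iso_isomorphic (f := cone_in from_zero)).
apply: quasi_iso_bij => i x b.
  by move=> b0; rewrite -(cone_in_snd from_zero b) b0 linear0.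
exists (stalk_map (cone_snd from_zero i) b); apply: cone_ext.
  by rewrite cone_in_fst; exact: zero_stalk.
by rewrite cone_in_snd.
Qed.

Lemma cone_to_zero : d_isomorphic (cshift 1 Y) (cone to_zero).
Proof.
apply: d_isomorphic_sym; apply: (quasi_iso_isomorphic (f := cone_out to_zero)).
apply: quasi_iso_bij => i x b.
  move=> b0; apply: cone_ext; first by rewrite linear0; exact: b0.
  by rewrite [LHS]zero_stalk [RHS]zero_stalk.
have [c [c1 _]] := cone_pair to_zero b 0; exists c; exact/esym.
Qed.

End Zero.

Section Generation.
Variables G D : complex k T -> Prop.

(* Nonempty filtrations, so that the last object can be replaced by an
   isomorphic one. *)
Definition filtered X : Prop := exists (N : nat) (Fs : nat -> complex k T),
  [/\ Fs 0%N = zero_complex k T, Fs N.+1 = X, (forall i, (i <= N.+1)%N -> D (Fs i)) &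
    forall i, (i < N.+1)%N -> exists (m : int) (H X' Y' : complex k T) (f : cmap X' Y'),
      [/\ G H, d_isomorphic (Fs i) X', d_isomorphic (Fs i.+1) Y' &
         d_isomorphic (cshift m H) (cone f)]].

Lemma filtered_iso X Y : filtered X -> D Y -> d_isomorphic Y X -> filtered Y.
Proof.
move=> [N [Fs [F0 FN DF tF]]] DY YX.
exists N, (fun i => if i == N.+1 then Y else Fs i); split=> //; rewrite ?eqxx //.
  by move=> i iN; case: eqP => // _; exact: DF.
move=> i iN; have [m [H [X' [Y' [f [GH iX iY iH]]]]]] := tF i iN.
exists m, H, X', Y', f; rewrite (ltn_eqF iN); split=> //.
have [e|//] := eqVneq i.+1 N.+1.
by apply: d_isomorphic_trans YX _; rewrite -FN -e.
Qed.

Lemma filtered_step X Y m H (f : cmap X Y) : filtered X -> D Y -> G H ->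
  d_isomorphic (cone f) (cshift m H) -> filtered Y.
Proof.
move=> [N [Fs [F0 FN DF tF]]] DY GH fH.
exists N.+1, (fun i => if i == N.+2 then Y else Fs i); split=> //; rewrite ?eqxx //.
  move=> i; rewrite leq_eqVlt ltnS; case: eqP => //= _; exact: DF.
move=> i; rewrite ltnS leq_eqVlt => /orP[/eqP->|iN].
  rewrite eqxx ltn_eqF // FN.
  by exists m, H, X, Y, f; split=> //; [exact: d_isomorphic_refl
    |exact: d_isomorphic_refl|exact: d_isomorphic_sym].
have [m' [H' [X' [Y' [f' [GH' iX iY iH]]]]]] := tF i iN.
exists m', H', X', Y', f'; rewrite ltn_eqF ?(leq_trans iN) // ltn_eqF //.
Qed.

(** A filtration starts at [zero_complex] itself, so an object merely isomorphic to it has to be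
    reached by triangles: 0 -> H -> H adds a generator, and H -> 0 -> H[1] removes it. *)
Lemma filtered_zero H X : G H -> (forall H, G H -> D H) -> D (zero_complex k T) ->
  D X -> d_isomorphic X (zero_complex k T) -> filtered X.
Proof.
move=> GH GD D0 DX X0; have DH := GD _ GH.
suff H1 : filtered H.
  apply: filtered_iso X0 => //.
  apply: (filtered_step (f := to_zero H) (m := 1) H1 _ GH) => //.
  exact/d_isomorphic_sym/cone_to_zero.
exists 0%N, (fun i => if i is 0%N then zero_complex k T else H); split=> //.
  by case.
case=> // _; exists 0, H, _, _, (from_zero H); split=> //.
- exact: d_isomorphic_refl.
- exact: d_isomorphic_refl.
- apply: d_isomorphic_trans (cone_from_zero H); exact: cshift0_isomorphic.
Qed.

Lemma filtered_generates :
  (forall H, G H -> D H) -> (forall X, D X -> filtered X) -> generates G D.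
Proof.
move=> GD DF; split=> // X /DF[N [Fs [F0 FN DFs tF]]].
exists N.+1, Fs; split=> // i iN.
have [m [H [X' [Y' [f [GH iX iY iH]]]]]] := tF i iN.
exists m, H, H; split=> //; split; first exact: d_isomorphic_refl.
exact: cone_triangle iH.
Qed.

End Generation.

End Triangles.

(** * Hyperplane arrangements *)

Section Arrangement.
Context (R : realType) (V : vectType R).

Lemma linear_coordinates (f : {linear V -> R^o}) (v : V) :
  f v = \sum_i coordinates v ord0 i * f (vbasis {:V})`_i.
Proof.
rewrite {1}(coord_vbasis (memvf v)) linear_sum; apply: eq_bigr => i _.
by rewrite linearZ /= mxE.
Qed.

Lemma linear_continuous_vect (f : {linear V -> R^o}) :
  continuous (f : vect_top V -> R).
Proof.
have -> : (f : vect_top V -> R) =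
    (fun M : 'rV[R]_(\dim {:V}) => \sum_i M ord0 i * f (vbasis {:V})`_i)
    \o @coordinates R V by apply/funext => v; exact: linear_coordinates.
move=> v; apply: continuous_comp; first exact: initial_continuous.
apply: continuous_big => [x|i _ x]; first exact: add_continuous.
apply: (@continuous_comp _ _ _ (fun M : 'rV[R]_(\dim {:V}) => M ord0 i)
  (fun t => t * f (vbasis {:V})`_i)); first exact: coord_continuous.
exact: mulrr_continuous.
Qed.

Record aform := AForm {
  afun : {linear V -> R^o};
  acst : R;
  aform_neq0 : exists v, afun v != 0 }.

Definition oppf (f : {linear V -> R^o}) : {linear V -> R^o} := \- f.

Definition opp_aform (a : aform) : aform.
Proof.
apply: (@AForm (oppf (afun a)) (- acst a)).
by have [v fv] := aform_neq0 a; exists v; rewrite /= oppr_eq0.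
Defined.

(* The digit of the equality case is the largest one, so that the code [rho] of
   sign vectors is upper semicontinuous. *)
Definition digit (a : aform) (x : vect_top V) : nat :=
  if afun a x < acst a then 0 else if afun a x == acst a then 2 else 1.

Definition rho (L : seq aform) (x : vect_top V) : nat :=
  foldr (fun a n => digit a x + 3 * n)%N 0%N L.

Lemma digit_lt a x : (digit a x < 3)%N.
Proof. by rewrite /digit; case: ifP => // _; case: ifP. Qed.

Lemma rho_lt L x : (rho L x < 3 ^ size L)%N.
Proof.
elim: L => //= a L IH; rewrite expnS (leq_trans (n := 3 + 3 * rho L x)) //.
  by rewrite ltn_add2r digit_lt.
by rewrite -mulnS leq_pmul2l.
Qed.

Lemma rho_cons a L x j : (rho (a :: L) x = j) <->
  digit a x = (j %% 3)%N /\ rho L x = (j %/ 3)%N.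
Proof.
split=> [<-|[d r]] /=.
  by rewrite addnC mulnC modnMDl divnMDl // modn_small ?divn_small ?digit_lt ?addn0.
by rewrite d r addnC mulnC -divn_eq.
Qed.

Lemma rho_cons_inj a L x y : rho (a :: L) x = rho (a :: L) y ->
  digit a x = digit a y /\ rho L x = rho L y.
Proof.
by move=> /rho_cons[-> ->]; have [-> ->] := (rho_cons a L y _).1 erefl.
Qed.

Lemma rho_cat L L' x y : rho (L ++ L') x = rho (L ++ L') y ->
  rho L x = rho L y /\ rho L' x = rho L' y.
Proof.
elim: L => [//|a L IH]; rewrite cat_cons => /rho_cons_inj[d /IH[e e']].
by rewrite /= d e.
Qed.

Lemma rho_flatten (I : eqType) (g : I -> seq aform) (s : seq I) x y :
  rho (flatten (map g s)) x = rho (flatten (map g s)) y ->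
  forall i, i \in s -> rho (g i) x = rho (g i) y.
Proof.
elim: s => // j s IH /= /rho_cat[e /IH e'] i.
by rewrite inE => /orP[/eqP->|/e'].
Qed.

Lemma half_space_form (H : set (vect_top V)) : half_space H -> exists a,
  forall x y, digit a x = digit a y -> H x -> H y.
Proof.
move=> [f [c [f0 H_fc]]]; exists (AForm c f0) => x y; rewrite /digit /=.
have [xc|xc|xc] := ltgtP (f x) c; have [yc|yc|yc] := ltgtP (f y) c => // _;
  by case: H_fc => -> /=; rewrite ?xc ?yc ?ltxx ?(ltW xc) ?(ltW yc) //
    ?[f x < c]lt_gtF ?[f x <= c]lt_geF.
Qed.

Lemma polyhedron_forms (P : set (vect_top V)) : convex_polyhedron P ->
  exists L, forall x y, rho L x = rho L y -> P x -> P y.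
Proof.
move=> [n [H [hH ->]]]; have [a aP] := choice (fun i => half_space_form (hH i)).
exists (flatten [seq [:: a i] | i <- enum 'I_n]) => x y e Px i _.
have /rho_cons_inj[d _] := rho_flatten e (mem_enum 'I_n i).
exact: aP d (Px i I).
Qed.

Lemma cover_forms (n : nat) (P : 'I_n -> set (vect_top V)) :
  (forall a, convex_polyhedron (P a)) -> \bigcup_a P a = setT ->
  exists L, forall x, exists a, forall y, rho L y = rho L x -> P a y.
Proof.
move=> hP cov; have [L LP] := choice (fun a => polyhedron_forms (hP a)).
exists (flatten [seq L a | a <- enum 'I_n]) => x.
have [a _ Pax] : (\bigcup_a P a) x by rewrite cov.
exists a => y /esym e; apply: LP Pax; exact: rho_flatten e a (mem_enum 'I_n a).
Qed.

Lemma polyhedronT : convex_polyhedron (setT : set (vect_top V)).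
Proof.
exists 0%N, (fun=> setT); split=> [[]//|].
by apply/seteqP; split=> // x _ [].
Qed.

Lemma polyhedron_half_space (H : set (vect_top V)) :
  half_space H -> convex_polyhedron H.
Proof.
move=> hH; exists 1%N, (fun=> H); split=> //.
apply/seteqP; split=> [x Hx i _ //|x /(_ ord0 I)//].
Qed.

Lemma polyhedronI (P Q : set (vect_top V)) :
  convex_polyhedron P -> convex_polyhedron Q -> convex_polyhedron (P `&` Q).
Proof.
move=> [m [H [hH ->]]] [n [K [hK ->]]].
exists (m + n)%N, (fun i => match fintype.split i with inl i => H i | inr i => K i end).
split=> [i|]; first by case: fintype.split.
apply/seteqP; split=> [x [Hx Kx] i _|x HKx].
  by case: fintype.split => j; [exact: Hx|exact: Kx].
split=> i _.
  by have := HKx (unsplit (inl i)) I; rewrite unsplitK.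
by have := HKx (unsplit (inr i)) I; rewrite unsplitK.
Qed.

Lemma half_space_lt a : half_space [set x : vect_top V | afun a x < acst a].
Proof. by exists (afun a), (acst a); split; [exact: aform_neq0|left]. Qed.

Lemma half_space_le a : half_space [set x : vect_top V | afun a x <= acst a].
Proof. by exists (afun a), (acst a); split; [exact: aform_neq0|right]. Qed.

(** Half-spaces are given by < and <= only: the digit 1 is an open half-space of the opposite form,
    and the digit 2 is the intersection of two opposite closed ones. *)
Lemma polyhedron_digit a d : (d < 3)%N ->
  convex_polyhedron [set x | digit a x = d].
Proof.
move=> d3; have [d0|d1|d2] : [\/ d = 0, d = 1 | d = 2]%N.
- by case: d d3 => [|[|[|]]] // _; [constructor 1|constructor 2|constructor 3].
- rewrite (_ : [set x | _] = [set x : vect_top V | afun a x < acst a]).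
    exact/polyhedron_half_space/half_space_lt.
  by apply/seteqP; split=> x; rewrite /= /digit d0; case: ltgtP.
- rewrite (_ : [set x | _] =
      [set x : vect_top V | afun (opp_aform a) x < acst (opp_aform a)]).
    exact/polyhedron_half_space/half_space_lt.
  by apply/seteqP; split=> x; rewrite /= /digit d1 ltrN2; case: ltgtP.
- rewrite (_ : [set x | _] = [set x : vect_top V | afun a x <= acst a] `&`
      [set x : vect_top V | afun (opp_aform a) x <= acst (opp_aform a)]).
    by apply: polyhedronI; exact/polyhedron_half_space/half_space_le.
  apply/seteqP; split=> x; rewrite /= /digit d2 lerN2; last case; case: ltgtP => //.
Qed.

Lemma polyhedron_cell L j : (j < 3 ^ size L)%N ->
  convex_polyhedron [set x | rho L x = j].
Proof.
elim: L j => [|a L IH] j /=.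
  rewrite expn0 ltnS leqn0 => /eqP ->.
  rewrite (_ : [set x | _] = setT); first exact: polyhedronT.
  by apply/seteqP; split.
rewrite expnS => jL; rewrite (_ : [set x | _] =
  [set x | digit a x = (j %% 3)%N] `&` [set x | rho L x = (j %/ 3)%N]).
  apply: polyhedronI; first exact/polyhedron_digit/ltn_pmod.
  by apply: IH; rewrite ltn_divLR // mulnC.
by apply/seteqP; split=> x /=; rewrite -/(rho (a :: L) x); move/rho_cons.
Qed.

Lemma open_afun a : open [set x : vect_top V | afun a x < acst a].
Proof.
have /continuousP := @linear_continuous_vect (afun a).
by move=> /(_ [set t | t < acst a]); apply; exact: open_lt.
Qed.

Lemma rho_usc (L : seq aform) (x : vect_top V) : exists W : opens (vect_top V),
  W x /\ forall y, W y -> (rho L y <= rho L x)%N.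
Proof.
elim: L => [|a L [W [Wx WL]]]; first by exists (opensT _).
have [O [Ox OL]] : exists O : opens (vect_top V),
    O x /\ forall y, O y -> (digit a y <= digit a x)%N.
  rewrite /digit; have [xa|xa|xa] := ltgtP (afun a x) (acst a).
  - by exists (Opens (open_afun a)); split=> // y; rewrite /omem /= => ->.
  - exists (Opens (open_afun (opp_aform a))); split.
      by rewrite /omem /= ltrN2.
    by move=> y; rewrite /omem /= ltrN2; case: ltgtP.
  - exists (opensT _); split=> // y _; case: ifP => // _; by case: ifP.
exists (opensI O W); split=> // y [Oy Wy] /=.
by rewrite leq_add ?OL // leq_pmul2l // WL.
Qed.

Lemma open_rho_lt L j : open [set x | (rho L x < j)%N].
Proof.
rewrite openE => x xj; have [W [Wx WL]] := rho_usc L x.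
rewrite /interior nbhsE; exists (oset W); first by split=> //; exact: oset_open.
by move=> y /WL yx; exact: leq_ltn_trans yx xj.
Qed.

Lemma locally_closed_cell L j : locally_closed [set x | rho L x = j].
Proof.
exists [set x | (rho L x < j.+1)%N], (~` [set x | (rho L x < j)%N]); split.
- exact: open_rho_lt.
- exact/open_closedC/open_rho_lt.
apply/seteqP; split=> x /=; first by move=> ->; rewrite ltnn ltnS leqnn.
by rewrite ltnS => -[xj /negP]; rewrite -leqNgt => jx; apply/eqP; rewrite eqn_leq xj.
Qed.

End Arrangement.

(** * Piecewise linear objects *)

Section Main.
Context (R : realType) (V : vectType R) (k : fieldType).
Implicit Types X Y : complex k (vect_top V).

Lemma is_PL_iso X Y : d_isomorphic X Y -> is_PL Y -> is_PL X.
Proof.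
move=> XY [n [P [hP cov PY]]]; exists n, P; split=> // a.
apply: constant_finite_rank_iso (PY a).
by apply: isomorphic_inv XY; exact: initial_continuous.
Qed.

Definition constant_on X (C : set (vect_top V)) : Prop :=
  constant_finite_rank (inv_complex (set_val (A := C)) X).

Lemma is_PL_cells X (L : seq (aform V)) :
  (forall j, (j < 3 ^ size L)%N -> constant_on X [set x | rho L x = j]) ->
  is_PL X.
Proof.
move=> XL; exists (3 ^ size L)%N, (fun j => [set x | rho L x = j]); split.
- by move=> j; exact: polyhedron_cell.
- by apply/seteqP; split=> // x _; exists (Ordinal (rho_lt L x)).
- by move=> j; exact: XL.
Qed.

Lemma is_PL_forms X : is_PL X -> exists L : seq (aform V),
  forall j, (j < 3 ^ size L)%N -> constant_on X [set x | rho L x = j].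
Proof.
move=> [n [P [hP cov PX]]]; have [L LP] := cover_forms hP cov.
exists L => j jL.
have [a aP] : exists a, [set x | rho L x = j] `<=` P a.
  have [[x xj]|no] := pselect (exists x, rho L x = j).
    by have [a aP] := LP x; exists a => y /= yj; apply: aP; rewrite yj.
  (* An empty cell is contained in any of the polyhedra; the origin only serves to obtain an
     index. *)
  by have [a _] := LP 0; exists a => y yj; case: no; exists y.
exact: constant_finite_rank_subset aP (PX a).
Qed.

Section PolyhedronSheaf.
Variable P : set (vect_top V).
Hypothesis lcP : locally_closed P.

Let X := single (const_sheaf P (k^o : lmodType k)).

Definition vsingle : vcomplex k.
Proof.
exists (fun i : int => if i == 0 then (k^o : vectType k) else 'rV[k]_0)
  (fun i j => \0 : {linear _ -> _}) => //.
by exists 0%N => -[[|i]|i] //= _ s; exact: thinmx0.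
Defined.

Definition vzero : vcomplex k.
Proof.
exists (fun i : int => 'rV[k]_0) (fun i j => \0 : {linear _ -> _}) => //.
by exists 0%N => i _ s; exact: thinmx0.
Defined.

Section Restrict.
Variable Z : set (vect_top V).

Let v := set_val (A := Z).
Let cv : continuous v. Proof. exact: initial_continuous. Qed.

Lemma inv_single_df i j (U : opens Z) (s : inv_complex v X i U) :
  df (inv_complex v X) i j U s = 0.
Proof. by apply: lsec_ext => y Uy; exact: stalk_map_hzero. Qed.

Lemma constant_on_sub : Z `<=` P -> constant_on X Z.
Proof.
move=> ZP; have Pv y : P (v y) by apply: ZP; exact: set_valP.
(* As for [hom_if], both complexes branch on the test of the degree, and the map is built over the
   boolean. *)
pose h (b : bool) :
  hom (inv_sheaf v (if b then const_sheaf P (k^o : lmodType k) else zero_sheaf k _))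
      (const_sheaf setT (if b then (k^o : vectType k) else 'rV[k]_0)) :=
  if b as b' return
    hom (inv_sheaf v (if b' then const_sheaf P (k^o : lmodType k) else zero_sheaf k _))
      (const_sheaf setT (if b' then (k^o : vectType k) else 'rV[k]_0))
  then inv_const_hom cv (k^o) Pv
  else inv_const_hom cv 'rV[k]_0 (Z := setT) (fun=> I).
have h_inj b y a : stalk_map (h b) a = 0 -> a = 0 :> stalk _ y.
  by case: b a => a /(congr1 (fun c => const_ev c)); rewrite const_ev_inv linear0 => a0;
    apply/(iev_inj cv)/const_ev_inj; rewrite !linear0.
have h_surj b y c : exists a : stalk _ y, c = stalk_map (h b) a.
  case: b c => c.
    have [d dE] := const_ev_locally_closed (M := k^o) (const_ev c) lcP (Pv y).
    have [a aE] := iev_surj cv d; exists a.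
    by apply: const_ev_inj; rewrite const_ev_inv aE.
  have [d dE] := const_ev_surj (v y) (const_ev c).
  have [a aE] := iev_surj cv d; exists a.
  by apply: const_ev_inj; rewrite const_ev_inv aE.
have gdf i j (U : opens Z) (s : inv_complex v X i U) :
    df (const_complex Z vsingle) i j U (h (i == 0) U s)
    = h (j == 0) U (df (inv_complex v X) i j U s).
  by rewrite inv_single_df linear0; apply: lsec_ext => y Uy.
exists vsingle; apply: (quasi_iso_isomorphic (f := CMap gdf)).
by apply: quasi_iso_bij => i y a; [exact: h_inj|exact: h_surj].
Qed.

Lemma constant_on_disjoint : (forall x, Z x -> ~ P x) -> constant_on X Z.
Proof.
move=> ZP; have X0 i y (a : stalk (inv_complex v X i) y) : a = 0.
  apply: (iev_inj cv); rewrite linear0; move: (iev a) => {a}.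
  rewrite /X /single /=; case: (i == 0) => b.
    apply: const_ev_inj; rewrite linear0 const_ev_out //.
    by apply: ZP; exact: set_valP.
  by apply: stalk_eq0 => U s; exact: zero_sheafE.
have gdf i j (U : opens Z) (s : inv_complex v X i U) :
    df (const_complex Z vzero) i j U (hzero _ (const_complex Z vzero i) U s)
    = hzero _ (const_complex Z vzero j) U (df (inv_complex v X) i j U s).
  exact: linear0.
exists vzero; apply: (quasi_iso_isomorphic (f := CMap gdf)).
apply: quasi_iso_bij => i y a; first by move=> _; exact: X0.
exists 0; rewrite linear0; apply: stalk_eq0 => U s.
by apply: lsec_ext => z Uz; exact: thinmx0.
Qed.

End Restrict.

End PolyhedronSheaf.

Lemma polyhedron_sheaf_is_PL X : polyhedron_sheaf X -> is_PL X.
Proof.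
move=> [P [/polyhedron_forms[L LP] lcP ->]]; apply: (is_PL_cells (L := L)) => j _.
have [[x xj Px]|no] := pselect (exists2 x, rho L x = j & P x).
  by apply: constant_on_sub => // y yj; apply: LP Px; rewrite xj yj.
by apply: constant_on_disjoint => // x xj Px; apply: no; exists x.
Qed.

Lemma is_PL_filtered X : is_PL X ->
  filtered (@polyhedron_sheaf R V k) (@is_PL R V k) X.
Proof.
move=> PX; have [L LX] := is_PL_forms PX; pose N := (3 ^ size L)%N.
pose cell j := [set x | rho L x = j].
(* The bound on j is placed under the existential quantifiers, so that r and phi can be chosen for
   all j at once. *)
have cellP j : exists (r : int -> nat) (phi : forall i x, stalk (X i) x -> nat -> k),
    (j < N)%N -> (forall i, @trivial_on _ _ X i (cell j) (r i) (phi i)) /\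
    forall n m (S : cohfam X), (forall x a, cell j x -> cyc X n x a ->
         S n x a <-> forall l, (m <= l)%N -> phi n x a l = 0) ->
      constant_on (sub_complex (tau n S)) (cell j).
  have [jN|_] := boolP (j < N)%N; last by exists (fun=> 0%N), (fun _ _ _ _ => 0).
  have [r [phi rphi]] := cell_data (LX j jN); by exists r, phi.
pose r j := projT1 (cid (cellP j)); pose cellP' j := projT2 (cid (cellP j)).
pose phi j := projT1 (cid (cellP' j)).
have data j : (j < N)%N -> (forall i, @trivial_on _ _ X i (cell j) (r j i) (phi j i)) /\
    forall n m (S : cohfam X), (forall x a, cell j x -> cyc X n x a ->
         S n x a <-> forall l, (m <= l)%N -> phi j n x a l = 0) ->
      constant_on (sub_complex (tau n S)) (cell j).
  exact: projT2 (cid (cellP' j)).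
clearbody phi; clear cellP'; clearbody r => {cellP}.
have tr j i : (j < N)%N -> @trivial_on _ _ X i (cell j) (r j i) (phi j i).
  by move=> /data[].
pose A n j m := chainc (rho_lt L) (rho_usc L) tr n j m.
have PLA n j m : is_PL (A n j m).
  apply: (is_PL_cells (L := L)) => j' j'N; have [_ cst] := data j' j'N.
  (* This is the number of coordinate vectors kept over the cell j': all of them before j, m over j,
     none after. *)
  pose m' := if (j' < j)%N then r j' n else if j' == j then m else 0%N.
  apply: (cst n m') => x a xj' ca; rewrite /m'.
  have e : rho L x = j' := xj'; subst j' => {xj'}.
  have [xj|jx|xj] := ltngtP (rho L x) j; (split=> [[_ a0] l ml|a0]; last split=> // l).
  - exact: (tr_out (tr _ n j'N) erefl ca ml).
  - by rewrite ltnNge (ltnW xj) ltn_eqF.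
  - by apply: a0; rewrite jx.
  - by move=> _; exact: a0.
  - by apply: a0; rewrite xj eqxx ml orbT.
  - by case/orP=> [|/andP[_]]; [rewrite xj ltnn|exact: a0].
have cellG j : (j < N)%N -> @polyhedron_sheaf R V k (single (const_sheaf (cell j) k^o)).
  move=> jN; exists (cell j); split=> //; first exact: polyhedron_cell.
  exact: locally_closed_cell.
have Amap n j m : (j < N)%N -> (m <= r j n)%N ->
    filtered (@polyhedron_sheaf R V k) (@is_PL R V k) (A n j 0%N) ->
    filtered (@polyhedron_sheaf R V k) (@is_PL R V k) (A n j m).
  move=> jN; elim: m => // m IH mr F0.
  have [f fP] := chain_step (rho_lt L) (rho_usc L) tr jN mr.
  exact: filtered_step (IH (ltnW mr) F0) (PLA _ _ _) (cellG j jN) fP.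
have Acell n j : (j <= N)%N ->
    filtered (@polyhedron_sheaf R V k) (@is_PL R V k) (A n 0%N 0%N) ->
    filtered (@polyhedron_sheaf R V k) (@is_PL R V k) (A n j 0%N).
  elim: j => // j IH jN F0.
  apply: filtered_iso (Amap n j (r j n) jN (leqnn _) (IH (ltnW jN) F0)) (PLA _ _ _) _.
  exact/d_isomorphic_sym/chain_next_iso.
have [n0 A0] := chain_start (rho_lt L) (rho_usc L) tr.
have At (t : nat) : filtered (@polyhedron_sheaf R V k) (@is_PL R V k)
    (A (n0 + t%:Z) 0%N 0%N).
  elim: t => [|t IH].
    (* The truncation at n0 is zero up to isomorphism; the constant sheaf on the whole space is the
       auxiliary generator by which it is reached. *)
    have Z0 := A0 (n0 + 0) (ler_wnDr (lexx 0) (lexx n0)).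
    apply: (filtered_zero (H := single (const_sheaf setT k^o))) => //.
    - by exists setT; split=> //; [exact: polyhedronT|exact: locally_closedT].
    - exact: polyhedron_sheaf_is_PL.
    - exact: is_PL_iso Z0 (PLA _ _ _).
    - exact: d_isomorphic_sym.
  apply: filtered_iso (Acell _ N (leqnn _) IH) (PLA _ _ _) _.
  rewrite -addn1 PoszD addrA; exact/d_isomorphic_sym/chain_degree_iso.
have [n1 X1] := chain_end (rho_lt L) (rho_usc L) tr.
(* From n0, moving up by |n1 - n0| degrees reaches at least n1, whichever of the two is larger. *)
apply: filtered_iso (At `|n1 - n0|%N) PX _; apply: X1.
by rewrite -lerBlDl abszE ler_norm.
Qed.

End Main.

Theorem theorem2p16 (R : realType) (V : vectType R) (k : fieldType) :
  generates (@polyhedron_sheaf R V k) (@is_PL R V k).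
Proof.
apply: filtered_generates; first exact: polyhedron_sheaf_is_PL.
exact: is_PL_filtered.
Qed.
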